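(* With respect to the automorphism $\theta^{-1}$ of $\mathcal{O}(\mathrm{S}_q^2)$ given by $\theta^{-1}(b)=K^2\triangleright b$, the equivariant $K_0$-group $K_0^{\mathcal{U}_q(\mathrm{su}_2)}(\mathcal{O}(\mathrm{S}_q^2))$ is isomorphic to the free abelian group with one generator, $[P_N]$, for each $N\in\mathbb{Z}$.
   Context: Let $q>0$, $q\neq 1$, $[x]_q=\frac{q^x-q^{-x}}{q-q^{-1}}$. $\mathcal{U}_q(\mathrm{su}_2)$ is the Hopf *-algebra generated by $E,F,K,K^{-1}$ with $KK^{-1}=K^{-1}K=1$, $KE=qEK$, $FK=qKF$, $EF-FE=\frac{1}{q-q^{-1}}(K^2-K^{-2})$, $E^*=F$, $K^*=K$, $\Delta(E)=E\otimes K+K^{-1}\otimes E$, $\Delta(F)=F\otimes K+K^{-1}\otimes F$, $\Delta(K)=K\otimes K$, $\varepsilon(E)=\varepsilon(F)=\varepsilon(K-1)=0$, $S(K)=K^{-1}$, $S(E)=-qE$, $S(F)=-q^{-1}F$. Sweedler notation $\Delta(f)=f_{(1)}\otimes f_{(2)}$ is used. $\mathcal{O}(\mathrm{SU}_q(2))$ is the coordinate Hopf *-algebra of quantum $\mathrm{SU}(2)$, generated by $a,b,c,d$ with $ab=qba$, $ac=qca$, $bd=qdb$, $cd=qdc$, $bc=cb$, $ad-da=(q-q^{-1})bc$, $ad-qbc=1$, $a^*=d$, $b^*=-qc$. It has the Peter-Weyl basis $t^l_{jk}$ ($l\in\frac12\mathbb{N}_0$, $j,k=-l,\dots,l$) of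 matrix elements of irreducible unitary corepresentations, with $t^{1/2}=\begin{pmatrix}a&b\\c&d\end{pmatrix}$ (rows/columns indexed by $-\frac12,\frac12$). The Haar state is $h(t^0_{00})=1$, $h(t^l_{jk})=0$ for $l>0$; the elements $v^l_{jk}=[2l+1]_q^{1/2}q^jt^l_{jk}$ are orthonormal for $\langle x,y\rangle=h(x^*y)$. With $\alpha^l_j=([l-j]_q[l+j+1]_q)^{1/2}$, the left action of $\mathcal{U}_q(\mathrm{su}_2)$ is $E\triangleright v^l_{jk}=\alpha^l_kv^l_{j,k+1}$, $F\triangleright v^l_{jk}=\alpha^l_{k-1}v^l_{j,k-1}$, $K\triangleright v^l_{jk}=q^kv^l_{jk}$, and there is a representation $f\mapsto\partial_f$, commuting with the left action, with $\partial_K(v^l_{jk})=q^{-j}v^l_{jk}$. The standard Podleś sphere is $\mathcal{O}(\mathrm{S}_q^2)=\{x\in\mathcal{O}(\mathrm{SU}_q(2)):\partial_{K^2}(x)=x\}$, a left $\mathcal{U}_q(\mathrm{su}_2)$-module *-algebra, i.e. $f\triangleright(xy)=(f_{(1)}\triangleright x)(f_{(2)}\triangleright y)$, $f\triangleright 1=\varepsilon(f)1$, $(f\triangleright x)^*=S(f)^*\triangleright x^*$. Projections $P_N$. For $n\in\frac12\mathbb{Z}$, $l\in\{|n|,|n|+1,\dots\}$, let $\mathbf{t}^l_n=(t^l_{n,-l},\dots,t^l_{n,l})$ (row vector) and let $\mathbf{t}^{l*}_n$ be its conjugate transpose (the column vector with entries $t^{l*}_{n,k}$). Let $\sigma_l(f)$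 be the matrix with $f\triangleright v^l_{nk}=\sum_j\sigma_l(f)_{jk}v^l_{nj}$ and $\rho_l^\circ(f)=\sigma_l(K^{-1}S(f)K)$, a *-representation of the opposite algebra $\mathcal{U}_q(\mathrm{su}_2)^\circ$ on $\mathbb{C}^{2l+1}$. For $N\in\mathbb{Z}$, $P_N:=\rho^\circ_{|N|/2}(K^{-1})\,\mathbf{t}^{|N|/2*}_{N/2}\,\mathbf{t}^{|N|/2}_{N/2}\,\rho^\circ_{|N|/2}(K)$, an $(|N|+1)\times(|N|+1)$-matrix over $\mathcal{O}(\mathrm{S}_q^2)$, which is an invariant projection (in the sense below) with respect to $\rho^\circ_{|N|/2}$. Equivariant $K_0$. Let $\mathcal{U}$ be a Hopf *-algebra, $\mathcal{B}$ a left $\mathcal{U}$-module *-algebra, $\sigma$ an automorphism of $\mathcal{B}$ with $\sigma(b)^*=\sigma^{-1}(b^* )$ and $\sigma(f\triangleright b)=S^2(f)\triangleright\sigma(b)$ (here $\mathcal{U}=\mathcal{U}_q(\mathrm{su}_2)$, $\mathcal{B}=\mathcal{O}(\mathrm{S}_q^2)$, $\sigma=\theta^{-1}$). For a matrix $X$ over $\mathcal{B}$ put $X^\dagger=\sigma(X)^*$ ($\sigma$ entrywise, $*$ conjugate transpose). A projection is $P\in \mathrm{M}_{n\times n}(\mathcal{B})$ with $P^2=P=P^\dagger$. Given a finite dimensional *-representation $\rho^\circ:\mathcal{U}^\circ\to\mathrm{End}(\mathbb{C}^n)$ of the opposite algebra, set $\mathrm{ad}^\circ_{\mathrm R}(f)(X)=\rho^\circ(S^{-1}(f_{(1)}))(S^{-2}(f_{(2)})\triangleright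 X)\rho^\circ(f_{(3)})$; $X$ is invariant if there exists a finite dimensional *-representation $\rho^\circ$ of $\mathcal{U}^\circ$ on $\mathbb{C}^n$ such that $\mathrm{ad}^\circ_{\mathrm R}(f)(X)=\varepsilon(f)X$ for all $f\in\mathcal{U}$ (and $X$ is considered together with $\rho^\circ$). Let $\pi^\circ(f)(v\otimes a)=\rho^\circ(f_{(2)})v\otimes S^{-1}(f_{(1)})\triangleright a$ on $\mathbb{C}^n\otimes\mathcal{B}$. Invariant projections $P\in\mathrm{M}_{n\times n}(\mathcal{B})$ (with $\rho_1^\circ$) and $Q\in\mathrm{M}_{m\times m}(\mathcal{B})$ (with $\rho_2^\circ$) are Murray-von Neumann equivalent if there is $V\in\mathrm{M}_{m\times n}(\mathcal{B})$ with $V^\dagger V=P$, $VV^\dagger=Q$ and $\pi_2^\circ(f)V=V\pi_1^\circ(f)$ for all $f\in\mathcal{U}$. $K_0^{\mathcal{U}}(\mathcal{B})$ is the Grothendieck group of the additive semigroup of equivalence classes of invariant projections of all sizes, with $[P]+[Q]=[P\oplus Q]$ ($P\oplus Q=\mathrm{diag}(P,Q)$ with $\rho_1^\circ\oplus\rho_2^\circ$) and $0=[0]$ for any size of zero matrix.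
   Formalization: Finite dimensional *-representations of the opposite algebra are restricted to those in which K has positive eigenvalues; otherwise the projection 1 with the character E,F ↦ 0, K ↦ −1 is invariant and its class is not generated by the [P_N]. *)

(* Defs.v *)
From HB Require Import structures.
From mathcomp Require Import all_boot all_order all_algebra.
From mathcomp Require Import generic_quotient ring_quotient sesquilinear.
From mathcomp Require Import boolp reals.
From mathcomp Require Import complex freeg.

Set Implicit Arguments.
Unset Strict Implicit.
Unset Printing Implicit Defensive.

Import Order.TTheory GRing.Theory Num.Theory.
Local Open Scope ring_scope.
Local Open Scope quotient_scope.

(* Elements of V (x) W are written as finite formal sums of elementary tensors,
   i.e. as sequences of pairs.  Two formal sums denote the same tensor iff every
   bilinear map takes the same value on them, which is equality in V (x) W by
   the universal property of the tensor product; similarly for three factors. *)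
Section Tensors.
Variable C : fieldType.

Definition tensor_eq (V W : lmodType C) (s t : seq (V * W)) : Prop :=
  forall (X : lmodType C) (f : {bilinear V -> W -> X}),
    \sum_(p <- s) f p.1 p.2 = \sum_(p <- t) f p.1 p.2.

Definition tensor3_eq (V1 V2 V3 : lmodType C) (s t : seq (V1 * V2 * V3)) :
    Prop :=
  forall (X : lmodType C) (f : V1 -> V2 -> V3 -> X),
    (forall y z, linear (fun x => f x y z)) ->
    (forall x z, linear (fun y => f x y z)) ->
    (forall x y, linear (fun z => f x y z)) ->
    \sum_(p <- s) f p.1.1 p.1.2 p.2 = \sum_(p <- t) f p.1.1 p.1.2 p.2.

End Tensors.

Section HopfStarAlgebras.
Variable C : numClosedFieldType.

Definition is_star (A : algType C) (st : A -> A) : Prop :=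
  [/\ forall (z : C) (x y : A), st (z *: x + y) = z^* *: st x + st y,
      forall x y : A, st (x * y) = st y * st x
    & involutive st].

(* [hcop f] is one chosen expression of Delta(f) as a sum of elementary
   tensors, so that Sweedler expressions are sums over [hcop f]; the axioms only
   constrain it up to [tensor_eq]. *)
Record hopfStarAlg := HopfStarAlg {
  hopf_alg :> algType C;
  hcop : hopf_alg -> seq (hopf_alg * hopf_alg);
  heps : hopf_alg -> C;
  hS : hopf_alg -> hopf_alg;
  hSinv : hopf_alg -> hopf_alg;
  hstar : hopf_alg -> hopf_alg;
  hcopP : forall (z : C) x y,
    tensor_eq (hcop (z *: x + y)) ([seq (z *: p.1, p.2) | p <- hcop x] ++ hcop y);
  hcop1 : tensor_eq (hcop 1) [:: (1, 1)];
  hcopM : forall x y, tensor_eq (hcop (x * y))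
    [seq (p.1 * r.1, p.2 * r.2) | p <- hcop x, r <- hcop y];
  hepsP : forall (z : C) x y, heps (z *: x + y) = z * heps x + heps y;
  heps1 : heps 1 = 1;
  hepsM : forall x y, heps (x * y) = heps x * heps y;
  hcopA : forall x, tensor3_eq
    [seq (r.1, r.2, p.2) | p <- hcop x, r <- hcop p.1]
    [seq (p.1, r.1, r.2) | p <- hcop x, r <- hcop p.2];
  hcop_epsl : forall x, \sum_(p <- hcop x) heps p.1 *: p.2 = x;
  hcop_epsr : forall x, \sum_(p <- hcop x) heps p.2 *: p.1 = x;
  hSP : forall (z : C) x y, hS (z *: x + y) = z *: hS x + hS y;
  hSl : forall x, \sum_(p <- hcop x) hS p.1 * p.2 = (heps x)%:A;
  hSr : forall x, \sum_(p <- hcop x) p.1 * hS p.2 = (heps x)%:A;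
  hSK : cancel hS hSinv;
  hSinvK : cancel hSinv hS;
  hstarP : is_star hstar;
  hcop_star : forall x,
    tensor_eq (hcop (hstar x)) [seq (hstar p.1, hstar p.2) | p <- hcop x] }.

(* f_(1) (x) f_(2) (x) f_(3) *)
Definition hcop3 (U : hopfStarAlg) (f : U) : seq (U * U * U) :=
  [seq (r.1, r.2, p.2) | p <- hcop f, r <- hcop p.1].

Definition is_representation (U : hopfStarAlg) (A : lmodType C)
    (act : U -> A -> A) : Prop :=
  [/\ forall f (z : C) x y, act f (z *: x + y) = z *: act f x + act f y,
      forall (z : C) f g x, act (z *: f + g) x = z *: act f x + act g x,
      forall x, act 1 x = x
    & forall f g x, act (f * g) x = act f (act g x)].

Record is_module_star_alg (U : hopfStarAlg) (A : algType C) (st : A -> A)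
    (act : U -> A -> A) : Prop := {
  msa_rep : is_representation act;
  msa_mul : forall f x y,
    act f (x * y) = \sum_(p <- hcop f) act p.1 x * act p.2 y;
  msa_one : forall f, act f 1 = (heps f)%:A;
  msa_star : forall f x, st (act f x) = act (hstar (hS f)) (st x) }.

Definition adjmx n (M : 'M[C]_n) : 'M[C]_n := (map_mx Num.conj M)^T.

Definition is_opp_star_rep (U : hopfStarAlg) n (rho : U -> 'M[C]_n) : Prop :=
  [/\ forall (z : C) f g, rho (z *: f + g) = z *: rho f + rho g,
      rho 1 = 1%:M,
      forall f g, rho (f * g) = rho g *m rho f
    & forall f, rho (hstar f) = adjmx (rho f)].

End HopfStarAlgebras.

(* Equivariant K_0.  The module *-algebra is given as the subset B of an ambient
   algebra A with involution st and action act; theta is the automorphism used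
   in the twisted involution (the "sigma" of the definition).
   The predicate adm selects the class of finite dimensional *-representations
   of the opposite algebra that are allowed. *)
Section EquivariantK0.
Variables (C : numClosedFieldType) (U : hopfStarAlg C) (A : algType C).
Variables (st : A -> A) (act : U -> A -> A) (B : {pred A}) (theta : A -> A).
Variable adm : forall n, (U -> 'M[C]_n) -> Prop.

Definition scalmx m n (M : 'M[C]_(m, n)) : 'M[A]_(m, n) := map_mx (in_alg A) M.

Definition mx_in m n (X : 'M[A]_(m, n)) : Prop := forall i j, X i j \in B.

Definition stmx m n (X : 'M[A]_(m, n)) : 'M[A]_(n, m) := (map_mx st X)^T.

Definition dagger m n (X : 'M[A]_(m, n)) : 'M[A]_(n, m) :=
  stmx (map_mx theta X).

Definition adR n (rho : U -> 'M[C]_n) (f : U) (X : 'M[A]_n) : 'M[A]_n :=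
  \sum_(p <- hcop3 f) scalmx (rho (hSinv p.1.1))
    *m map_mx (act (hSinv (hSinv p.1.2))) X *m scalmx (rho p.2).

(* C^n (x) A is identified with column vectors over A *)
Definition pi_opp n (rho : U -> 'M[C]_n) (f : U) (x : 'cV[A]_n) : 'cV[A]_n :=
  \sum_(p <- hcop f) scalmx (rho p.2) *m map_mx (act (hSinv p.1)) x.

Record is_inv_proj n (P : 'M[A]_n) (rho : U -> 'M[C]_n) : Prop := {
  ip_in : mx_in P;
  ip_idem : P *m P = P;
  ip_dagger : dagger P = P;
  ip_star_rep : is_opp_star_rep rho;
  ip_adm : adm rho;
  ip_inv : forall f, adR rho f P = (heps f)%:A *: P }.

Record inv_proj := InvProj {
  ip_size : nat;
  ip_mx : 'M[A]_ip_size;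
  ip_rep : U -> 'M[C]_ip_size;
  ip_prop : is_inv_proj ip_mx ip_rep }.

HB.instance Definition _ := gen_eqMixin inv_proj.
HB.instance Definition _ := gen_choiceMixin inv_proj.

Definition mvn_equiv (P Q : inv_proj) : Prop :=
  exists V : 'M[A]_(ip_size Q, ip_size P),
    [/\ mx_in V,
        dagger V *m V = ip_mx P,
        V *m dagger V = ip_mx Q
      & forall f (x : 'cV[A]_(ip_size P)), mx_in x ->
          pi_opp (ip_rep Q) f (V *m x) = V *m pi_opp (ip_rep P) f x].

Definition dsum_mx n m (P : 'M[A]_n) (Q : 'M[A]_m) : 'M[A]_(n + m) :=
  block_mx P 0 0 Q.

Definition dsum_rep n m (rho1 : U -> 'M[C]_n) (rho2 : U -> 'M[C]_m) (f : U) :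
    'M[C]_(n + m) :=
  block_mx (rho1 f) 0 0 (rho2 f).

Lemma scalmx_block m1 m2 n1 n2 (M11 : 'M[C]_(m1, n1)) (M12 : 'M[C]_(m1, n2))
    (M21 : 'M[C]_(m2, n1)) (M22 : 'M[C]_(m2, n2)) :
  scalmx (block_mx M11 M12 M21 M22) =
  block_mx (scalmx M11) (scalmx M12) (scalmx M21) (scalmx M22).
Proof. exact: map_block_mx. Qed.

Hypothesis B0 : 0 \in B.
Hypothesis st0 : st 0 = 0.
Hypothesis theta0 : theta 0 = 0.
Hypothesis act0 : forall f, act f 0 = 0.
Hypothesis adm_dsum : forall n m (rho1 : U -> 'M[C]_n) (rho2 : U -> 'M[C]_m),
  adm rho1 -> adm rho2 -> adm (dsum_rep rho1 rho2).

Lemma map_mx_eq0 (g : A -> A) m n : g 0 = 0 -> map_mx g (0 : 'M[A]_(m, n)) = 0.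
Proof. by move=> g0; apply/matrixP=> i j; rewrite !mxE. Qed.

Lemma dsum_is_inv_proj n m (P : 'M[A]_n) (Q : 'M[A]_m) rho1 rho2 :
  is_inv_proj P rho1 -> is_inv_proj Q rho2 ->
  is_inv_proj (dsum_mx P Q) (dsum_rep rho1 rho2).
Proof.
move=> [Pin PP Pd [r1l r11 r1M r1s] Pa Pinv].
move=> [Qin QQ Qd [r2l r21 r2M r2s] Qa Qinv]; split.
- move=> i j; rewrite /dsum_mx.
  by case: (split_ordP i) => i' ->; case: (split_ordP j) => j' ->;
     rewrite ?block_mxEul ?block_mxEur ?block_mxEdl ?block_mxEdr // mxE.
- by rewrite /dsum_mx mulmx_block !mulmx0 !mul0mx !addr0 !add0r PP QQ.
- rewrite /dagger /stmx /dsum_mx !map_block_mx tr_block_mx.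
  rewrite !(map_mx_eq0 _ _ theta0) !(map_mx_eq0 _ _ st0) !trmx0.
  by congr block_mx.
- split=> [z f g||f g|f]; rewrite /dsum_rep.
  + by rewrite r1l r2l scale_block_mx add_block_mx !scaler0 !addr0.
  + by rewrite r11 r21 -scalar_mx_block.
  + by rewrite r1M r2M mulmx_block !mulmx0 !mul0mx !addr0 !add0r.
  + rewrite r1s r2s /adjmx map_block_mx tr_block_mx.
    by congr block_mx; apply/matrixP=> i j; rewrite !mxE conjC0.
- exact: adm_dsum.
- move=> f.
  have -> : (heps f)%:A *: dsum_mx P Q =
      dsum_mx ((heps f)%:A *: P) ((heps f)%:A *: Q).
    by rewrite /dsum_mx scale_block_mx !scaler0.
  rewrite -Pinv -Qinv /adR.
  elim: (hcop3 f) => [|p s IHs].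
    by rewrite !big_nil /dsum_mx block_mx0.
  rewrite !big_cons {}IHs /dsum_mx /dsum_rep !scalmx_block map_block_mx.
  rewrite !(map_mx_eq0 _ _ (act0 _)) /scalmx !map_mx0 !mulmx_block.
  rewrite !(mulmx0, mul0mx, addr0, add0r) add_block_mx !addr0.
  by [].
Qed.

(* The Grothendieck group is presented as the free abelian group on the
   invariant projections, modulo the subgroup generated by [P] - [Q] for P and Q
   equivalent and by [P (+) Q] - [P] - [Q].  The last clause quantifies over the
   proof that P (+) Q is an invariant projection; such a proof is provided by
   [dsum_is_inv_proj]. *)
Inductive K0_rel : {freeg inv_proj} -> Prop :=
| K0_rel0 : K0_rel 0
| K0_relB x y of K0_rel x & K0_rel y : K0_rel (x - y)
| K0_rel_mvn P Q of mvn_equiv P Q : K0_rel (<< P >> - << Q >>)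
| K0_rel_dsum P Q
    (h : is_inv_proj (dsum_mx (ip_mx P) (ip_mx Q))
                     (dsum_rep (ip_rep P) (ip_rep Q))) :
    K0_rel (<< InvProj h >> - << P >> - << Q >>).

Definition K0_relb : {pred {freeg inv_proj}} := fun x => `[< K0_rel x >].

Fact K0_rel_zmod_closed : zmod_closed K0_relb.
Proof.
split=> [|x y /asboolP hx /asboolP hy]; apply/asboolP; first exact: K0_rel0.
exact: K0_relB.
Qed.

HB.instance Definition _ := GRing.isZmodClosed.Build _ K0_relb K0_rel_zmod_closed.

Definition equivK0 : zmodType := {ideal_quot K0_relb}.

Definition K0_class (P : inv_proj) : equivK0 := \pi_({ideal_quot K0_relb}) << P >>.

End EquivariantK0.
Arguments scalmx {C} A {m n} M.

(* Half-integers are handled through their doubles: the spin l is encoded by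
   L = 2l : nat, and an index j in {-l, ..., l} by its position i = j + l, an
   element of 'I_L.+1, so that 2j = 2i - L. *)
Section QuantumSU2.
Variable R : realType.
Local Notation C := R[i].
Variable q : R.

Definition qnum (x : int) : R := (q ^ x - q ^ (- x)) / (q - q^-1).

(* q^(m/2) *)
Definition qhalf (m : int) : R := Num.sqrt q ^ m.

Definition dbl L (j : 'I_L.+1) : int := (j : nat).*2%:Z - L%:Z.

(* alpha^l_j, where l - j = L - i and l + j + 1 = i + 1 *)
Definition alpha L (i : 'I_L.+1) : R :=
  Num.sqrt (qnum (L%:Z - i%:Z) * qnum (i%:Z + 1)).

Local Notation "x %:C" := (real_complex R x).

Record uq_su2_relations (A : algType C) (E F K Ki : A) : Prop := {
  uqr_KKi : K * Ki = 1;
  uqr_KiK : Ki * K = 1;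
  uqr_KE : K * E = q%:C *: (E * K);
  uqr_FK : F * K = q%:C *: (K * F);
  uqr_EF : E * F - F * E = ((q - q^-1)^-1)%:C *: (K ^+ 2 - Ki ^+ 2) }.

(* "The algebra generated by x with relations r" is expressed by its universal
   property. *)
Record is_uq_su2 (U : hopfStarAlg C) (E F K Ki : U) : Prop := {
  uq_rel : uq_su2_relations E F K Ki;
  uq_univ : forall (A : algType C) (e f k ki : A), uq_su2_relations e f k ki ->
    exists2 phi : {lrmorphism U -> A},
      [/\ phi E = e, phi F = f, phi K = k & phi Ki = ki]
      & forall psi : {lrmorphism U -> A},
          [/\ psi E = e, psi F = f, psi K = k & psi Ki = ki] -> psi =1 phi;
  uq_starE : hstar E = F;
  uq_starK : hstar K = K;
  uq_copE : tensor_eq (hcop E) [:: (E, K); (Ki, E)];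
  uq_copF : tensor_eq (hcop F) [:: (F, K); (Ki, F)];
  uq_copK : tensor_eq (hcop K) [:: (K, K)];
  uq_epsE : heps E = 0;
  uq_epsF : heps F = 0;
  uq_epsK : heps (K - 1) = 0;
  uq_SK : hS K = Ki;
  uq_SE : hS E = - q%:C *: E;
  uq_SF : hS F = - (q^-1)%:C *: F }.

Record osuq2_relations (A : algType C) (a b c d : A) : Prop := {
  oqr_ab : a * b = q%:C *: (b * a);
  oqr_ac : a * c = q%:C *: (c * a);
  oqr_bd : b * d = q%:C *: (d * b);
  oqr_cd : c * d = q%:C *: (d * c);
  oqr_bc : b * c = c * b;
  oqr_comm : a * d - d * a = (q - q^-1)%:C *: (b * c);
  oqr_det : a * d - q%:C *: (b * c) = 1 }.

Definition is_corep_mx (A : hopfStarAlg C) n (t : 'M[A]_n) : Prop :=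
  (forall j k, tensor_eq (hcop (t j k)) [seq (t j i, t i k) | i <- enum 'I_n])
  /\ (forall j k, heps (t j k) = (j == k)%:R).

Definition is_unitary_mx (A : hopfStarAlg C) n (t : 'M[A]_n) : Prop :=
  stmx (@hstar _ A) t *m t = 1%:M /\ t *m stmx (@hstar _ A) t = 1%:M.

Definition mx22 (A : algType C) (a b c d : A) : 'M[A]_2 :=
  \matrix_(i, j) if i == 0 then (if j == 0 then a else b)
                 else (if j == 0 then c else d).

Record is_osuq2 (A : hopfStarAlg C) (a b c d : A) : Prop := {
  oq_rel : osuq2_relations a b c d;
  oq_univ : forall (A' : algType C) (a' b' c' d' : A'),
    osuq2_relations a' b' c' d' ->
    exists2 phi : {lrmorphism A -> A'},
      [/\ phi a = a', phi b = b', phi c = c' & phi d = d']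
      & forall psi : {lrmorphism A -> A'},
          [/\ psi a = a', psi b = b', psi c = c' & psi d = d'] -> psi =1 phi;
  oq_stara : hstar a = d;
  oq_starb : hstar b = - q%:C *: c;
  oq_corep : is_corep_mx (mx22 a b c d) }.

(* Peter-Weyl basis.  Irreducibility of each t L is the linear independence of
   its entries, which is part of the basis property. *)
Record is_peter_weyl (A : hopfStarAlg C) (a b c d : A)
    (t : forall L : nat, 'M[A]_L.+1) : Prop := {
  pw_corep : forall L, is_corep_mx (t L);
  pw_unitary : forall L, is_unitary_mx (t L);
  pw_fund : t 1%N = mx22 a b c d;
  pw_span : forall x : A, exists n (z : forall L : nat, 'M[C]_L.+1),
    x = \sum_(L < n) \sum_j \sum_k z L j k *: t L j k;
  pw_free : forall n (z : forall L : nat, 'M[C]_L.+1),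
    \sum_(L < n) \sum_j \sum_k z L j k *: t L j k = 0 ->
    forall L, (L < n)%N -> z L = 0 }.

Definition pw_v (A : algType C) (t : forall L : nat, 'M[A]_L.+1) L
    (j k : 'I_L.+1) : A :=
  (Num.sqrt (qnum (L%:Z + 1)) * qhalf (dbl j))%:C *: t L j k.

Record is_left_action (U A : hopfStarAlg C) (E F K : U)
    (t : forall L : nat, 'M[A]_L.+1) (act : U -> A -> A) : Prop := {
  la_msa : is_module_star_alg (@hstar _ A) act;
  la_E : forall L (j k : 'I_L.+1), act E (pw_v t j k) =
    \sum_(i : 'I_L.+1 | i == k.+1 :> nat) (alpha k)%:C *: pw_v t j i;
  la_F : forall L (j k : 'I_L.+1), act F (pw_v t j k) =
    \sum_(i : 'I_L.+1 | i.+1 == k :> nat) (alpha i)%:C *: pw_v t j i;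
  la_K : forall L (j k : 'I_L.+1),
    act K (pw_v t j k) = (qhalf (dbl k))%:C *: pw_v t j k }.

Record is_partial_action (U A : hopfStarAlg C) (K : U)
    (t : forall L : nat, 'M[A]_L.+1) (act pd : U -> A -> A) : Prop := {
  pd_rep : is_representation pd;
  pd_comm : forall f g x, pd f (act g x) = act g (pd f x);
  pd_K : forall L (j k : 'I_L.+1),
    pd K (pw_v t j k) = (qhalf (- dbl j))%:C *: pw_v t j k }.

Definition podles (U A : hopfStarAlg C) (K : U) (pd : U -> A -> A) : {pred A} :=
  fun x => pd (K ^+ 2) x == x.

Definition is_spin_rep (U A : hopfStarAlg C) (t : forall L : nat, 'M[A]_L.+1)
    (act : U -> A -> A) (sigma : forall L : nat, U -> 'M[C]_L.+1) : Prop :=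
  forall L f (n k : 'I_L.+1),
    act f (pw_v t n k) = \sum_j sigma L f j k *: pw_v t n j.

Definition rho_opp (U : hopfStarAlg C) (K Ki : U)
    (sigma : forall L : nat, U -> 'M[C]_L.+1) L (f : U) : 'M[C]_L.+1 :=
  sigma L (Ki * hS f * K).

(* the index n = N/2 for the spin l = |N|/2, that is n = l or n = -l *)
Definition extremal_idx (N : int) : 'I_(`|N|%N.+1) :=
  if 0 <= N then ord_max else ord0.

Definition podles_proj (U A : hopfStarAlg C) (K Ki : U)
    (t : forall L : nat, 'M[A]_L.+1) (sigma : forall L : nat, U -> 'M[C]_L.+1)
    (N : int) : 'M[A]_(`|N|%N.+1) :=
  let tN : 'rV[A]_(`|N|%N.+1) := row (extremal_idx N) (t `|N|%N) in
  scalmx A (rho_opp K Ki sigma `|N|%N Ki) *m stmx (@hstar _ A) tN *m tN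
    *m scalmx A (rho_opp K Ki sigma `|N|%N K).

(* Finite dimensional *-representations of U_q(su_2) are understood to be those
   in which K acts with positive spectrum, i.e. the direct sums of the sigma_l
   ("type 1").  The *-automorphism E -> E, F -> F, K -> -K turns them into
   further *-representations of the abstract *-algebra, with K negative. *)
Definition pos_rep (U : hopfStarAlg C) (K : U) n (rho : U -> 'M[C]_n) : Prop :=
  forall z : C, eigenvalue (rho K) z -> 0 < z.

Lemma pos_rep_dsum (U : hopfStarAlg C) (K : U) n m
    (rho1 : U -> 'M[C]_n) (rho2 : U -> 'M[C]_m) :
  pos_rep K rho1 -> pos_rep K rho2 -> pos_rep K (dsum_rep rho1 rho2).
Proof.
move=> h1 h2 z /eigenvalueP [v]; rewrite -[v]hsubmxK /dsum_rep.
rewrite mul_row_block !mulmx0 addr0 add0r scale_row_mx => /eq_row_mx [e1 e2].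
case: (eqVneq (lsubmx v) 0) => [->|v1 _]; last first.
  by apply: h1; apply/eigenvalueP; exists (lsubmx v).
case: (eqVneq (rsubmx v) 0) => [->|v2 _]; first by rewrite row_mx0 eqxx.
by apply: h2; apply/eigenvalueP; exists (rsubmx v).
Qed.

End QuantumSU2.

(* Main.v *)
From HB Require Import structures.
Require Import Defs.
From mathcomp Require Import all_boot all_order all_algebra.
From mathcomp Require Import generic_quotient ring_quotient sesquilinear.
From mathcomp Require Import spectral boolp reals complex freeg.
From mathcomp Require Import ring zify.

Set Implicit Arguments.
Unset Strict Implicit.
Unset Printing Implicit Defensive.

Import Order.TTheory GRing.Theory Num.Theory.
Local Open Scope ring_scope.

(** Invariant projections over the standard Podles sphere describe homogeneous
    vector bundles on the quotient of SU_q(2) by its circle subgroup, and such a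
    bundle is determined by its fibre over the base point, a finite dimensional
    representation of the circle.

    The base point is the counit [eps] of O(SU_q(2)).  If P is an invariant
    projection with representation rho, then [eps P] is an orthogonal projection
    that commutes with [k = rho Ki] (lemma [inv_proj_fiber]); the fibre is its
    range, and the circle acts on it through k.  The eigenvalues of k on the
    fibre are powers q^(N_i/2), and the sum of the basis elements N_i is the
    invariant of P in the free abelian group on Z.  It adds up over direct sums,
    and a Murray-von Neumann equivalence V induces the isomorphism [eps V] of
    fibres ([mvn_fiber]), so the invariant is defined on the K_0-group.

    That the fibre determines the projection rests on two facts.  First, a
    *-representation of U_q(su_2) with positive K is a direct sum of spin
    representations ([spin_in_proj]), and therefore integrates to a unitary
    matrix u over O(SU_q(2)) on which U_q(su_2) acts by multiplication with the
    matrices of the representation ([integrate_proj]); for the spin L/2 this is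
    the matrix [t L].  Second, the only elements of O(SU_q(2)) invariant under
    U_q(su_2) are the scalars ([invariant_scalar]).  Conjugation with such
    matrices u turns equivariant matrices into matrices of invariants, that is
    into scalar matrices ([equivariant_intertwiner]).  Hence every invariant
    projection is k u^* p u k^-1 with p its fibre, and every isomorphism w of
    fibres is the fibre of the equivalence k2 u2^* w u1 k1^-1
    ([fiber_lift], [fiber_mvn]).

    Consequently two invariant projections with the same weights are equivalent.
    Since P_N has the single weight N ([line_weights]), a projection with weights
    N_i is equivalent to the direct sum of the P_(N_i) ([sum_of_lines]), and
    sending N to the class of P_N inverts the invariant ([K0_free]). *)

(** * Bilinear evaluation of formal tensors *)

Section Tensors.
Variable C : fieldType.

Lemma tensor_eq_sum (V W X : lmodType C) (s t : seq (V * W)) (f : V -> W -> X) :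
    tensor_eq s t ->
    (forall y, linear (f^~ y)) -> (forall x, linear (f x)) ->
  \sum_(p <- s) f p.1 p.2 = \sum_(p <- t) f p.1 p.2.
Proof.
move=> st fl fr.
pose f' : {bilinear V -> W -> X} := HB.pack f
  (bilinear_isBilinear.Build C V W X *:%R *:%R f
     (conj (fun y a u v => fl y a u v) (fun x a u v => fr x a u v))).
exact: (st X f').
Qed.

Lemma lin0 (V W : lmodType C) (f : V -> W) : linear f -> f 0 = 0.
Proof.
by move=> fl; have := fl (- 1) 0 0; rewrite scaler0 addr0 scaleN1r addNr.
Qed.

Lemma lin_sum (V W : lmodType C) (f : V -> W) (I : Type) (r : seq I) (g : I -> V) :
  linear f -> f (\sum_(i <- r) g i) = \sum_(i <- r) f (g i).
Proof.
move=> fl; elim: r => [|i r IH]; first by rewrite !big_nil lin0.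
by rewrite !big_cons -IH -[g i]scale1r fl !scale1r.
Qed.

Lemma lin_sumf (V W : lmodType C) (I : Type) (r : seq I) (f : I -> V -> W) :
  (forall i, linear (f i)) -> linear (fun x => \sum_(i <- r) f i x).
Proof.
move=> fl a x y; rewrite scaler_sumr -big_split /=.
by apply: eq_bigr => i _; rewrite fl.
Qed.

Lemma lin_comp (V W X : lmodType C) (g : W -> X) (f : V -> W) :
  linear g -> linear f -> linear (fun x => g (f x)).
Proof. by move=> gl fl z x y; rewrite fl gl. Qed.

Lemma scale_linear (V : lmodType C) (c : C) : linear (fun x : V => c *: x).
Proof. by move=> z x y; rewrite scalerDr !scalerA mulrC. Qed.

Lemma linZ (V W : lmodType C) (f : V -> W) z x :
  linear f -> f (z *: x) = z *: f x.
Proof. by move=> fl; have := fl z x 0; rewrite (lin0 fl) !addr0. Qed.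

End Tensors.

(** * Antipode and counit of a Hopf *-algebra *)

Section HopfAlgebra.
Variables (C : numClosedFieldType) (U : hopfStarAlg C).
Implicit Types x y : U.

Section Sums.
Variables (X : lmodType C) (f : U -> U -> X).
Hypothesis fl : forall y, linear (f^~ y).
Hypothesis fr : forall x, linear (f x).

Lemma hcop_sum_linear : linear (fun x => \sum_(p <- hcop x) f p.1 p.2).
Proof.
move=> z x y; rewrite (tensor_eq_sum (hcopP z x y) fl fr) big_cat big_map /=.
congr (_ + _); rewrite scaler_sumr; apply: eq_bigr => p _ /=.
by have := fl p.2 z p.1 0; rewrite !addr0 (lin0 (fl _)) addr0.
Qed.

Lemma hcop_sumM x y : \sum_(p <- hcop (x * y)) f p.1 p.2 =
  \sum_(p <- hcop x) \sum_(r <- hcop y) f (p.1 * r.1) (p.2 * r.2).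
Proof.
by rewrite (tensor_eq_sum (hcopM x y) fl fr) big_allpairs_dep.
Qed.

Lemma hcop_sum1 : \sum_(p <- hcop (1 : U)) f p.1 p.2 = f 1 1.
Proof. by rewrite (tensor_eq_sum (@hcop1 _ U) fl fr) big_seq1. Qed.
End Sums.

Lemma hcop_sumA (X : lmodType C) (f : U -> U -> U -> X) x :
    (forall b c, linear (fun a => f a b c)) ->
    (forall a c, linear (fun b => f a b c)) ->
    (forall a b, linear (fun c => f a b c)) ->
  \sum_(p <- hcop x) \sum_(r <- hcop p.1) f r.1 r.2 p.2 =
  \sum_(p <- hcop x) \sum_(r <- hcop p.2) f p.1 r.1 r.2.
Proof.
by move=> f1 f2 f3; have := @hcopA _ U x X f f1 f2 f3; rewrite !big_allpairs_dep.
Qed.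

Lemma hS_linear : linear (@hS _ U). Proof. exact: hSP. Qed.

Lemma hSinv_linear : linear (@hSinv _ U).
Proof. by move=> z x y; apply: (can_inj (@hSK _ U)); rewrite hSinvK hSP !hSinvK. Qed.

Lemma mull_linear (a : U) : linear (fun x => a * x).
Proof. by move=> z x y; rewrite mulrDr scalerAr. Qed.

Lemma mulr_linear (a : U) : linear (fun x => x * a).
Proof. by move=> z x y; rewrite mulrDl scalerAl. Qed.


Lemma heps_linear : linear (@heps _ U : U -> C^o).
Proof. by move=> z x y; rewrite hepsP. Qed.

Lemma hepsZ (z : C) x : heps (z *: x) = z * heps x.
Proof. exact: (linZ z x heps_linear). Qed.

Lemma scaleeps_linear (V : lmodType C) (v : V) : linear (fun x : U => heps x *: v).
Proof. by move=> z x y; rewrite hepsP scalerDl scalerA. Qed.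



Lemma hS1 : hS (1 : U) = 1.
Proof.
have := hSl (1 : U).
rewrite (@hcop_sum1 _ (fun a b => hS a * b)) ?heps1 ?mulr1 ?scale1r //.
- by move=> b z x y; rewrite /= hSP mulrDl scalerAl.
- by move=> b; apply: mull_linear.
Qed.

Section AntipodeProduct.
Variables x y : U.

(** Summed over the threefold coproducts of x and y, [mid] collapses to
    [hS y * hS x] when its first two thirds are combined by the antipode
    identity, and to [hS (x * y)] when its last two thirds are. *)
Let mid a1 a2 a3 b1 b2 b3 : U := hS (a1 * b1) * (a2 * b2) * (hS b3 * hS a3).

Lemma hSM : hS (x * y) = hS y * hS x.
Proof.
have L := hS_linear.
have l1 a2 a3 b1 b2 b3 : linear (fun a => mid a a2 a3 b1 b2 b3).
  by move=> z u v; rewrite /mid mulrDl -scalerAl hSP !mulrDl -!scalerAl.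
have l2 a1 a3 b1 b2 b3 : linear (fun a => mid a1 a a3 b1 b2 b3).
  by move=> z u v; rewrite /mid mulrDl -scalerAl mulrDr mulrDl -scalerAr -!scalerAl.
have l3 a1 a2 b1 b2 b3 : linear (fun a => mid a1 a2 a b1 b2 b3).
  by move=> z u v; rewrite /mid hSP !mulrDr -!scalerAr.
have l4 a1 a2 a3 b2 b3 : linear (fun b => mid a1 a2 a3 b b2 b3).
  by move=> z u v; rewrite /mid mulrDr -scalerAr hSP !mulrDl -!scalerAl.
have l5 a1 a2 a3 b1 b3 : linear (fun b => mid a1 a2 a3 b1 b b3).
  by move=> z u v; rewrite /mid [a2 * _]mulrDr -scalerAr mulrDr mulrDl -scalerAr -!scalerAl.
have l6 a1 a2 a3 b1 b2 : linear (fun b => mid a1 a2 a3 b1 b2 b).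
  by move=> z u v; rewrite /mid hSP mulrDl !mulrDr -scalerAl -!scalerAr.
have left : \sum_(p <- hcop x) \sum_(p' <- hcop p.1)
    \sum_(r <- hcop y) \sum_(r' <- hcop r.1) mid p'.1 p'.2 p.2 r'.1 r'.2 r.2
  = hS y * hS x.
  transitivity (\sum_(p <- hcop x) \sum_(r <- hcop y)
      hS (heps r.1 *: r.2) * hS (heps p.1 *: p.2)); last first.
    rewrite -{2}(hcop_epsl x) -{2}(hcop_epsl y) !(lin_sum _ _ L).
    by rewrite big_distrlr exchange_big.
  apply: eq_bigr => p _; rewrite exchange_big /=; apply: eq_bigr => r _.
  under eq_bigr do rewrite -mulr_suml.
  rewrite -mulr_suml.
  rewrite -(@hcop_sumM _ (fun a b => hS a * b)); last first.
  - by move=> a; apply: mull_linear.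
  - by move=> b; apply: (lin_comp (mulr_linear b)).
  rewrite hSl hepsM !(linZ _ _ L) -!scalerAl -scalerAr mul1r scalerA.
  by rewrite mulrC.
have right : \sum_(p <- hcop x) \sum_(p' <- hcop p.2)
    \sum_(r <- hcop y) \sum_(r' <- hcop r.2) mid p.1 p'.1 p'.2 r.1 r'.1 r'.2
  = hS (x * y).
  transitivity (\sum_(p <- hcop x) \sum_(r <- hcop y)
      hS ((heps p.2 *: p.1) * (heps r.2 *: r.1))); last first.
    rewrite -{2}(hcop_epsr x) -{2}(hcop_epsr y) big_distrlr.
    rewrite (lin_sum _ _ L); apply: eq_bigr => p _.
    by rewrite (lin_sum _ _ L).
  apply: eq_bigr => p _; rewrite exchange_big /=; apply: eq_bigr => r _.
  transitivity (\sum_(p' <- hcop p.2) hS (p.1 * r.1) *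
     (p'.1 * (heps r.2)%:A * hS p'.2)).
    apply: eq_bigr => p' _; rewrite -hSr -mulrA mulr_suml !mulr_sumr.
    by apply: eq_bigr => r' _; rewrite /mid !mulrA.
  rewrite -mulr_sumr; under eq_bigr do rewrite mulr_algr -scalerAl.
  rewrite -scaler_sumr hSr -scalerAr -scalerAl -!scalerAr (linZ _ _ L).
  by rewrite (linZ _ _ L) mulr1 scalerA mulrC -scalerA.
rewrite -left -right; symmetry.
rewrite (@hcop_sumA _ (fun a1 a2 a3 => \sum_(r <- hcop y) \sum_(r' <- hcop r.1)
   mid a1 a2 a3 r'.1 r'.2 r.2)); first last.
- by move=> a b; do 2!apply: lin_sumf => ?; apply: l3.
- by move=> a b; do 2!apply: lin_sumf => ?; apply: l2.
- by move=> a b; do 2!apply: lin_sumf => ?; apply: l1.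
apply: eq_bigr => p _; apply: eq_bigr => p' _.
by rewrite (@hcop_sumA _ (fun b1 b2 b3 => mid p.1 p'.1 p'.2 b1 b2 b3)).
Qed.

End AntipodeProduct.

Lemma hSinv1 : hSinv (1 : U) = 1.
Proof. by rewrite -{1}hS1 hSK. Qed.

Lemma hSinvM x y : hSinv (x * y) = hSinv y * hSinv x.
Proof. by apply: (can_inj (@hSK _ U)); rewrite hSM !hSinvK. Qed.

Lemma hstar1 : hstar (1 : U) = 1.
Proof.
have [_ stM stK] := hstarP U.
by rewrite -[LHS]mulr1 -{2}[1]stK -stM mulr1 stK.
Qed.

(** A coproduct has only one counit, and x |-> conj (eps (hstar x)) is one. *)
Lemma heps_star x : heps (hstar x) = (heps x)^*.
Proof.
have [stl stM stK] := hstarP U.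
have st0 : hstar (0 : U) = 0.
  by have := stl (- 1) 0 0; rewrite scaler0 addr0 conjCN1 scaleN1r addNr.
have stZ z u : hstar (z *: u : U) = z^* *: hstar u.
  by have := stl z u 0; rewrite st0 !addr0.
have stS (I : Type) (r : seq I) (g : I -> U) :
    hstar (\sum_(i <- r) g i) = \sum_(i <- r) hstar (g i).
  elim: r => [|i r IH]; first by rewrite !big_nil.
  by rewrite !big_cons -IH -[g i]scale1r stl conjC1 !scale1r.
pose e' u := (heps (hstar u : U))^*.
have e'l u : \sum_(p <- hcop u) e' p.1 *: p.2 = u :> U.
  apply: (can_inj stK); rewrite stS.
  under eq_bigr do rewrite stZ conjCK.
  rewrite -[RHS]hcop_epsl (tensor_eq_sum (f := fun a b => heps a *: b) (hcop_star u)).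
  - by rewrite big_map.
  - by move=> v; apply: scaleeps_linear.
  - by move=> v; apply: scale_linear.
suff -> : heps x = e' x by rewrite /e' conjCK.
have El : linear (@heps _ U : U -> C^o) by exact: heps_linear.
have e'L : linear (e' : U -> C^o).
  by move=> z u v; rewrite /e' stl hepsP rmorphD rmorphM /= conjCK.
rewrite -{1}(e'l x) -{2}(hcop_epsr x) (lin_sum _ _ El) (lin_sum _ _ e'L).
apply: eq_bigr => p _; rewrite (linZ _ _ El) (linZ _ _ e'L).
by rewrite /GRing.scale /= mulrC.
Qed.

End HopfAlgebra.

(** * Generators of the quantized enveloping algebra *)

Section QuantumEnveloping.
Variables (R : realType) (q : R).
Local Notation C := R[i].
Local Notation "x %:C" := (real_complex R x).
Hypothesis hq0 : 0 < q.
Variables (U : hopfStarAlg C) (E F K Ki : U).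
Hypothesis hU : is_uq_su2 q E F K Ki.

Section Generation.
Variable P : U -> Prop.
Hypothesis P1 : P 1.
Hypothesis PD : forall (z : C) f g, P f -> P g -> P (z *: f + g).
Hypothesis PM : forall f g, P f -> P g -> P (f * g).

Let S : {pred U} := fun f => `[< P f >].

Let S_subalg : subalg_closed S.
Proof.
split; first exact/asboolP.
- by move=> z f g /asboolP hf /asboolP hg; apply/asboolP/PD.
- by move=> f g /asboolP hf /asboolP hg; apply/asboolP/PM.
Qed.

HB.instance Definition _ := GRing.isSubalgClosed.Build C U S S_subalg.

Let Ssub := {f : U | S f}.
HB.instance Definition _ := SubChoice.on Ssub.
HB.instance Definition _ := [SubChoice_isSubAlgebra of Ssub by <:].

(** The elements satisfying P form a subalgebra [S].  The universal property maps
    U to [S]; followed by the inclusion, this map fixes the generators, so by the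
    uniqueness clause it is the identity of U, whence every element is in [S]. *)
Lemma uq_ind : P E -> P F -> P K -> P Ki -> forall f, P f.
Proof.
move=> PE PF PK PKi f.
have inS g : P g -> g \in S by move=> hg; apply/asboolP.
pose sub g (hg : P g) : Ssub := Sub g (inS g hg).
have [[r1 r2 r3 r4 r5] univ] := (uq_rel hU, uq_univ hU).
have rels : uq_su2_relations q (sub E PE) (sub F PF) (sub K PK) (sub Ki PKi).
  by split; apply: val_inj.
have [phi [phE phF phK phKi] _] := univ _ _ _ _ _ rels.
have [psi _ uniq] := univ _ _ _ _ _ (uq_rel hU).
pose inc (x : Ssub) : U := val x.
have incl : linear inc by [].
have incm : monoid_morphism inc by [].
pose valS : {lrmorphism Ssub -> U} := HB.pack inc
  (GRing.isLinear.Build C Ssub U *:%R inc incl)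
  (GRing.isMonoidMorphism.Build Ssub U inc incm).
pose vphi : {lrmorphism U -> U} := valS \o phi.
have vE : [/\ vphi E = E, vphi F = F, vphi K = K & vphi Ki = Ki].
  by rewrite /= phE phF phK phKi.
pose idU : {lrmorphism U -> U} := idfun.
have -> : f = vphi f by rewrite uniq // -(uniq idU).
exact/asboolP/(valP (phi f)).
Qed.

End Generation.
Lemma qc_neq0 : q%:C != 0. Proof. by rewrite fmorph_eq0 gt_eqF. Qed.

Lemma uq_KKi : K * Ki = 1. Proof. exact: (uqr_KKi (uq_rel hU)). Qed.
Lemma uq_KiK : Ki * K = 1. Proof. exact: (uqr_KiK (uq_rel hU)). Qed.

Lemma uq_epsK1 : heps K = 1.
Proof.
have := hepsP (1 : C) (K - 1) (1 : U).
by rewrite scale1r subrK (uq_epsK hU) heps1 mulr0 add0r.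
Qed.

Lemma uq_epsKi : heps Ki = 1.
Proof. by rewrite -[LHS]mulr1 -uq_epsK1 -hepsM uq_KiK heps1 uq_epsK1. Qed.

Section CopSums.
Variables (X : lmodType C) (f : U -> U -> X).
Hypothesis fl : forall y, linear (f^~ y).
Hypothesis fr : forall x, linear (f x).

Lemma hcop_sumE : \sum_(p <- hcop E) f p.1 p.2 = f E K + f Ki E.
Proof. by rewrite (tensor_eq_sum (uq_copE hU) fl fr) !big_cons big_nil addr0. Qed.

Lemma hcop_sumF : \sum_(p <- hcop F) f p.1 p.2 = f F K + f Ki F.
Proof. by rewrite (tensor_eq_sum (uq_copF hU) fl fr) !big_cons big_nil addr0. Qed.

Lemma hcop_sumK : \sum_(p <- hcop K) f p.1 p.2 = f K K.
Proof. by rewrite (tensor_eq_sum (uq_copK hU) fl fr) big_seq1. Qed.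
End CopSums.

(** Ki is group-like because it is inverse to the group-like K: compare the
    coproducts of [Ki * K] and 1 on the bilinear map [f (_ * Ki) (_ * Ki)]. *)
Lemma hcop_sumKi (X : lmodType C) (f : U -> U -> X) :
    (forall y, linear (f^~ y)) -> (forall x, linear (f x)) ->
  \sum_(p <- hcop Ki) f p.1 p.2 = f Ki Ki.
Proof.
move=> fl fr; pose g x y := f (x * Ki) (y * Ki).
have gl y : linear (g^~ y) by exact: lin_comp (fl _) (mulr_linear _).
have gr x : linear (g x) by exact: lin_comp (fr _) (mulr_linear _).
have := hcop_sumM gl gr Ki K; rewrite uq_KiK (hcop_sum1 gl gr) /g !mul1r => ->.
apply: eq_bigr => p _.
rewrite (@hcop_sumK _ (fun a b => f (p.1 * a * Ki) (p.2 * b * Ki))).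
- by rewrite -!mulrA uq_KKi !mulr1.
- by move=> y; apply: lin_comp (fl _) (lin_comp (mulr_linear _) (mull_linear _)).
- by move=> y; apply: lin_comp (fr _) (lin_comp (mulr_linear _) (mull_linear _)).
Qed.

Lemma uq_SKi : hS Ki = K.
Proof.
have := hSl Ki; rewrite (@hcop_sumKi _ (fun a b => hS a * b)) ?uq_epsKi ?scale1r.
- by move=> h; rewrite -[LHS]mulr1 -uq_KiK mulrA h mul1r.
- by move=> y; exact: (lin_comp (mulr_linear y) (@hS_linear _ U)).
- by move=> y; apply: mull_linear.
Qed.

Lemma uq_SiK : hSinv K = Ki. Proof. by rewrite -uq_SKi hSK. Qed.
Lemma uq_SiKi : hSinv Ki = K. Proof. by rewrite -(uq_SK hU) hSK. Qed.

Lemma uq_SiE : hSinv E = - q%:C^-1 *: E.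
Proof.
apply: (can_inj (@hSK _ U)); rewrite hSinvK (linZ _ _ (@hS_linear _ U)) (uq_SE hU).
by rewrite scalerA mulrNN mulVf ?scale1r // qc_neq0.
Qed.

Lemma uq_SiF : hSinv F = - q%:C *: F.
Proof.
apply: (can_inj (@hSK _ U)); rewrite hSinvK (linZ _ _ (@hS_linear _ U)) (uq_SF hU).
by rewrite scalerA mulrNN fmorphV mulfV ?scale1r // qc_neq0.
Qed.

Lemma uq_starF : hstar F = E.
Proof. by have [_ _ stK] := hstarP U; rewrite -(uq_starE hU) stK. Qed.

Lemma uq_starKi : hstar Ki = Ki.
Proof.
have [_ stM _] := hstarP U.
have h : K * hstar Ki = 1 by rewrite -{1}(uq_starK hU) -stM uq_KiK hstar1.
by rewrite -[LHS]mul1r -uq_KiK -mulrA h mulr1.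
Qed.

End QuantumEnveloping.

(** * Matrices over a module *-algebra *)

Section Adjoint.
Variable C : numClosedFieldType.

Definition ctr m n (M : 'M[C]_(m, n)) : 'M[C]_(n, m) := (map_mx Num.conj M)^T.

Lemma ctrM m n p (M : 'M[C]_(m, n)) (N : 'M_(n, p)) :
  ctr (M *m N) = ctr N *m ctr M.
Proof. by rewrite /ctr map_mxM trmx_mul. Qed.

Lemma ctrK m n (M : 'M[C]_(m, n)) : ctr (ctr M) = M.
Proof. by apply/matrixP=> i j; rewrite !mxE conjCK. Qed.

Lemma ctr1 n : ctr (1%:M : 'M[C]_n) = 1%:M.
Proof. by rewrite /ctr map_mx1 trmx1. Qed.

Lemma ctrD m n (M N : 'M[C]_(m, n)) : ctr (M + N) = ctr M + ctr N.
Proof. by rewrite /ctr map_mxD linearD. Qed.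

Lemma ctrN m n (M : 'M[C]_(m, n)) : ctr (- M) = - ctr M.
Proof. by rewrite /ctr map_mxN linearN. Qed.

Lemma ctrZ m n z (M : 'M[C]_(m, n)) : ctr (z *: M) = z^* *: ctr M.
Proof. by rewrite /ctr map_mxZ linearZ. Qed.

Lemma ctr0 m n : ctr (0 : 'M[C]_(m, n)) = 0.
Proof. by rewrite /ctr map_mx0 trmx0. Qed.

End Adjoint.

Section ScalarMatrices.
Variables (C : numClosedFieldType) (A : algType C).

Lemma scalmxM m n p (M : 'M[C]_(m, n)) (N : 'M_(n, p)) :
  scalmx A (M *m N) = scalmx A M *m scalmx A N.
Proof. exact: map_mxM. Qed.

Lemma scalmx1 n : scalmx A (1%:M : 'M[C]_n) = 1%:M.
Proof. exact: map_mx1. Qed.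

Lemma scalmx0 m n : scalmx A (0 : 'M[C]_(m, n)) = 0.
Proof. exact: map_mx0. Qed.

Lemma scalmxD m n (M N : 'M[C]_(m, n)) :
  scalmx A (M + N) = scalmx A M + scalmx A N.
Proof. exact: map_mxD. Qed.

Lemma scalmxN m n (M : 'M[C]_(m, n)) : scalmx A (- M) = - scalmx A M.
Proof. exact: map_mxN. Qed.

Lemma scalmxMC m n p (z : C) (M : 'M[C]_(m, n)) (X : 'M[A]_(n, p)) :
  scalmx A (z *: M) *m X = z%:A *: (scalmx A M *m X).
Proof.
apply/matrixP=> i j; rewrite !mxE mulr_sumr; apply: eq_bigr => k _.
by rewrite !mxE -!scalerAl !mul1r scalerA.
Qed.

Lemma scalmxCM m n p (z : C) (M : 'M[C]_(n, p)) (X : 'M[A]_(m, n)) :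
  X *m scalmx A (z *: M) = z%:A *: (X *m scalmx A M).
Proof.
apply/matrixP=> i j; rewrite !mxE mulr_sumr; apply: eq_bigr => k _.
by rewrite !mxE -!scalerAl !mulr_algr !mul1r scalerA.
Qed.

Lemma mulmxCA m n p (z : C) (X : 'M[A]_(m, n)) (Y : 'M[A]_(n, p)) :
  X *m (z%:A *: Y) = z%:A *: (X *m Y).
Proof.
apply/matrixP=> i j; rewrite !mxE mulr_sumr; apply: eq_bigr => k _.
by rewrite !mxE -!scalerAl !mul1r scalerAr.
Qed.

(** The computation behind [actK_adR_gen].  There k, ki and G are the values of a
    representation at Ki, K and a generator g, X is K acting on P, and gX is g
    acting on X. *)
Lemma adR_gen_identity n (k ki G : 'M[C]_n) (r s : C) (X P gX : 'M[A]_n) :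
    s * r = 1 -> ki *m k = 1%:M -> k *m ki = 1%:M ->
    G *m ki = r *: (ki *m G) -> P = scalmx A k *m X *m scalmx A ki ->
  - (scalmx A (s *: G) *m (scalmx A ki *m X *m scalmx A k) *m scalmx A ki)
    + scalmx A (s ^+ 2 *: ki) *m (r%:A *: gX) *m scalmx A ki + scalmx A ki *m P *m scalmx A G
  = scalmx A (s *: ki) *m (gX - (scalmx A (r *: G) *m X *m scalmx A k - scalmx A k *m X *m scalmx A G))
      *m scalmx A ki.
Proof.
move=> sr kik kki Gki ->.
have e1 : scalmx A (s *: G) *m (scalmx A ki *m X *m scalmx A k) *m scalmx A ki =
          scalmx A (s *: ki) *m (scalmx A (r *: G) *m X *m scalmx A k) *m scalmx A ki.
  by rewrite !mulmxA -!scalmxM -!scalemxAl Gki -!scalemxAr !scalerA.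
have e2 : scalmx A (s ^+ 2 *: ki) *m (r%:A *: gX) = scalmx A (s *: ki) *m gX.
  rewrite mulmxCA -scalmxMC scalerA; congr (scalmx A (_ *: _) *m _).
  by rewrite expr2 mulrC -mulrA sr mulr1.
have e3 : scalmx A ki *m (scalmx A k *m X *m scalmx A ki) *m scalmx A G =
          scalmx A (s *: ki) *m (scalmx A k *m X *m scalmx A G) *m scalmx A ki.
  rewrite !mulmxA -!scalmxM -!scalemxAl kik scalmx1 mul1mx.
  rewrite -[RHS]mulmxA -scalmxM Gki scalmxCM -mulmxA -scalmxM scalmxMC scalmx1 mul1mx.
  by rewrite -scalemxAl scalerA mulr_algl scalerA [r * s]mulrC sr !scale1r.
rewrite e1 e2 e3 mulmxBr mulmxBl mulmxBr mulmxBl.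
by rewrite opprB [- _ + _]addrC addrAC addrA.
Qed.

Lemma scalmxZ_eq0 m n p (z : C) (M : 'M[C]_(m, n)) (X : 'M[A]_(n, p)) :
  z != 0 -> scalmx A (z *: M) *m X = 0 -> scalmx A M *m X = 0.
Proof.
move=> z0 h; rewrite -[M]scale1r -(mulVf z0) -scalerA scalmxMC h scaler0 //.
Qed.

Lemma scalmxVZ m n p (z : C) (M : 'M[C]_(m, n)) (X : 'M[A]_(n, p)) :
  z != 0 -> scalmx A (z^-1 *: M) *m (z%:A *: X) = scalmx A M *m X.
Proof.
by move=> z0; rewrite mulmxCA -scalmxMC scalerA mulfV // scale1r.
Qed.

(** Matrices over A seen as a vector space over C rather than as a module over A:
    sums over a coproduct can then be evaluated by matrix-valued bilinear maps. *)
Definition cmx m n : Type := 'M[A]_(m, n).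

HB.instance Definition _ m n := GRing.Zmodule.on (cmx m n).

Definition cmx_scale m n (z : C) (X : cmx m n) : cmx m n := z%:A *: (X : 'M[A]__).

Fact cmx_scaleA m n z w (X : cmx m n) :
  cmx_scale z (cmx_scale w X) = cmx_scale (z * w) X.
Proof. by rewrite /cmx_scale scalerA mulr_algl scalerA. Qed.

Fact cmx_scale1 m n : left_id 1 (@cmx_scale m n).
Proof. by move=> X; rewrite /cmx_scale !scale1r. Qed.

Fact cmx_scaleDr m n : right_distributive (@cmx_scale m n) +%R.
Proof. by move=> z X Y; rewrite /cmx_scale scalerDr. Qed.

Fact cmx_scaleDl m n (X : cmx m n) : {morph (@cmx_scale m n)^~ X : z w / z + w}.
Proof. by move=> z w; rewrite /cmx_scale !scalerDl. Qed.

HB.instance Definition _ m n := GRing.Zmodule_isLmodule.Build C (cmx m n)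
  (@cmx_scaleA m n) (@cmx_scale1 m n) (@cmx_scaleDr m n) (@cmx_scaleDl m n).

Lemma cmx_scaleE m n z (X : cmx m n) : z *: X = z%:A *: (X : 'M[A]__).
Proof. by []. Qed.

Lemma cmx_mull_linear m n p (X : 'M[A]_(m, n)) :
  linear (fun Y : cmx n p => X *m Y : cmx m p).
Proof. by move=> z Y Z; rewrite mulmxDr cmx_scaleE mulmxCA. Qed.

Lemma cmx_mulr_linear m n p (X : 'M[A]_(n, p)) :
  linear (fun Y : cmx m n => Y *m X : cmx m p).
Proof. by move=> z Y Z; rewrite mulmxDl cmx_scaleE -scalemxAl. Qed.

Lemma cmx_scal_linear (V : lmodType C) m n (f : V -> 'M[C]_(m, n)) :
  linear f -> linear (fun x => scalmx A (f x) : cmx m n).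
Proof.
move=> fl z x y; rewrite fl scalmxD; congr (_ + _).
by apply/matrixP=> i j; rewrite !mxE -scalerAl mul1r scalerA.
Qed.

End ScalarMatrices.

Section ModuleStarAlgebra.
Variables (R : realType) (q : R).
Local Notation C := R[i].
Local Notation "x %:C" := (real_complex R x).
Hypothesis hq0 : 0 < q.
Variables (U : hopfStarAlg C) (E F K Ki : U).
Hypothesis hU : is_uq_su2 q E F K Ki.
Variables (A : hopfStarAlg C) (act : U -> A -> A).
Hypothesis hact : is_module_star_alg (@hstar _ A) act.

Local Notation actx f := (map_mx (act f)).
Local Notation stx := (stmx (@hstar _ A)).
Local Notation scal := (@scalmx _ A _ _).
Local Notation epsx := (map_mx (@heps _ A)).

Lemma act_linear f : linear (act f).
Proof. by have [h _ _ _] := msa_rep hact; exact: h. Qed.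

Lemma act_linearl x : linear (act^~ x).
Proof. by have [_ h _ _] := msa_rep hact; move=> z f g; exact: h. Qed.

Lemma act1 x : act 1 x = x.
Proof. by have [_ _ h _] := msa_rep hact; exact: h. Qed.

Lemma actM f g x : act (f * g) x = act f (act g x).
Proof. by have [_ _ _ h] := msa_rep hact; exact: h. Qed.

Lemma act0 f : act f 0 = 0. Proof. exact: lin0 (act_linear f). Qed.

Lemma actKKi x : act K (act Ki x) = x.
Proof. by rewrite -actM (uq_KKi hU) act1. Qed.

Lemma actKiK x : act Ki (act K x) = x.
Proof. by rewrite -actM (uq_KiK hU) act1. Qed.

Lemma actxM f g m n (X : 'M[A]_(m, n)) : actx (f * g) X = actx f (actx g X).
Proof. by apply/matrixP=> i j; rewrite !mxE actM. Qed.

Lemma actx1 m n (X : 'M[A]_(m, n)) : actx 1 X = X.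
Proof. by apply/matrixP=> i j; rewrite !mxE act1. Qed.

Lemma actxD f m n (X Y : 'M[A]_(m, n)) : actx f (X + Y) = actx f X + actx f Y.
Proof.
apply/matrixP=> i j; rewrite !mxE.
by have := act_linear f 1 (X i j) (Y i j); rewrite !scale1r.
Qed.

Lemma actxN f m n (X : 'M[A]_(m, n)) : actx f (- X) = - actx f X.
Proof.
apply/matrixP=> i j; rewrite !mxE -scaleN1r (linZ _ _ (act_linear f)).
by rewrite scaleN1r.
Qed.

Lemma actxNl f m n (X : 'M[A]_(m, n)) : actx (- f) X = - actx f X.
Proof.
apply/matrixP=> i j; rewrite !mxE -scaleN1r (linZ _ _ (act_linearl _)).
by rewrite scaleN1r.
Qed.

Lemma actx0 f m n : actx f (0 : 'M[A]_(m, n)) = 0.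
Proof. by apply/matrixP=> i j; rewrite !mxE act0. Qed.

Lemma actxZ (z : C) f m n (X : 'M[A]_(m, n)) : actx (z *: f) X = z%:A *: actx f X.
Proof.
by apply/matrixP=> i j; rewrite !mxE (linZ _ _ (act_linearl _)) -scalerAl mul1r.
Qed.

Lemma actx_sl f m n p (M : 'M[C]_(m, n)) (X : 'M[A]_(n, p)) :
  actx f (scal M *m X) = scal M *m actx f X.
Proof.
apply/matrixP=> i j; rewrite !mxE (lin_sum _ _ (act_linear f)).
by apply: eq_bigr => k _; rewrite !mxE -!scalerAl !mul1r (linZ _ _ (act_linear f)).
Qed.

Lemma actx_sr f m n p (M : 'M[C]_(n, p)) (X : 'M[A]_(m, n)) :
  actx f (X *m scal M) = actx f X *m scal M.
Proof.
apply/matrixP=> i j; rewrite !mxE (lin_sum _ _ (act_linear f)).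
by apply: eq_bigr => k _; rewrite !mxE !mulr_algr (linZ _ _ (act_linear f)).
Qed.

Lemma actx_s f m n (M : 'M[C]_(m, n)) : actx f (scal M) = scal (heps f *: M).
Proof.
apply/matrixP=> i j; rewrite !mxE (linZ _ _ (act_linear f)).
by rewrite (msa_one hact) scalerA mulrC.
Qed.

Lemma act_mul_linear f g : (forall y, linear (fun a : U => act a f * y)) *
  (forall y, linear (fun b : U => y * act b g)).
Proof.
split=> y z a b; rewrite act_linearl.
  by rewrite mulrDl scalerAl.
by rewrite mulrDr scalerAr.
Qed.

Lemma act_mulE x y : act E (x * y) = act E x * act K y + act Ki x * act E y.
Proof.
rewrite (msa_mul hact) (@hcop_sumE _ _ _ _ _ _ _ hU _ (fun a b => act a x * act b y)) //.
- by move=> b; apply: (act_mul_linear x y).1.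
- by move=> b; apply: (act_mul_linear x y).2.
Qed.

Lemma act_mulF x y : act F (x * y) = act F x * act K y + act Ki x * act F y.
Proof.
rewrite (msa_mul hact) (@hcop_sumF _ _ _ _ _ _ _ hU _ (fun a b => act a x * act b y)) //.
- by move=> b; apply: (act_mul_linear x y).1.
- by move=> b; apply: (act_mul_linear x y).2.
Qed.

Lemma act_mulK x y : act K (x * y) = act K x * act K y.
Proof.
rewrite (msa_mul hact) (@hcop_sumK _ _ _ _ _ _ _ hU _ (fun a b => act a x * act b y)) //.
- by move=> b; apply: (act_mul_linear x y).1.
- by move=> b; apply: (act_mul_linear x y).2.
Qed.

Lemma act_mulKi x y : act Ki (x * y) = act Ki x * act Ki y.
Proof. by rewrite -{1}[x]actKKi -{1}[y]actKKi -act_mulK actKiK. Qed.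

Lemma actx_linear f m n : linear (fun X : cmx A m n => actx f X : cmx A m n).
Proof.
move=> z X Y; rewrite !cmx_scaleE actxD; congr (_ + _).
apply/matrixP=> i j; rewrite !mxE -!scalerAl !mul1r.
exact: linZ (act_linear f).
Qed.

Lemma actx_linearl m n (X : 'M[A]_(m, n)) : linear (fun f => actx f X : cmx A m n).
Proof.
move=> z f g; rewrite cmx_scaleE; apply/matrixP=> i j; rewrite !mxE.
by rewrite act_linearl -scalerAl mul1r.
Qed.

Section Products.
Variables (m n p : nat) (X : 'M[A]_(m, n)) (Y : 'M[A]_(n, p)).

Lemma actx_mulK : actx K (X *m Y) = actx K X *m actx K Y.
Proof.
apply/matrixP=> i j; rewrite !mxE (lin_sum _ _ (act_linear _)).
by apply: eq_bigr => k _; rewrite !mxE act_mulK.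
Qed.

Lemma actx_mulKi : actx Ki (X *m Y) = actx Ki X *m actx Ki Y.
Proof.
apply/matrixP=> i j; rewrite !mxE (lin_sum _ _ (act_linear _)).
by apply: eq_bigr => k _; rewrite !mxE act_mulKi.
Qed.

Lemma actx_mulE : actx E (X *m Y) = actx E X *m actx K Y + actx Ki X *m actx E Y.
Proof.
apply/matrixP=> i j; rewrite !mxE (lin_sum _ _ (act_linear _)) -big_split /=.
by apply: eq_bigr => k _; rewrite !mxE act_mulE.
Qed.

Lemma actx_mulF : actx F (X *m Y) = actx F X *m actx K Y + actx Ki X *m actx F Y.
Proof.
apply/matrixP=> i j; rewrite !mxE (lin_sum _ _ (act_linear _)) -big_split /=.
by apply: eq_bigr => k _; rewrite !mxE act_mulF.
Qed.
End Products.

Lemma hstarD (x y : A) : hstar (x + y) = hstar x + hstar y.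
Proof.
have [stl _ _] := hstarP A.
by have := stl 1 x y; rewrite scale1r conjC1 scale1r.
Qed.

Lemma hstar0 : hstar (0 : A) = 0.
Proof.
have [stl _ _] := hstarP A.
by have := stl (-1) 0 0; rewrite scaler0 addr0 conjCN1 scaleN1r addNr.
Qed.

Lemma hstarZ z (x : A) : hstar (z *: x) = z^* *: hstar x.
Proof.
have [stl _ _] := hstarP A.
by have := stl z x 0; rewrite hstar0 !addr0.
Qed.

Lemma hstar_sum (I : Type) (r : seq I) (g : I -> A) :
  hstar (\sum_(i <- r) g i) = \sum_(i <- r) hstar (g i).
Proof.
by elim: r => [|i r IH]; rewrite ?big_nil ?hstar0 // !big_cons -IH hstarD.
Qed.

Lemma stmxM m n p (X : 'M[A]_(m, n)) (Y : 'M[A]_(n, p)) :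
  stx (X *m Y) = stx Y *m stx X.
Proof.
have [_ stM _] := hstarP A.
apply/matrixP=> i j; rewrite !mxE hstar_sum.
by apply: eq_bigr => k _; rewrite !mxE stM.
Qed.

Lemma stmxK m n (X : 'M[A]_(m, n)) : stx (stx X) = X.
Proof.
have [_ _ stK] := hstarP A.
by apply/matrixP=> i j; rewrite !mxE stK.
Qed.

Lemma stmx_scal m n (M : 'M[C]_(m, n)) : stx (scal M) = scal (ctr M).
Proof. by apply/matrixP=> i j; rewrite !mxE hstarZ hstar1. Qed.

Lemma stmxD m n (X Y : 'M[A]_(m, n)) : stx (X + Y) = stx X + stx Y.
Proof. by apply/matrixP=> i j; rewrite !mxE hstarD. Qed.

Lemma conj_real_complex (x : R) : (x%:C)^* = x%:C.
Proof. exact: conjc_real. Qed.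

Lemma act_starE x : act E (hstar x) = - q%:C *: hstar (act F x).
Proof.
rewrite (msa_star hact) (uq_SF hU).
have [stl _ _] := hstarP U.
have -> : hstar (- (q^-1)%:C *: F) = - (q^-1)%:C *: E.
  have := stl (- (q^-1)%:C) F 0; rewrite !addr0 (uq_starF hU) => ->.
  have -> : hstar (0 : U) = 0.
    by have := stl (-1) 0 0; rewrite scaler0 addr0 conjCN1 scaleN1r addNr.
  by rewrite addr0 rmorphN /= conj_real_complex.
rewrite (linZ _ _ (act_linearl _)) scalerA mulrNN fmorphV mulfV ?scale1r //.
exact: qc_neq0.
Qed.

Lemma act_starF x : act F (hstar x) = - q%:C^-1 *: hstar (act E x).
Proof.
have [_ _ stK] := hstarP A.
rewrite -{2}[x]stK act_starE hstarZ stK scalerA rmorphN /= conj_real_complex.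
by rewrite mulrNN mulVf ?scale1r // qc_neq0.
Qed.

Lemma act_starK x : act K (hstar x) = hstar (act Ki x).
Proof. by rewrite (msa_star hact) (uq_SKi hU) (uq_starK hU). Qed.

Lemma act_starKi x : act Ki (hstar x) = hstar (act K x).
Proof. by rewrite (msa_star hact) (uq_SK hU) (uq_starKi hU). Qed.

Lemma actx_starK m n (X : 'M[A]_(m, n)) : actx K (stx X) = stx (actx Ki X).
Proof. by apply/matrixP=> i j; rewrite !mxE act_starK. Qed.

Lemma actx_starKi m n (X : 'M[A]_(m, n)) : actx Ki (stx X) = stx (actx K X).
Proof. by apply/matrixP=> i j; rewrite !mxE act_starKi. Qed.

Lemma actx_starE m n (X : 'M[A]_(m, n)) :
  actx E (stx X) = (- q%:C)%:A *: stx (actx F X).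
Proof. by apply/matrixP=> i j; rewrite !mxE act_starE -scalerAl mul1r. Qed.

Lemma actx_starF m n (X : 'M[A]_(m, n)) :
  actx F (stx X) = (- q%:C^-1)%:A *: stx (actx E X).
Proof. by apply/matrixP=> i j; rewrite !mxE act_starF -scalerAl mul1r. Qed.

Lemma epsxM m n p (X : 'M[A]_(m, n)) (Y : 'M[A]_(n, p)) :
  epsx (X *m Y) = epsx X *m epsx Y.
Proof.
apply/matrixP=> i j; rewrite !mxE (lin_sum _ _ (@heps_linear _ A)).
by apply: eq_bigr => k _; rewrite !mxE hepsM.
Qed.

Lemma epsx_scal m n (M : 'M[C]_(m, n)) : epsx (scal M) = M.
Proof.
apply/matrixP=> i j; rewrite !mxE (linZ _ _ (@heps_linear _ A)).
by rewrite heps1 [LHS]mulr1.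
Qed.

Lemma epsx_star m n (X : 'M[A]_(m, n)) : epsx (stx X) = ctr (epsx X).
Proof. by apply/matrixP=> i j; rewrite !mxE heps_star. Qed.

End ModuleStarAlgebra.

(** * Eigenvectors of complex matrices *)

Section LinearAlgebra.
Variable C : numClosedFieldType.

Lemma rV_inner (n : nat) (v w : 'rV[C]_n) :
  v *m ctr w = (\sum_i v 0 i * (w 0 i)^*)%:M.
Proof.
apply/matrixP=> i j; rewrite !ord1 !mxE eqxx mulr1n.
by apply: eq_bigr => k _; rewrite !mxE.
Qed.

Lemma normalize_rV (n : nat) (v : 'rV[C]_n) : v != 0 ->
  exists2 c : C, c != 0 & (c *: v) *m ctr (c *: v) = 1%:M.
Proof.
move=> v0; set s := \sum_i v 0 i * (v 0 i)^*.
have s_ge0 : 0 <= s by apply: sumr_ge0 => i _; rewrite -normCK exprn_ge0.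
have s_neq0 : s != 0.
  apply: contra v0; rewrite psumr_eq0 => [/allP h|i _]; last first.
    by rewrite -normCK exprn_ge0.
  apply/eqP/rowP=> i; have := h i (mem_index_enum i).
  by rewrite mxE /= -normCK expf_eq0 /= normr_eq0 => /eqP.
have s_gt0 : 0 < s by rewrite lt_def s_neq0.
exists (sqrtC s)^-1; first by rewrite invr_eq0 sqrtC_eq0.
rewrite ctrZ -scalemxAl -scalemxAr scalerA rV_inner -/s.
have -> : ((sqrtC s)^-1)^* = (sqrtC s)^-1.
  by apply: geC0_conj; rewrite invr_ge0 sqrtC_ge0.
rewrite -invfM -expr2 sqrtCK scale_scalar_mx mulVf //.
Qed.

(** If no w j vanished, all l j would be roots of one characteristic polynomial. *)
Lemma eigen_seq_zero n (k : 'M[C]_n) (w : nat -> 'rV[C]_n) (l : nat -> C) :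
  injective l -> (forall j, w j *m k = l j *: w j) -> exists j, w j == 0.
Proof.
move=> linj wk; apply: contrapT => /forallNP h.
have root_l j : root (char_poly k) (l j).
  rewrite -eigenvalue_root_char; apply/eigenvalueP; exists (w j) => //.
  exact/negP/h.
have := @max_poly_roots _ (char_poly k) [seq l j | j <- iota 0 n.+1].
rewrite monic_neq0 ?char_poly_monic // map_inj_uniq // iota_uniq size_map.
rewrite size_iota size_char_poly ltnn => h'; apply: notF; apply: h' => //.
by apply/allP => _ /mapP [j _ ->].
Qed.

(** The row space of p is stable under k, which has an eigenvector there. *)
Lemma eigenvector_in_proj n (p k : 'M[C]_n) :
    p != 0 -> p *m p = p -> p *m k = k *m p ->
  exists (v : 'rV[C]_n) z, [/\ v != 0, v *m p = v & v *m k = z *: v].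
Proof.
move=> p0 pp pk; pose B := row_base p.
have Bk : (B *m k <= B)%MS.
  rewrite eq_row_base (eqmxMr _ (eq_row_base p)) pk.
  exact: submxMl.
have r0 : (0 < \rank p)%N by rewrite lt0n mxrank_eq0.
have [z /eigenvalueP [w wz w0]] := eigenvalue_closed (B *m k *m pinvmx B) r0.
exists (w *m B), z; split.
- apply: contra w0 => /eqP wB0; rewrite -(inj_eq (row_free_inj (row_base_free p))).
  by rewrite mul0mx wB0.
- have : (w *m B <= p)%MS by rewrite (submx_trans (submxMl _ _)) ?eq_row_base.
  by case/submxP => D ->; rewrite -mulmxA pp.
- by rewrite -mulmxA -{1}(mulmxKpV Bk) mulmxA wz -scalemxAl.
Qed.

End LinearAlgebra.

(** * Highest weight vectors *)

Section HighestWeight.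
Variables (R : realType) (q : R).
Local Notation C := R[i].
Local Notation "x %:C" := (real_complex R x).
Hypothesis hq0 : 0 < q.
Hypothesis hq1 : q != 1.
Local Notation Q := (q%:C).

Definition qh (m : int) : C := (qhalf q m)%:C.

Lemma sqrtq_gt0 : 0 < Num.sqrt q. Proof. by rewrite sqrtr_gt0. Qed.

Lemma qhalf_gt0 m : 0 < qhalf q m.
Proof. by rewrite exprz_gt0 // sqrtq_gt0. Qed.

Lemma qhalfD m n : qhalf q (m + n) = qhalf q m * qhalf q n.
Proof. by rewrite /qhalf expfzDr // gt_eqF // sqrtq_gt0. Qed.

Lemma qhalf0 : qhalf q 0 = 1. Proof. exact: expr0z. Qed.

Lemma qhalf2 m : qhalf q (m + m) = q ^ m.
Proof.
by rewrite qhalfD /qhalf -exprzMl ?unitfE ?gt_eqF ?sqrtq_gt0 // -expr2 sqr_sqrtr // ltW.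
Qed.

Lemma qhalf_inj : injective (qhalf q).
Proof.
apply: ieexprIz; first exact: sqrtq_gt0.
apply: contra hq1 => /eqP h.
by rewrite -[q]sqr_sqrtr ?ltW // h expr1n.
Qed.

Lemma qh_inj : injective qh.
Proof. by move=> m n /(fmorph_inj (real_complex R)) /qhalf_inj. Qed.

Lemma qhD m n : qh (m + n) = qh m * qh n.
Proof. by rewrite /qh qhalfD rmorphM. Qed.

Lemma qh0 : qh 0 = 1. Proof. by rewrite /qh qhalf0. Qed.

Lemma qh_gt0 m : 0 < qh m.
Proof. by rewrite /qh ltcR qhalf_gt0. Qed.

Lemma qh_neq0 m : qh m != 0. Proof. by rewrite gt_eqF // qh_gt0. Qed.

Lemma qhV m : qh (- m) = (qh m)^-1.
Proof.
by apply: (mulIf (qh_neq0 m)); rewrite mulVf ?qh_neq0 // -qhD addNr qh0.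
Qed.

Lemma qh_conj m : (qh m)^* = qh m. Proof. exact: conj_real_complex. Qed.

Lemma qh2 (n : nat) : qh (n%:Z + n%:Z) = Q ^+ n.
Proof. by rewrite /qh qhalf2 -exprnP rmorphXn. Qed.

Lemma q_sub_neq0 : q - q^-1 != 0.
Proof.
apply: contra hq1; rewrite subr_eq0 => /eqP h.
have : q * q = 1 by rewrite {2}h divff // gt_eqF.
by rewrite -expr2 => /eqP; rewrite sqrf_eq1 => /orP [//|/eqP h']; move: hq0; rewrite h' ltr0N1.
Qed.

Lemma q2_sub_neq0 : q * q - 1 != 0.
Proof.
have -> : q * q - 1 = q * (q - q^-1) by rewrite mulrBr divff // gt_eqF.
by rewrite mulf_neq0 ?q_sub_neq0 // gt_eqF.
Qed.

Lemma qnum_gt0 (n : nat) : 0 < qnum q n.+1%:Z.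
Proof.
have qn0 : q != 0 by rewrite gt_eqF.
elim: n => [|n IH].
  by rewrite /qnum -exprnN -exprnP expr1 divff // q_sub_neq0.
have -> : qnum q n.+2%:Z = q * qnum q n.+1%:Z + (q ^+ n.+1)^-1.
  rewrite /qnum -!exprnN -!exprnP !exprS; field.
  by rewrite qn0 expf_neq0 //= q2_sub_neq0.
by apply: addr_gt0; [apply: mulr_gt0 | rewrite invr_gt0 exprn_gt0].
Qed.


(** The images of K, its inverse, E and F under a *-representation on C^n in which
    K is positive.  The matrices act on row vectors from the right; hence f
    raises weights and e lowers them. *)
Record uq_mx n (k ki e f : 'M[C]_n) : Prop := {
  um_kki : k *m ki = 1%:M;
  um_kik : ki *m k = 1%:M;
  um_ke : k *m e = Q *: (e *m k);
  um_fk : f *m k = Q *: (k *m f);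
  um_ef : e *m f - f *m e = ((q - q^-1)^-1)%:C *: (k *m k - ki *m ki);
  um_k : ctr k = k;
  um_e : ctr e = f;
  um_pos : forall (v : 'rV[C]_n) z, v != 0 -> v *m k = z *: v -> 0 < z }.

Section UqMatrices.
Variables (n : nat) (k ki e f : 'M[C]_n).
Hypothesis H : uq_mx k ki e f.

Let Q0 : Q != 0. Proof. exact: qc_neq0. Qed.

Let Q2 : Q * Q - 1 != 0.
Proof.
have -> : Q * Q - 1 = (q * q - 1)%:C by rewrite rmorphB rmorphM rmorph1.
by rewrite fmorph_eq0 q2_sub_neq0.
Qed.

Lemma ek_comm : e *m k = Q^-1 *: (k *m e).
Proof. by rewrite (um_ke H) scalerA mulVf // scale1r. Qed.

Lemma eigen_lower (v : 'rV[C]_n) l j : v *m k = l *: v ->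
  iter j (mulmxr e) v *m k = (l / Q ^+ j) *: iter j (mulmxr e) v.
Proof.
move=> vk; elim: j => [|j IH]; first by rewrite expr0 divr1.
rewrite iterS /= -mulmxA ek_comm -scalemxAr mulmxA IH -scalemxAl scalerA exprS.
by rewrite invfM mulrCA.
Qed.

Lemma eigen_raise (v : 'rV[C]_n) l j : v *m k = l *: v ->
  iter j (mulmxr f) v *m k = (l * Q ^+ j) *: iter j (mulmxr f) v.
Proof.
move=> vk; elim: j => [|j IH]; first by rewrite expr0 mulr1.
rewrite iterS /= -mulmxA (um_fk H) -scalemxAr mulmxA IH -scalemxAl scalerA exprS.
by rewrite mulrCA.
Qed.

Lemma Qexp_inj : injective (fun j : nat => Q ^+ j).
Proof.
move=> i j; rewrite -!rmorphXn => /(fmorph_inj (real_complex R)) h.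
by have := @ieexprIz _ q hq0 hq1 i j h => -[].
Qed.

Lemma eigen_ki (v : 'rV[C]_n) l : l != 0 -> v *m k = l *: v -> v *m ki = l^-1 *: v.
Proof.
move=> l0 vk; have : v *m k *m ki = l *: (v *m ki) by rewrite vk scalemxAl.
by rewrite -mulmxA (um_kki H) mulmx1 => {2}->; rewrite scalerA mulVf // scale1r.
Qed.

Section HighestWeightVector.
Variables (v : 'rV[C]_n) (l : C).
Hypothesis v0 : v != 0.
Hypothesis vf : v *m f = 0.
Hypothesis vk : v *m k = l *: v.

Let w j := iter j (mulmxr e) v.
Let c j := (Q ^+ j.+1 - (Q ^+ j.+1)^-1) * (l ^+ 2 / Q ^+ j - Q ^+ j / l ^+ 2)
             / (Q - Q^-1) ^+ 2.

Let l0 : l != 0.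
Proof. by rewrite gt_eqF // (um_pos H v0 vk). Qed.

(** The coefficient [c j] is the sum over i <= j of
    (l^2 q^(-2i) - l^(-2) q^(2i)) / (q - 1/q), in closed form. *)
Lemma hw_ladder j : w j.+1 *m f = c j *: w j.
Proof.
have step i : w i.+1 *m f = w i *m f *m e +
    ((q - q^-1)^-1)%:C *: (((l / Q ^+ i) ^+ 2 - (l / Q ^+ i) ^- 2) *: w i).
  have -> : w i.+1 *m f = w i *m f *m e + w i *m (e *m f - f *m e).
    by rewrite mulmxBr !mulmxA addrC subrK.
  congr (_ + _); rewrite (um_ef H) -scalemxAr; congr (_ *: _).
  have wk : w i *m k = (l / Q ^+ i) *: w i by exact: eigen_lower.
  have li0 : l / Q ^+ i != 0 by rewrite mulf_neq0 ?invr_eq0 ?expf_neq0.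
  have wki := eigen_ki li0 wk.
  rewrite mulmxBr !mulmxA wk wki -!scalemxAl wk wki !scalerA -scalerBl.
  by rewrite -!expr2 exprVn.
elim: j => [|j IH]; rewrite step.
  rewrite {1}/w /= vf mul0mx add0r scalerA /c; congr (_ *: _).
  rewrite expr0 expr1 !divr1 fmorphV rmorphB fmorphV /=; field.
  by rewrite l0 Q0 Q2.
rewrite IH -scalemxAl -[w j *m e]/(w j.+1) scalerA -scalerDl /c; congr (_ *: _).
rewrite fmorphV rmorphB fmorphV /= !exprS; field.
by rewrite l0 Q0 Q2 expf_neq0.
Qed.

(** In finite dimension the ladder breaks off at some first L, where [c L] has to
    vanish.  This says l^4 = q^(2L), and positivity leaves l = q^(L/2). *)
Lemma hw_weight : exists L : nat,
  [/\ l = qh L%:Z, w L != 0, w L.+1 = 0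
    & forall j, (j <= L)%N ->
        w j.+1 *m f = (qnum q j.+1%:Z * qnum q (L%:Z - j%:Z))%:C *: w j].
Proof.
have ex0 : exists j, w j == 0.
  apply: (@eigen_seq_zero _ _ k w (fun j => l / Q ^+ j)) => [i j|j].
    by move/(mulfI l0)/invr_inj/Qexp_inj.
  exact: eigen_lower.
case: (ex_minnP ex0) => -[|L]; first by rewrite /w /= (negPf v0).
move=> /eqP wL1 minL.
have wL0 : w L != 0 by apply/negP => /minL; rewrite ltnn.
have Qpos j : 0 < Q ^+ j by rewrite exprn_gt0 // ltcR.
have cL : c L = 0.
  apply/eqP; have := hw_ladder L; rewrite wL1 mul0mx => /esym /eqP.
  by rewrite scaler_eq0 (negPf wL0) orbF.
have l2 : l ^+ 2 = Q ^+ L.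
  have QL0 : Q ^+ L.+1 - (Q ^+ L.+1)^-1 != 0.
    rewrite subr_eq0; apply/negP => /eqP h.
    have : Q ^+ (L.+1 + L.+1) = Q ^+ 0.
      by rewrite exprD {2}h divff // gt_eqF.
    by move/Qexp_inj.
  have Qm0 : (Q - Q^-1) ^+ 2 != 0.
    rewrite expf_neq0 // -fmorphV -rmorphB fmorph_eq0; exact: q_sub_neq0.
  move: cL => /eqP; rewrite /c mulf_eq0 invr_eq0 (negPf Qm0) orbF mulf_eq0.
  rewrite (negPf QL0) /= subr_eq0 => /eqP h.
  have lpos := um_pos H v0 vk.
  apply: (@pexpIrn _ 2 isT); rewrite ?nnegrE ?exprn_ge0 ?ltW ?ltcR //.
  move/eqP: h; rewrite eqr_div ?expf_neq0 // => /eqP h.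
  by rewrite [LHS]expr2 h [RHS]expr2.
exists L; split=> //.
- have lpos := um_pos H v0 vk.
  apply: (@pexpIrn _ 2 isT); rewrite ?nnegrE ?ltW ?qh_gt0 //.
  by rewrite /= l2 -qh2 qhD expr2.
- move=> j jL; rewrite hw_ladder; congr (_ *: _); rewrite /c l2 /qnum.
  rewrite -(subnKC jL) PoszD addrAC subrr add0r.
  rewrite -!exprnN -!exprnP rmorphM !fmorph_div !rmorphB !fmorphV !rmorphXn /=.
  rewrite exprD; field.
  by rewrite Q0 Q2 !expf_neq0.
Qed.

End HighestWeightVector.
End UqMatrices.
End HighestWeight.

(** * Spin representations inside a *-representation *)

Section SpinBlocks.
Variables (R : realType) (q : R).
Local Notation C := R[i].
Local Notation "x %:C" := (real_complex R x).
Hypothesis hq0 : 0 < q.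
Hypothesis hq1 : q != 1.
Local Notation Q := (q%:C).
Local Notation qh := (qh q).

Definition spinK L : 'M[C]_L.+1 := diag_mx (\row_j qh (dbl j)).
Definition spinE L : 'M[C]_L.+1 :=
  \matrix_(i, j) if (i == j.+1 :> nat) then (alpha q j)%:C else 0.
Definition spinF L : 'M[C]_L.+1 :=
  \matrix_(i, j) if (i.+1 == j :> nat) then (alpha q i)%:C else 0.

Variables (n : nat) (k ki e f : 'M[C]_n).
Hypothesis H : uq_mx q k ki e f.

Lemma eigen_orth (v w : 'rV[C]_n) (a b : R) :
  v *m k = a%:C *: v -> w *m k = b%:C *: w -> a != b -> v *m ctr w = 0.
Proof.
move=> va wb ab.
have h : a%:C *: (v *m ctr w) = b%:C *: (v *m ctr w).
  rewrite scalemxAl -va -mulmxA -{1}(um_k H) -ctrM wb ctrZ conj_real_complex.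
  by rewrite scalemxAr.
apply/eqP; move/eqP: h; rewrite -subr_eq0 -scalerBl scaler_eq0 -rmorphB.
by rewrite fmorph_eq0 subr_eq0 (negPf ab).
Qed.

Section HighestWeightBasis.
Variables (v : 'rV[C]_n) (L : nat).
Hypothesis vf : v *m f = 0.
Hypothesis vk : v *m k = qh L%:Z *: v.
Hypothesis v1 : v *m ctr v = 1%:M.
Let w j := iter j (mulmxr e) v.
Hypothesis wL : w L.+1 = 0.
Hypothesis wf : forall j, (j <= L)%N ->
  w j.+1 *m f = (qnum q j.+1%:Z * qnum q (L%:Z - j%:Z))%:C *: w j.

(* Dividing by the square roots [a j] of the ladder coefficients makes the
   vectors orthonormal: e and f are adjoint to each other, so consecutive
   vectors of the rescaled ladder have the same norm. *)
Let a j : R := Num.sqrt (qnum q j.+1%:Z * qnum q (L%:Z - j%:Z)).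
Let b j : R := \prod_(i < j) (a i)^-1.
Let ww j := (b j)%:C *: w j.

Let a_gt0 j : (j < L)%N -> 0 < a j.
Proof.
move=> jL; rewrite sqrtr_gt0 mulr_gt0 ?qnum_gt0 //.
have -> : L%:Z - j%:Z = ((L - j.+1).+1)%:Z by lia.
exact: qnum_gt0.
Qed.

Let a2 j : (j < L)%N -> a j * a j = qnum q j.+1%:Z * qnum q (L%:Z - j%:Z).
Proof.
move=> jL; rewrite -expr2 sqr_sqrtr //.
by have := a_gt0 jL; rewrite sqrtr_gt0 => /ltW.
Qed.

Let ww0 : ww 0 = v.
Proof. by rewrite /ww /b big_ord0 rmorph1 scale1r. Qed.

Let wwS j : (j < L)%N -> ww j *m e = (a j)%:C *: ww j.+1.
Proof.
move=> jL; rewrite /ww scalerA -rmorphM /b big_ord_recr /= mulrCA divff.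
  by rewrite mulr1 -scalemxAl.
by rewrite gt_eqF // a_gt0.
Qed.

Let wwL : ww L *m e = 0.
Proof. by rewrite /ww -scalemxAl -[w L *m e]/(w L.+1) wL scaler0. Qed.

Let wwf j : (j < L)%N -> ww j.+1 *m f = (a j)%:C *: ww j.
Proof.
move=> jL; rewrite /ww -scalemxAl wf ?(ltnW jL) // !scalerA -!rmorphM -a2 //.
congr ((_)%:C *: _); rewrite /b big_ord_recr /= mulrA divfK; first exact: mulrC.
by rewrite gt_eqF // a_gt0.
Qed.

Let wwk j : ww j *m k = qh (L%:Z - (j + j)%N%:Z) *: ww j.
Proof.
rewrite /ww -scalemxAl (eigen_lower hq0 H _ vk) !scalerA mulrC; congr (_ *: _).
by rewrite qhD // qhV // PoszD qh2.
Qed.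

Let ww_norm j : (j <= L)%N -> ww j *m ctr (ww j) = 1%:M.
Proof.
elim: j => [|j IH] jL; first by rewrite ww0.
have a0 : (a j)%:C != 0 by rewrite fmorph_eq0 gt_eqF // a_gt0.
have h : (a j)%:C *: (ww j.+1 *m ctr (ww j.+1)) =
         (a j)%:C *: (ww j *m ctr (ww j)).
  rewrite scalemxAl -wwS // -mulmxA.
  have -> : e *m ctr (ww j.+1) = ctr (ww j.+1 *m f).
    by rewrite ctrM -(um_e H) ctrK.
  by rewrite wwf // ctrZ conj_real_complex scalemxAr.
by rewrite -IH ?(ltnW jL) //; apply: (scalerI a0).
Qed.

(* The ladder descends from the highest weight L/2, whereas the basis of the
   spin representation is numbered by increasing weight. *)
Let T : 'M[C]_(L.+1, n) := \matrix_(i < L.+1) ww (L - i)%N.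

Lemma spin_basis : [/\ forall p : 'M[C]_n, v *m p = v -> p *m e = e *m p -> T *m p = T,
  T *m ctr T = 1%:M, T *m k = spinK L *m T, T *m e = spinE L *m T
  & T *m f = spinF L *m T].
Proof.
have rT i : row i T = ww (L - i)%N by rewrite rowK.
split.
- move=> p vp pe; apply/row_matrixP => i; rewrite row_mul rT /ww -scalemxAl.
  congr (_ *: _); elim: (L - i)%N => [//|j IH].
  by rewrite /w iterS /= -/(w j) -mulmxA -pe mulmxA IH.
- apply/matrixP => i j; transitivity ((ww (L - i)%N *m ctr (ww (L - j)%N)) 0 0).
    by rewrite !mxE; apply: eq_bigr => m _; rewrite !mxE.
  case: (eqVneq i j) => [<-|ij].
    by rewrite ww_norm ?leq_subr // !mxE !eqxx.
  rewrite (@eigen_orth _ _ (qhalf q (L%:Z - (L - i + (L - i))%N%:Z))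
    (qhalf q (L%:Z - (L - j + (L - j))%N%:Z))); rewrite ?mxE ?(negPf ij) //.
  apply: contra ij => /eqP /(qhalf_inj hq0 hq1) h; apply/eqP/val_inj => /=.
  have := ltn_ord i; have := ltn_ord j; lia.
- apply/row_matrixP => i; rewrite !row_mul rT wwk row_diag_mx -scalemxAl.
  rewrite -rowE rT mxE; congr (qh _ *: _); rewrite /dbl.
  have := ltn_ord i; lia.
- apply/row_matrixP => i; rewrite !row_mul rT.
  have -> : row i (spinE L) *m T = \sum_j spinE L i j *: row j T.
    by rewrite mulmx_sum_row; apply: eq_bigr => j _; rewrite mxE.
  case: i => -[|i] iL /=.
    rewrite big1 ?subn0 // => j _; rewrite mxE /= scale0r //.
  rewrite (bigD1 (Ordinal (ltnW iL))) //= big1 ?addr0 => [|j ji]; last first.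
    rewrite mxE /=; case: eqP => [[ij]|_]; last by rewrite scale0r.
    by move: ji; rewrite -val_eqE /= ij eqxx.
  rewrite mxE /= eqxx rT wwS; last lia.
  rewrite (_ : (L - i.+1).+1 = (L - i)%N); last lia.
  congr ((_)%:C *: _); rewrite /a /alpha /=; congr (Num.sqrt (qnum q _ * qnum q _)).
  + lia.
  + lia.
- apply/row_matrixP => i; rewrite !row_mul rT.
  have -> : row i (spinF L) *m T = \sum_j spinF L i j *: row j T.
    by rewrite mulmx_sum_row; apply: eq_bigr => j _; rewrite mxE.
  case: (ltnP i L) => iL.
    have iL' : (i.+1 < L.+1)%N by [].
    rewrite (bigD1 (Ordinal iL')) //= big1 ?addr0 => [|j ji]; last first.
      rewrite mxE /=; case: eqP => [ij|_]; last by rewrite scale0r.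
      by move: ji; rewrite -val_eqE /= ij eqxx.
    rewrite mxE /= eqxx rT /= (_ : (L - i)%N = (L - i.+1).+1); last lia.
    rewrite wwf; last lia.
    congr ((_)%:C *: _); rewrite /a /alpha /=; congr (Num.sqrt (qnum q _ * qnum q _)).
    + lia.
    + lia.
  rewrite (_ : (L - i)%N = 0%N); last lia.
  rewrite ww0 vf big1 // => j _; rewrite mxE; case: eqP => [ij|]; last by rewrite scale0r.
  by have := ltn_ord j; lia.
Qed.

End HighestWeightBasis.

(** By [eigen_seq_zero] there is a last nonzero vector among the v f^j. *)
Lemma highest_weight_exists (v : 'rV[C]_n) z : v != 0 -> v *m k = z *: v ->
  exists j : nat, [/\ iter j (mulmxr f) v != 0, iter j (mulmxr f) v *m f = 0 &
    iter j (mulmxr f) v *m k = (z * Q ^+ j) *: iter j (mulmxr f) v].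
Proof.
move=> v0 vk; have z_gt0 := um_pos H v0 vk.
have ex0 : exists j, iter j (mulmxr f) v == 0.
  apply: (@eigen_seq_zero _ _ k _ (fun j => z * Q ^+ j)) => [i j|j].
    by move/(mulfI (lt0r_neq0 z_gt0))/(Qexp_inj hq0 hq1).
  exact: (eigen_raise H).
case: (ex_minnP ex0) => -[|j]; first by rewrite /= (negPf v0).
move=> /eqP uf minj; exists j; split=> //; last exact: (eigen_raise H).
by apply/negP => /minj; rewrite ltnn.
Qed.

(** A nonzero invariant subspace, given as the range of an equivariant projection
    p, contains an isometric copy of a spin representation. *)
Lemma spin_in_proj (p : 'M[C]_n) : p != 0 -> p *m p = p ->
    p *m k = k *m p -> p *m e = e *m p -> p *m f = f *m p ->
  exists L (T : 'M[C]_(L.+1, n)), [/\ T *m p = T, T *m ctr T = 1%:M,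
    T *m k = spinK L *m T, T *m e = spinE L *m T & T *m f = spinF L *m T].
Proof.
move=> p0 pp pk pe pf.
have [v [z [v0 vp vk]]] := eigenvector_in_proj p0 pp pk.
have [j [u0 uf uk]] := highest_weight_exists v0 vk.
set u := iter j (mulmxr f) v in u0 uf uk.
have up : u *m p = u.
  rewrite /u; elim: j {uf u u0 uk} => [//|j IH].
  by rewrite iterS /= -mulmxA -pf mulmxA IH.
have [c c0 cu] := normalize_rV u0.
have cuf : (c *: u) *m f = 0 by rewrite -scalemxAl uf scaler0.
have cuk : (c *: u) *m k = (z * Q ^+ j) *: (c *: u).
  by rewrite -scalemxAl uk !scalerA mulrC.
have cu0 : c *: u != 0 by rewrite scaler_eq0 (negPf c0).
have [L [zL _ wL wf]] := hw_weight hq0 hq1 H cu0 cuf cuk.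
rewrite zL in cuk.
have [Tp TT Tk Te Tf] := spin_basis cuf cuk cu wL wf.
eexists L, _; split; [|exact: TT|exact: Tk|exact: Te|exact: Tf].
by apply: Tp => //; rewrite -scalemxAl up.
Qed.

(** The weight of v differs by an integer from the highest weight above it. *)
Lemma weight_half_int (v : 'rV[C]_n) z : v != 0 -> v *m k = z *: v ->
  exists m : int, z = qh m.
Proof.
move=> v0 vk; have [j [u0 uf uk]] := highest_weight_exists v0 vk.
have [L [zL _ _ _]] := hw_weight hq0 hq1 H u0 uf uk.
exists (L%:Z - (j + j)%N%:Z); rewrite qhD // qhV // PoszD qh2 // -zL mulfK //.
by rewrite expf_neq0 // qc_neq0.
Qed.

End SpinBlocks.

(** * Multisets of weights *)

Section Weights.
Variables (R : realType) (q : R).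
Local Notation C := R[i].
Local Notation "x %:C" := (real_complex R x).
Hypothesis hq0 : 0 < q.
Hypothesis hq1 : q != 1.
Local Notation Q := (q%:C).
Local Notation qh := (qh q).

Definition weight_mx r (g : 'I_r -> int) : 'M[C]_r := diag_mx (\row_i qh (g i)).

(** The rows of S form an orthonormal basis of the row space of p that consists of
    eigenvectors of k, with eigenvalues q^(g i/2). *)
Definition has_weights n (p k : 'M[C]_n) r (g : 'I_r -> int) : Prop :=
  exists S : 'M[C]_(r, n),
    [/\ S *m ctr S = 1%:M, ctr S *m S = p & S *m k = weight_mx g *m S].

Lemma weight_mxE r m (g : 'I_r -> int) (S : 'M[C]_(r, m)) i j :
  (weight_mx g *m S) i j = qh (g i) * S i j.
Proof. by rewrite mul_diag_mx !mxE. Qed.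

Lemma ctr_weight_mx r (g : 'I_r -> int) : ctr (weight_mx g) = weight_mx g.
Proof.
apply/matrixP=> i j; rewrite !mxE eq_sym; case: eqP => [->|_].
  by rewrite mulr1n qh_conj.
by rewrite mulr0n conjC0.
Qed.

Definition sum_fun r1 r2 (g1 : 'I_r1 -> int) (g2 : 'I_r2 -> int) (i : 'I_(r1 + r2)) :=
  match fintype.split i with inl j => g1 j | inr j => g2 j end.

Lemma sum_funl r1 r2 (g1 : 'I_r1 -> int) (g2 : 'I_r2 -> int) i :
  sum_fun g1 g2 (lshift r2 i) = g1 i.
Proof. by rewrite /sum_fun (unsplitK (inl i)). Qed.

Lemma sum_funr r1 r2 (g1 : 'I_r1 -> int) (g2 : 'I_r2 -> int) i :
  sum_fun g1 g2 (rshift r1 i) = g2 i.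
Proof. by rewrite /sum_fun (unsplitK (inr i)). Qed.

Lemma weight_mx_sum r1 r2 (g1 : 'I_r1 -> int) (g2 : 'I_r2 -> int) :
  weight_mx (sum_fun g1 g2) = block_mx (weight_mx g1) 0 0 (weight_mx g2).
Proof.
rewrite /weight_mx -diag_mx_row; congr diag_mx; apply/rowP => i.
case: (split_ordP i) => j ->; rewrite ?row_mxEl ?row_mxEr !mxE.
  by rewrite sum_funl.
by rewrite sum_funr.
Qed.

Lemma ctr_block m1 m2 n1 n2 (a : 'M[C]_(m1, n1)) b c (d : 'M_(m2, n2)) :
  ctr (block_mx a b c d) = block_mx (ctr a) (ctr c) (ctr b) (ctr d).
Proof. by rewrite /ctr map_block_mx tr_block_mx. Qed.

Lemma ctr_col_mx m1 m2 n (a : 'M[C]_(m1, n)) (b : 'M_(m2, n)) :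
  ctr (col_mx a b) = row_mx (ctr a) (ctr b).
Proof. by rewrite /ctr map_col_mx tr_col_mx. Qed.

Lemma has_weights_sum n1 n2 (p1 k1 : 'M[C]_n1) (p2 k2 : 'M[C]_n2) r1 r2
    (g1 : 'I_r1 -> int) (g2 : 'I_r2 -> int) :
  has_weights p1 k1 g1 -> has_weights p2 k2 g2 ->
  has_weights (block_mx p1 0 0 p2) (block_mx k1 0 0 k2) (sum_fun g1 g2).
Proof.
move=> [S1 [a1 b1 c1]] [S2 [a2 b2 c2]]; exists (block_mx S1 0 0 S2).
rewrite ctr_block !ctr0 weight_mx_sum !mulmx_block !mulmx0 !mul0mx !addr0 !add0r.
by rewrite a1 a2 b1 b2 c1 c2 -scalar_mx_block.
Qed.

(** Split off one normalized eigenvector at a time. *)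
Lemma weights_exist n (k ki e f : 'M[C]_n) (H : uq_mx q k ki e f) (p : 'M[C]_n) :
    p *m p = p -> ctr p = p -> p *m k = k *m p ->
  exists r (g : 'I_r -> int), has_weights p k g.
Proof.
have [m] := ubnP (\rank p); elim: m p => // m IH p rp pp pa pk.
have [p0|p0] := eqVneq p 0.
  exists 0%N, (fun _ => 0), 0; rewrite ctr0 !mulmx0 p0 !mul0mx; split => //.
  by apply/matrixP => -[].
have [v [z [v0 vp vk]]] := eigenvector_in_proj p0 pp pk.
have [j zj] := weight_half_int hq0 hq1 H v0 vk.
have [c c0 cc] := normalize_rV v0.
set w := c *: v in cc.
have wp : w *m p = w by rewrite /w -scalemxAl vp.
have wk : w *m k = qh j *: w by rewrite /w -scalemxAl vk zj !scalerA mulrC.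
have kw : k *m ctr w = qh j *: ctr w.
  by rewrite -{1}(um_k H) -ctrM wk ctrZ qh_conj.
have pw : p *m ctr w = ctr w by rewrite -{1}pa -ctrM wp.
pose p' := p - ctr w *m w.
have wp' : w *m p' = 0 by rewrite /p' mulmxBr mulmxA cc mul1mx wp subrr.
have pp' : p' *m p = p' by rewrite /p' mulmxBl pp -mulmxA wp.
have p'p : p *m p' = p' by rewrite /p' mulmxBr pp mulmxA pw.
have p'p' : p' *m p' = p' by rewrite {1}/p' mulmxBl p'p -mulmxA wp' mulmx0 subr0.
have p'a : ctr p' = p' by rewrite /p' ctrD ctrN ctrM ctrK pa.
have p'k : p' *m k = k *m p'.
  rewrite /p' mulmxBl mulmxBr pk -mulmxA wk mulmxA kw -scalemxAl -scalemxAr.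
  by [].
have rp' : (\rank p' < m)%N.
  rewrite ltnS in rp; apply: leq_trans rp.
  have sub : (p' <= p)%MS by rewrite -pp' submxMl.
  rewrite (ltn_leqif (mxrank_leqif_sup sub)); apply/negP => /submxP [D pD].
  have w0 : w = 0 by rewrite -wp -pa pD ctrM p'a mulmxA wp' mul0mx.
  by move/eqP: cc; rewrite w0 mul0mx eq_sym oner_eq0.
have [r [g [S [SS SS' Sk]]]] := IH p' rp' p'p' p'a p'k.
have Sp' : S *m p' = S by rewrite -SS' mulmxA SS mul1mx.
have Sw : S *m ctr w = 0 by rewrite -Sp' -mulmxA -p'a -ctrM wp' ctr0 mulmx0.
have wS : w *m ctr S = 0 by rewrite -[w]ctrK -ctrM Sw ctr0.
exists (1 + r)%N, (sum_fun (fun _ : 'I_1 => j) g), (col_mx w S); split.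
- by rewrite ctr_col_mx mul_col_row cc SS wS Sw -scalar_mx_block.
- by rewrite ctr_col_mx mul_row_col SS' addrC subrK.
- rewrite mul_col_mx weight_mx_sum mul_block_col !mul0mx addr0 add0r Sk.
  congr (col_mx _ _); apply/matrixP => i i'; rewrite wk weight_mxE mxE.
  by rewrite ord1.
Qed.

(** In weight bases w becomes a unitary matrix Z that intertwines the two diagonal
    matrices of weights.  It intertwines the indicators of each single weight N
    as well, and the traces of these are the multiplicities of N. *)
Lemma weights_unique n n' (p k : 'M[C]_n) (p' k' : 'M[C]_n') r r'
    (g : 'I_r -> int) (g' : 'I_r' -> int) (w : 'M[C]_(n', n)) :
    has_weights p k g -> has_weights p' k' g' -> ctr k = k ->
    ctr w *m w = p -> w *m ctr w = p' -> w *m k = k' *m w ->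
  \sum_i << g i >> = \sum_i << g' i >> :> {freeg int}.
Proof.
move=> [S [SS SS' Sk]] [S' [TT TT' Tk]] ka wp wp' wk.
pose Z := S' *m w *m ctr S.
have Sp : S *m p = S by rewrite -SS' mulmxA SS mul1mx.
have S'p : S' *m p' = S' by rewrite -TT' mulmxA TT mul1mx.
have wpp : p' *m w = w *m p by rewrite -wp -wp' mulmxA.
have ctrZ : ctr Z = S *m ctr w *m ctr S' by rewrite /Z !ctrM ctrK mulmxA.
have ZZ : ctr Z *m Z = 1%:M.
  rewrite ctrZ /Z !mulmxA -[_ *m ctr S' *m S']mulmxA TT' -[_ *m p' *m w]mulmxA wpp.
  by rewrite !mulmxA -[_ *m ctr w *m w]mulmxA wp Sp Sp SS.
have ZZ' : Z *m ctr Z = 1%:M.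
  rewrite ctrZ /Z !mulmxA -[_ *m ctr S *m S]mulmxA SS' -[S' *m w *m p]mulmxA -wpp.
  by rewrite !mulmxA S'p -[_ *m w *m ctr w]mulmxA wp' S'p TT.
have kS : k *m ctr S = ctr S *m weight_mx g.
  by rewrite -{1}ka -ctrM Sk ctrM ctr_weight_mx.
have Zk : Z *m weight_mx g = weight_mx g' *m Z.
  by rewrite /Z -mulmxA -kS mulmxA -[_ *m w *m k]mulmxA wk !mulmxA Tk.
pose del N m (h : 'I_m -> int) : 'M[C]_m := diag_mx (\row_i (h i == N)%:R).
have Zd N : Z *m del N _ g = del N _ g' *m Z.
  apply/matrixP => i j; rewrite mul_diag_mx mul_mx_diag !mxE.
  have := congr1 (fun M : 'M[C]_(_, _) => M i j) Zk.
  rewrite /= weight_mxE mul_mx_diag !mxE mulrC.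
  move/eqP; rewrite -subr_eq0 -mulrBl mulf_eq0 subr_eq0.
  case/orP => [/eqP /(qh_inj hq0 hq1) ->|/eqP ->]; first by rewrite mulrC.
  by rewrite mul0r mulr0.
have trE N m (h : 'I_m -> int) :
    \tr (del N m h) = ((\sum_i (h i == N))%N)%:R.
  by rewrite mxtrace_diag natr_sum; apply: eq_bigr => i _; rewrite !mxE.
apply/eqP/freeg_eqP => N; rewrite !raddf_sum /=.
under eq_bigr do rewrite coeffU mul1r.
under [RHS]eq_bigr do rewrite coeffU mul1r.
rewrite -!natr_sum; congr (_%:R); apply/eqP.
rewrite -(eqr_nat C) -!trE; apply/eqP.
rewrite -[del N _ g]mul1mx -ZZ -mulmxA Zd mxtrace_mulC -mulmxA ZZ' mulmx1.
by [].
Qed.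

Lemma weights_fiber n n' (p k : 'M[C]_n) (p' k' : 'M[C]_n') r (g : 'I_r -> int) :
    has_weights p k g -> has_weights p' k' g -> ctr k' = k' ->
  exists w : 'M[C]_(n', n),
    [/\ ctr w *m w = p, w *m ctr w = p' & w *m k = k' *m w].
Proof.
move=> [S [SS SS' Sk]] [S' [TT TT' Tk]] ka; exists (ctr S' *m S).
have kS : k' *m ctr S' = ctr S' *m weight_mx g.
  by rewrite -{1}ka -ctrM Tk ctrM ctr_weight_mx.
rewrite ctrM ctrK; split.
- by rewrite mulmxA -[_ *m S' *m ctr S']mulmxA TT mulmx1.
- by rewrite mulmxA -[_ *m S *m ctr S]mulmxA SS mulmx1.
- by rewrite -mulmxA Sk !mulmxA kS.
Qed.

End Weights.

(** * Grothendieck groups that are free *)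

Local Open Scope quotient_scope.

Lemma freeg_additive_ext (T : choiceType) (M : zmodType) (f g : {freeg T} -> M) :
  {morph f : x y / x - y} -> {morph g : x y / x - y} ->
  (forall x, f << x >> = g << x >>) -> f =1 g.
Proof.
move=> fB gB fg.
pose f' : {additive {freeg T} -> M} := HB.pack f (GRing.isZmodMorphism.Build _ _ f fB).
pose g' : {additive {freeg T} -> M} := HB.pack g (GRing.isZmodMorphism.Build _ _ g gB).
move=> D; change (f' D = g' D); rewrite -(freeg_sumE D) !raddf_sum.
apply: eq_bigr => x _; have -> : << coeff x D *g x >> = << x >> *~ coeff x D.
  by rewrite freegU_mulz intz.
by rewrite !raddfMz /= fg.
Qed.

Section FreeGrothendieck.
Variables (C : numClosedFieldType) (U : hopfStarAlg C) (A : algType C).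
Variables (st : A -> A) (act : U -> A -> A) (B : {pred A}) (theta : A -> A).
Variable adm : forall n, (U -> 'M[C]_n) -> Prop.
Local Notation invproj := (inv_proj st act B theta adm).
Local Notation K0 := (equivK0 st act B theta adm).
Variables (T : choiceType) (wt : invproj -> {freeg T}) (G : T -> invproj).
Hypothesis wt_mvn : forall P Q, mvn_equiv P Q -> wt P = wt Q.
Hypothesis wt_dsum : forall P Q
  (h : is_inv_proj st act B theta adm (dsum_mx (ip_mx P) (ip_mx Q))
                     (dsum_rep (ip_rep P) (ip_rep Q))),
  wt (InvProj h) = wt P + wt Q.
Hypothesis wtG : forall N, wt (G N) = << N >>.

(** The inverse of the isomorphism of [K0_free]. *)
Definition K0_of_weights (y : {freeg T}) : K0 :=
  fglift (fun N => K0_class (G N) : zmodule K0) y.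

Let K0_of_weightsB : {morph K0_of_weights : x y / x - y}.
Proof. exact: (@lift_is_additive _ _ (zmodule K0)). Qed.

Lemma K0_of_weightsU N : K0_of_weights << N >> = K0_class (G N).
Proof. by rewrite /K0_of_weights liftU scale1r. Qed.

Lemma K0_of_weights_sum r (g : 'I_r -> T) :
  K0_of_weights (\sum_i << g i >>) = \sum_i K0_class (G (g i)).
Proof.
pose f : {additive {freeg T} -> K0} :=
  HB.pack K0_of_weights (GRing.isZmodMorphism.Build _ _ K0_of_weights K0_of_weightsB).
rewrite -[K0_of_weights]/(f : _ -> _) raddf_sum.
by apply: eq_bigr => i _; exact: K0_of_weightsU.
Qed.

Hypothesis wtK : forall P, K0_of_weights (wt P) = K0_class P.

Let phi0 : {freeg invproj} -> {freeg T} := fglift wt.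

Let phi0B : {morph phi0 : x y / x - y}.
Proof. exact: lift_is_additive. Qed.

Let phi0U P : phi0 << P >> = wt P.
Proof. by rewrite /phi0 liftU scale1r. Qed.

Let phi0_rel x : K0_rel x -> phi0 x = 0.
Proof.
elim=> [|{}x y _ hx _ hy|P Q /wt_mvn h|P Q h].
- by rewrite -(subrr 0) phi0B subrr.
- by rewrite phi0B hx hy subrr.
- by rewrite phi0B !phi0U h subrr.
- by rewrite !phi0B !phi0U wt_dsum addrAC addrK subrr.
Qed.

Let phi (x : K0) : {freeg T} := phi0 (repr x).

Let phi_pi D : phi (\pi_K0 D) = phi0 D.
Proof.
apply/eqP; rewrite -subr_eq0 -phi0B; apply/eqP/phi0_rel/asboolP.
have : repr (\pi_K0 D) - D \in @K0_relb _ _ _ st act B theta adm.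
  by rewrite Quotient.idealrBE reprK.
by [].
Qed.

Let piB : {morph (\pi_K0 : {freeg invproj} -> K0) : x y / x - y}.
Proof. by move=> x y; rewrite raddfB. Qed.

Let phiB : {morph phi : x y / x - y}.
Proof.
by move=> x y; rewrite -[x]reprK -[y]reprK -piB !phi_pi phi0B.
Qed.

(** An additive invariant [wt] of equivalence classes is an isomorphism onto a free
    group as soon as there are elements G N with invariant N such that every
    class is the combination of theirs prescribed by its invariant. *)
Lemma K0_free : exists2 phi : {additive K0 -> {freeg T}},
  bijective phi & forall N, phi (K0_class (G N)) = << N >>.
Proof.
pose phi' : {additive K0 -> {freeg T}} :=
  HB.pack phi (GRing.isZmodMorphism.Build _ _ phi phiB).
exists phi'; last first.
  by move=> N; rewrite /= /K0_class phi_pi phi0U.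
exists K0_of_weights => [x|y] /=.
- rewrite -[x]reprK phi_pi.
  apply: (@freeg_additive_ext _ _ (K0_of_weights \o phi0) (\pi_K0)) => [u v|//|P] /=.
    by rewrite phi0B K0_of_weightsB.
  by rewrite phi0U wtK.
- apply: (@freeg_additive_ext _ _ (phi \o K0_of_weights) id) => [u v|//|N] /=.
    by rewrite K0_of_weightsB phiB.
  by rewrite K0_of_weightsU /K0_class phi_pi phi0U.
Qed.

End FreeGrothendieck.

(** * The Peter-Weyl basis and the two actions *)

Section PeterWeyl.
Variables (R : realType) (q : R).
Local Notation C := R[i].
Local Notation "x %:C" := (real_complex R x).
Hypothesis hq0 : 0 < q.
Hypothesis hq1 : q != 1.
Local Notation Q := (q%:C).
Local Notation qh := (qh q).
Variables (U : hopfStarAlg C) (E F K Ki : U).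
Hypothesis hU : is_uq_su2 q E F K Ki.
Variables (A : hopfStarAlg C) (a b c d : A) (t : forall L : nat, 'M[A]_L.+1).
Hypothesis ht : is_peter_weyl a b c d t.
Variable act : U -> A -> A.
Hypothesis hact : is_left_action q E F K t act.
Variable pd : U -> A -> A.
Hypothesis hpd : is_partial_action q K t act pd.

Local Notation actx f := (map_mx (act f)).
Local Notation stx := (stmx (@hstar _ A)).
Local Notation scal := (@scalmx _ A _ _).
Local Notation epsx := (map_mx (@heps _ A)).
Local Notation B := (podles K pd).

Let msa := la_msa hact.

Definition pw_cst L (j : 'I_L.+1) : C :=
  (Num.sqrt (qnum q (L%:Z + 1)) * qhalf q (dbl j))%:C.

Lemma pw_cst_neq0 L (j : 'I_L.+1) : pw_cst j != 0.
Proof.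
rewrite fmorph_eq0 mulf_neq0 // gt_eqF ?qhalf_gt0 // sqrtr_gt0.
by rewrite (_ : L%:Z + 1 = L.+1%:Z) ?qnum_gt0 //; lia.
Qed.

Lemma pw_vE L (j k : 'I_L.+1) : pw_v q t j k = pw_cst j *: t L j k.
Proof. by []. Qed.

Lemma pw_tE L (j k : 'I_L.+1) : t L j k = (pw_cst j)^-1 *: pw_v q t j k.
Proof. by rewrite pw_vE scalerA mulVf ?scale1r // pw_cst_neq0. Qed.

Lemma act_tK L (j k : 'I_L.+1) : act K (t L j k) = qh (dbl k) *: t L j k.
Proof.
rewrite {1}pw_tE (linZ _ _ (act_linear msa _)) (la_K hact) pw_vE !scalerA.
by congr (_ *: _); rewrite mulrAC mulVf ?mul1r // pw_cst_neq0.
Qed.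

Lemma act_tE L (j k : 'I_L.+1) : act E (t L j k) =
  \sum_(i : 'I_L.+1 | i == k.+1 :> nat) (alpha q k)%:C *: t L j i.
Proof.
rewrite {1}pw_tE (linZ _ _ (act_linear msa _)) (la_E hact) scaler_sumr.
apply: eq_bigr => i _; rewrite pw_vE !scalerA; congr (_ *: _).
by rewrite mulrAC mulVf ?mul1r // pw_cst_neq0.
Qed.

Lemma act_tF L (j k : 'I_L.+1) : act F (t L j k) =
  \sum_(i : 'I_L.+1 | i.+1 == k :> nat) (alpha q i)%:C *: t L j i.
Proof.
rewrite {1}pw_tE (linZ _ _ (act_linear msa _)) (la_F hact) scaler_sumr.
apply: eq_bigr => i _; rewrite pw_vE !scalerA; congr (_ *: _).
by rewrite mulrAC mulVf ?mul1r // pw_cst_neq0.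
Qed.

Lemma actx_tK L : actx K (t L) = t L *m scal (spinK q L).
Proof.
apply/matrixP=> i j; rewrite !mxE act_tK (bigD1 j) //= big1 ?addr0.
  by rewrite !mxE eqxx mulr1n mulr_algr.
by move=> k kj; rewrite !mxE (negPf kj) mulr0n /= mulr_algr scale0r.
Qed.

Lemma actx_tE L : actx E (t L) = t L *m scal (spinE q L).
Proof.
apply/matrixP=> i j; rewrite !mxE act_tE big_mkcond; apply: eq_bigr => k _.
by rewrite !mxE /=; case: ifP => _; rewrite ?mulr_algr ?scale0r.
Qed.

Lemma actx_tF L : actx F (t L) = t L *m scal (spinF q L).
Proof.
apply/matrixP=> i j; rewrite !mxE act_tF big_mkcond; apply: eq_bigr => k _.
by rewrite !mxE /=; case: ifP => _; rewrite ?mulr_algr ?scale0r.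
Qed.

Lemma epsx_t L : epsx (t L) = 1%:M.
Proof. by apply/matrixP=> i j; rewrite !mxE (pw_corep ht L).2. Qed.

Lemma pw_ext (V : lmodType C) (f g : A -> V) : linear f -> linear g ->
  (forall L j k, f (t L j k) = g (t L j k)) -> f =1 g.
Proof.
move=> fl gl fg x; have [n [z ->]] := pw_span ht x.
rewrite !(lin_sum _ _ fl) !(lin_sum _ _ gl); apply: eq_bigr => L _.
rewrite !(lin_sum _ _ fl) !(lin_sum _ _ gl); apply: eq_bigr => j _.
rewrite !(lin_sum _ _ fl) !(lin_sum _ _ gl); apply: eq_bigr => k _.
by rewrite (linZ _ _ fl) (linZ _ _ gl) fg.
Qed.

(** A diagonal map that fixes x fixes every basis vector that occurs in x. *)
Lemma pw_eigen (f : A -> A) (l : forall L, 'I_L.+1 -> 'I_L.+1 -> C) n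
    (z : forall L : nat, 'M[C]_L.+1) :
    linear f -> (forall L j k, f (t L j k) = l L j k *: t L j k) ->
    let x := \sum_(L < n) \sum_j \sum_k z L j k *: t L j k in
  f x = x -> forall L, (L < n)%N -> forall j k, z L j k = 0 \/ l L j k = 1.
Proof.
move=> fl ft x fx L Ln j k.
pose z' L' : 'M[C]_L'.+1 := \matrix_(j, k) ((l L' j k - 1) * z L' j k).
have h : \sum_(L < n) \sum_j \sum_k z' L j k *: t L j k = 0.
  rewrite -[RHS](subrr x) -{1}fx /x !(lin_sum _ _ fl) -sumrB.
  apply: eq_bigr => L' _; rewrite !(lin_sum _ _ fl) -sumrB.
  apply: eq_bigr => j' _; rewrite !(lin_sum _ _ fl) -sumrB.
  apply: eq_bigr => k' _; rewrite (linZ _ _ fl) ft mxE scalerA -scalerBl.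
  by rewrite mulrBl mul1r mulrC.
have /matrixP/(_ j k) := pw_free ht h Ln; rewrite !mxE => /eqP.
by rewrite mulf_eq0 subr_eq0 => /orP [] /eqP; [right|left].
Qed.

Lemma alpha_neq0 L (k : 'I_L.+1) : (k < L)%N -> (alpha q k)%:C != 0.
Proof.
move=> kL; rewrite fmorph_eq0 gt_eqF // sqrtr_gt0 mulr_gt0 //.
  by rewrite (_ : L%:Z - k%:Z = (L - k.+1).+1%:Z) ?qnum_gt0 //; lia.
by rewrite (_ : k%:Z + 1 = k.+1%:Z) ?qnum_gt0 //; lia.
Qed.

(** Invariance under K allows only vectors of weight 0, and among the basis vectors
    E annihilates only those of highest weight; both happen for spin 0 only. *)
Lemma invariant_span x : act K x = x -> act E x = 0 -> exists z, x = z *: t 0%N 0 0.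
Proof.
have [n [z ->]] := pw_span ht x => Kx Ex.
have hK := pw_eigen (act_linear msa K) act_tK Kx.
pose z' L : 'M[C]_L.+1 := \matrix_(j, k)
  \sum_(i : 'I_L.+1 | k == i.+1 :> nat) (z L j i * (alpha q i)%:C).
have hE : \sum_(L < n) \sum_j \sum_k z' L j k *: t L j k = 0.
  rewrite -[RHS]Ex (lin_sum _ _ (act_linear msa E)).
  apply: eq_bigr => L _; rewrite (lin_sum _ _ (act_linear msa E)).
  apply: eq_bigr => j _; rewrite (lin_sum _ _ (act_linear msa E)).
  under eq_bigr do rewrite mxE scaler_suml.
  under [RHS]eq_bigr do rewrite (linZ _ _ (act_linear msa E)) act_tE scaler_sumr.
  rewrite (exchange_big_dep xpredT) //=; apply: eq_bigr => i _.
  by apply: eq_bigr => k _; rewrite scalerA.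
have z0 L : (L < n)%N -> (0 < L)%N -> z L = 0.
  move=> Ln L0; apply/matrixP => j k; rewrite mxE.
  case: (ltnP k L) => kL.
    have kL' : (k.+1 < L.+1)%N by [].
    have /matrixP/(_ j (Ordinal kL')) := pw_free ht hE Ln; rewrite !mxE /=.
    rewrite (bigD1 k) //= big1 ?addr0 => [/eqP|i /andP [/eqP [ki] ik]].
      by rewrite mulf_eq0 (negPf (alpha_neq0 kL)) orbF => /eqP.
    by move: ik; rewrite -val_eqE /= ki eqxx.
  case: (hK L Ln j k) => // h.
  have : qh (dbl k) = qh 0 by rewrite h qh0.
  move/(qh_inj hq0 hq1); rewrite /dbl; have := ltn_ord k; lia.
clear z' Kx Ex hE hK; case: n z z0 => [|n] z z0.
  by exists 0; rewrite big_ord0 scale0r.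
exists (z 0%N 0 0); rewrite big_ord_recl /= [X in _ + X]big1 ?addr0.
  by rewrite !big_ord_recl !big_ord0 !addr0.
move=> i _; rewrite big1 // => j _; rewrite big1 // => k _.
by rewrite z0 ?mxE ?scale0r //= ltnS ltn_ord.
Qed.

(** The unit is invariant, and the counit determines its only coefficient. *)
Lemma t0_1 : t 0%N 0 0 = 1.
Proof.
have [z hz] : exists z, 1 = z *: t 0%N 0 0.
  apply: invariant_span; rewrite (msa_one msa) ?(uq_epsE hU) ?scale0r //.
  by rewrite (uq_epsK1 hU) scale1r.
have : heps (1 : A) = z * heps (t 0%N 0 0).
  by rewrite {1}hz hepsZ.
by rewrite (pw_corep ht 0%N).2 eqxx mulr1 heps1 => z1; rewrite hz -z1 scale1r.
Qed.

(** The trivial corepresentation occurs only once. *)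
Lemma invariant_scalar x : act K x = x -> act E x = 0 -> x = (heps x)%:A.
Proof.
move=> Kx Ex; have [z ->] := invariant_span Kx Ex.
by rewrite t0_1 hepsZ heps1 mulr1.
Qed.

Lemma invariant_scalmx m n (X : 'M[A]_(m, n)) :
  actx K X = X -> actx E X = 0 -> X = scal (epsx X).
Proof.
move=> /matrixP KX /matrixP EX; apply/matrixP => i j.
by have := KX i j; have := EX i j; rewrite !mxE => ex kx; exact: invariant_scalar.
Qed.

Lemma pd_linear f : linear (pd f).
Proof. by have [h _ _ _] := pd_rep hpd; exact: h. Qed.

Lemma pd_tK L (j k : 'I_L.+1) : pd K (t L j k) = qh (- dbl j) *: t L j k.
Proof.
rewrite {1}pw_tE (linZ _ _ (pd_linear _)) (pd_K hpd) pw_vE !scalerA.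
by congr (_ *: _); rewrite mulrAC mulVf ?mul1r // pw_cst_neq0.
Qed.

Lemma pd_KKi x : pd K (pd Ki x) = x.
Proof. by have [_ _ h1 hM] := pd_rep hpd; rewrite -hM (uq_KKi hU) h1. Qed.

Lemma pd_KiK x : pd Ki (pd K x) = x.
Proof. by have [_ _ h1 hM] := pd_rep hpd; rewrite -hM (uq_KiK hU) h1. Qed.

Lemma pd_tKi L (j k : 'I_L.+1) : pd Ki (t L j k) = qh (dbl j) *: t L j k.
Proof.
have : pd Ki (pd K (t L j k)) = t L j k by rewrite pd_KiK.
rewrite pd_tK (linZ _ _ (pd_linear _)) => h.
by rewrite -{2}h scalerA -qhD // subrr qh0 scale1r.
Qed.

Lemma act_tKi L (j k : 'I_L.+1) : act Ki (t L j k) = qh (- dbl k) *: t L j k.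
Proof.
have := actKiK hU msa (t L j k).
rewrite act_tK (linZ _ _ (act_linear msa _)) => h.
by rewrite -{2}h scalerA -qhD // addNr qh0 scale1r.
Qed.

Lemma eps_act_mul_linear g : (forall y, linear (fun x : A => heps (act g x) *: (y : A))) *
  (forall x, linear (fun y : A => heps (act g x) *: y)).
Proof.
split=> [y|x]; last exact: scale_linear.
by move=> z u v; rewrite (act_linear msa) hepsP scalerDl scalerA.
Qed.

(** Both sides agree on the Peter-Weyl basis.  Through this formula [pd] inherits
    its compatibility with products and involution from [act]. *)
Lemma pd_coaction (g h : U) :
    (forall L (j k : 'I_L.+1), act g (t L j k) = heps (act g (t L k k)) *: t L j k) ->
    (forall L (j k : 'I_L.+1), pd h (t L j k) = heps (act g (t L j j)) *: t L j k) ->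
  forall x, pd h x = \sum_(p <- hcop x) heps (act g p.1) *: p.2.
Proof.
move=> gt hht; have [l1 l2] := eps_act_mul_linear g; apply: pw_ext.
- exact: pd_linear.
- exact: (hcop_sum_linear l1 l2).
move=> L j k; rewrite (tensor_eq_sum ((pw_corep ht L).1 j k) l1 l2) big_map /=.
rewrite big_enum (bigD1 j) //= big1 ?addr0 // => i ij.
by rewrite gt hepsZ (pw_corep ht L).2 eq_sym (negPf ij) mulr0 scale0r.
Qed.

Lemma pd_KiE x : pd Ki x = \sum_(p <- hcop x) heps (act K p.1) *: p.2.
Proof.
have hE L (k : 'I_L.+1) : heps (act K (t L k k)) = qh (dbl k).
  by rewrite act_tK hepsZ (pw_corep ht L).2 eqxx mulr1.
by apply: pd_coaction => L j k; rewrite hE ?act_tK ?pd_tKi.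
Qed.

Lemma pd_KE x : pd K x = \sum_(p <- hcop x) heps (act Ki p.1) *: p.2.
Proof.
have hE L (k : 'I_L.+1) : heps (act Ki (t L k k)) = qh (- dbl k).
  by rewrite act_tKi hepsZ (pw_corep ht L).2 eqxx mulr1.
by apply: pd_coaction => L j k; rewrite hE ?act_tKi ?pd_tK.
Qed.

Lemma pd_mulKi x y : pd Ki (x * y) = pd Ki x * pd Ki y.
Proof.
have [l1 l2] := eps_act_mul_linear K.
rewrite !pd_KiE (hcop_sumM l1 l2) big_distrlr /=.
apply: eq_bigr => p _; apply: eq_bigr => r _.
by rewrite (act_mulK hU msa) hepsM -scalerAl -scalerAr scalerA.
Qed.

Lemma pd_starKi x : pd Ki (hstar x) = hstar (pd K x).
Proof.
have [l1 l2] := eps_act_mul_linear K.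
rewrite pd_KiE pd_KE hstar_sum (tensor_eq_sum (hcop_star x) l1 l2) big_map.
by apply: eq_bigr => p _; rewrite /= (act_starK hU msa) heps_star hstarZ.
Qed.

(** The weights of [pd K] are powers of sqrt q, a positive number different from 1,
    so that K and K ^+ 2 have the same fixed points. *)
Lemma podlesE x : (x \in B) = (pd Ki x == x).
Proof.
have [_ _ h1 hM] := pd_rep hpd.
apply/idP/eqP => [/eqP|h]; last first.
  by apply/eqP; rewrite expr2 hM -{1}h pd_KKi -{1}h pd_KKi.
have [n [z xE]] := pw_span ht x; rewrite {1 2}xE => hx.
have pd_tK2 L (j k : 'I_L.+1) : pd (K ^+ 2) (t L j k) = qh (- dbl j - dbl j) *: t L j k.
  by rewrite expr2 hM pd_tK (linZ _ _ (pd_linear _)) pd_tK scalerA qhD.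
have hz := pw_eigen (pd_linear (K ^+ 2)) pd_tK2 hx.
rewrite xE (lin_sum _ _ (pd_linear _)); apply: eq_bigr => L _.
rewrite (lin_sum _ _ (pd_linear _)); apply: eq_bigr => j _.
rewrite (lin_sum _ _ (pd_linear _)); apply: eq_bigr => k _.
rewrite (linZ _ _ (pd_linear _)) pd_tKi.
case: (hz L (ltn_ord L) j k) => [->|]; first by rewrite !scale0r.
rewrite -(qh0 q) => /(qh_inj hq0 hq1) h.
by rewrite (_ : dbl j = 0) ?qh0 ?scale1r //; lia.
Qed.

Lemma podles_act f x : x \in B -> act f x \in B.
Proof. by rewrite !podlesE => /eqP h; rewrite (pd_comm hpd) h. Qed.

(** By [pd_KiE] the left side is eps (pd Ki x), and pd Ki fixes x. *)
Lemma heps_podlesK x : x \in B -> heps (act K x) = heps x.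
Proof.
rewrite podlesE => /eqP h; rewrite -{2}h pd_KiE -{1}(hcop_epsr x).
rewrite (lin_sum _ _ (act_linear msa K)) !(lin_sum _ _ (@heps_linear _ A)).
apply: eq_bigr => p _; rewrite (linZ _ _ (act_linear msa K)).
by rewrite !hepsZ mulrC.
Qed.

Lemma heps_podlesKi x : x \in B -> heps (act Ki x) = heps x.
Proof.
move=> xB; rewrite -(heps_podlesK (podles_act Ki xB)).
by rewrite (actKKi hU msa).
Qed.

(** * Unitary matrices integrating *-representations *)

Local Notation pdx f := (map_mx (pd f)).

(** On the range of the projection p, u is a unitary matrix over O(SU_q(2)) whose
    columns transform under U_q(su_2) by the matrices k, e and f.  For p = 1 it
    is the matrix of coefficients of the corepresentation of SU_q(2) whose
    differential is given by k, e and f. *)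
Record integrates n (k e f p : 'M[C]_n) (u : 'M[A]_n) : Prop := {
  ig_p : u *m scal p = u;
  ig_st : stx u *m u = scal p;
  ig_ts : u *m stx u = scal p;
  ig_K : actx K u = u *m scal k;
  ig_E : actx E u = u *m scal e;
  ig_F : actx F u = u *m scal f;
  ig_pd : pdx Ki u = scal k *m u;
  ig_eps : epsx u = p }.

Lemma pdxD f m n (X Y : 'M[A]_(m, n)) : pdx f (X + Y) = pdx f X + pdx f Y.
Proof.
apply/matrixP=> i j; rewrite !mxE.
by have := pd_linear f 1 (X i j) (Y i j); rewrite !scale1r.
Qed.

Lemma pdx_sl f m n p (M : 'M[C]_(m, n)) (X : 'M[A]_(n, p)) :
  pdx f (scal M *m X) = scal M *m pdx f X.
Proof.
apply/matrixP=> i j; rewrite !mxE (lin_sum _ _ (pd_linear f)).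
by apply: eq_bigr => k _; rewrite !mxE -!scalerAl !mul1r (linZ _ _ (pd_linear f)).
Qed.

Lemma pdx_sr f m n p (M : 'M[C]_(n, p)) (X : 'M[A]_(m, n)) :
  pdx f (X *m scal M) = pdx f X *m scal M.
Proof.
apply/matrixP=> i j; rewrite !mxE (lin_sum _ _ (pd_linear f)).
by apply: eq_bigr => k _; rewrite !mxE !mulr_algr (linZ _ _ (pd_linear f)).
Qed.

Lemma pdx_mulKi m n p (X : 'M[A]_(m, n)) (Y : 'M[A]_(n, p)) :
  pdx Ki (X *m Y) = pdx Ki X *m pdx Ki Y.
Proof.
apply/matrixP=> i j; rewrite !mxE (lin_sum _ _ (pd_linear _)).
by apply: eq_bigr => k _; rewrite !mxE pd_mulKi.
Qed.

Lemma pdx_starKi m n (X : 'M[A]_(m, n)) : pdx Ki (stx X) = stx (pdx K X).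
Proof. by apply/matrixP=> i j; rewrite !mxE pd_starKi. Qed.

Lemma epsxD m n (X Y : 'M[A]_(m, n)) : epsx (X + Y) = epsx X + epsx Y.
Proof.
apply/matrixP=> i j; rewrite !mxE.
by have := hepsP 1 (X i j) (Y i j); rewrite scale1r mul1r.
Qed.

Lemma pdx_t L : pdx Ki (t L) = scal (spinK q L) *m t L.
Proof.
apply/matrixP=> i j; rewrite !mxE pd_tKi.
rewrite (bigD1 i) //= big1 ?addr0.
  by rewrite !mxE eqxx mulr1n /= -scalerAl mul1r.
by move=> k ki; rewrite !mxE eq_sym (negPf ki) mulr0n /= scale0r mul0r.
Qed.

Lemma spin_integrates L :
  integrates (spinK q L) (spinE q L) (spinF q L) 1%:M (t L).
Proof.
have [h1 h2] := pw_unitary ht L.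
split; rewrite ?scalmx1 ?mulmx1 //.
- exact: actx_tK.
- exact: actx_tE.
- exact: actx_tF.
- exact: pdx_t.
- exact: epsx_t.
Qed.

Lemma ctr_spinK L : ctr (spinK q L) = spinK q L.
Proof.
apply/matrixP=> i j; rewrite !mxE eq_sym; case: eqP => [->|_].
  by rewrite mulr1n qh_conj.
by rewrite mulr0n conjC0.
Qed.

Lemma ctr_spinE L : ctr (spinE q L) = spinF q L.
Proof.
apply/matrixP=> i j; rewrite !mxE eq_sym.
by case: eqP => _; rewrite ?conjC0 ?conj_real_complex.
Qed.

Lemma ctr_spinF L : ctr (spinF q L) = spinE q L.
Proof. by rewrite -ctr_spinE ctrK. Qed.

(** By induction on the rank of p: split off a spin representation, embedded by T,
    and add the block [ctr T *m t L *m T] to the matrix obtained for the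
    complement. *)
Lemma integrate_proj n (k ki e f : 'M[C]_n) (H : uq_mx q k ki e f) (p : 'M[C]_n) :
    p *m p = p -> ctr p = p ->
    p *m k = k *m p -> p *m e = e *m p -> p *m f = f *m p ->
  exists u, integrates k e f p u.
Proof.
have [m] := ubnP (\rank p); elim: m p => // m IH p rp pp pa pk pe pf.
have [p0|p0] := eqVneq p 0.
  exists 0; rewrite p0; split; rewrite ?scalmx0 ?mulmx0 ?mul0mx ?(actx0 msa) //.
  - by apply/matrixP=> i j; rewrite !mxE (lin0 (pd_linear _)).
  - by apply/matrixP=> i j; rewrite !mxE (lin0 (@heps_linear _ A)).
have [L [T [Tp TT Tk Te Tf]]] := spin_in_proj hq0 hq1 H p0 pp pk pe pf.
have fa : ctr f = e by rewrite -(um_e H) ctrK.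
have kT : k *m ctr T = ctr T *m spinK q L.
  by rewrite -{1}(um_k H) -ctrM Tk ctrM ctr_spinK.
have eT : e *m ctr T = ctr T *m spinE q L.
  by rewrite -fa -ctrM Tf ctrM ctr_spinF.
have fT : f *m ctr T = ctr T *m spinF q L.
  by rewrite -(um_e H) -ctrM Te ctrM ctr_spinE.
have pT : p *m ctr T = ctr T by rewrite -{1}pa -ctrM Tp.
pose p' := p - ctr T *m T.
have Tp' : T *m p' = 0 by rewrite mulmxBr mulmxA TT mul1mx Tp subrr.
have p'p : p *m p' = p' by rewrite mulmxBr pp mulmxA pT.
have pp' : p' *m p = p' by rewrite mulmxBl pp -mulmxA Tp.
have p'p' : p' *m p' = p' by rewrite {1}/p' mulmxBl p'p -mulmxA Tp' mulmx0 subr0.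
have p'a : ctr p' = p' by rewrite /p' ctrD ctrN ctrM ctrK pa.
have rp' : (\rank p' < m)%N.
  rewrite ltnS in rp; apply: leq_trans rp.
  have sub : (p' <= p)%MS by rewrite -pp' submxMl.
  rewrite (ltn_leqif (mxrank_leqif_sup sub)); apply/negP => /submxP [D pD].
  have T0 : T = 0 by rewrite -Tp -pa pD ctrM p'a mulmxA Tp' mul0mx.
  by move/eqP: TT; rewrite T0 mul0mx eq_sym oner_eq0.
have comm (x y : 'M[C]_n) (s : 'M[C]_L.+1) : p *m x = x *m p -> T *m x = s *m T ->
    x *m ctr T = ctr T *m s -> p' *m x = x *m p'.
  by move=> px Tx xT; rewrite /p' mulmxBl mulmxBr px -mulmxA Tx mulmxA -xT -mulmxA.
have [u' I] := IH p' rp' p'p' p'a (comm _ k _ pk Tk kT) (comm _ e _ pe Te eT)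
  (comm _ f _ pf Tf fT).
have J := spin_integrates L.
have pu' : scal p' *m u' = u'.
  by rewrite -(ig_ts I) -mulmxA (ig_st I) (ig_p I).
have Tu' : scal T *m u' = 0 by rewrite -pu' mulmxA -scalmxM Tp' scalmx0 mul0mx.
have u'T : u' *m scal (ctr T) = 0.
  by rewrite -(ig_p I) -mulmxA -scalmxM -p'a -ctrM Tp' ctr0 scalmx0 mulmx0.
have sT : stx u' *m scal (ctr T) = 0.
  rewrite -(stmx_scal A T) -stmxM Tu'.
  by apply/matrixP=> i j; rewrite !mxE hstar0.
have Ts : scal T *m stx u' = 0.
  rewrite -[T]ctrK -(stmx_scal A (ctr T)) -stmxM u'T.
  by apply/matrixP=> i j; rewrite !mxE hstar0.
have TT' : scal T *m scal (ctr T) = 1%:M by rewrite -scalmxM TT scalmx1.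
pose w := scal (ctr T) *m t L *m scal T.
have sw : stx w = scal (ctr T) *m stx (t L) *m scal T.
  by rewrite /w !stmxM !stmx_scal ctrK mulmxA.
have ep : scal p = scal p' + scal (ctr T *m T) by rewrite -scalmxD subrK.
have [st ts] := pw_unitary ht L.
have sww : stx w *m w = scal (ctr T *m T).
  rewrite sw /w !mulmxA -[_ *m scal T *m scal (ctr T)]mulmxA TT' mulmx1.
  by rewrite -[_ *m stx (t L) *m t L]mulmxA st mulmx1 scalmxM.
have wsw : w *m stx w = scal (ctr T *m T).
  rewrite sw /w !mulmxA -[_ *m scal T *m scal (ctr T)]mulmxA TT' mulmx1.
  by rewrite -[_ *m t L *m stx (t L)]mulmxA ts mulmx1 scalmxM.
have su'w : stx u' *m w = 0 by rewrite /w !mulmxA sT !mul0mx.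
have swu' : stx w *m u' = 0 by rewrite sw -!mulmxA Tu' !mulmx0.
have u'sw : u' *m stx w = 0 by rewrite sw !mulmxA u'T !mul0mx.
have wsu' : w *m stx u' = 0 by rewrite /w -!mulmxA Ts !mulmx0.
have actw g (s : 'M[C]_L.+1) (x : 'M[C]_n) : actx g (t L) = t L *m scal s ->
    T *m x = s *m T -> actx g u' = u' *m scal x ->
    actx g (u' + w) = (u' + w) *m scal x.
  move=> gs Tx gu'; rewrite (actxD msa) gu' mulmxDl; congr (_ + _).
  by rewrite /w (actx_sr msa) (actx_sl msa) gs -!mulmxA -!scalmxM Tx.
exists (u' + w); split.
- rewrite mulmxDl -{1}(ig_p I) -mulmxA -scalmxM pp' (ig_p I).
  by rewrite /w -!mulmxA -scalmxM Tp.
- by rewrite stmxD mulmxDl !mulmxDr (ig_st I) su'w swu' sww addr0 add0r -ep.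
- by rewrite stmxD mulmxDl !mulmxDr (ig_ts I) u'sw wsu' wsw addr0 add0r -ep.
- exact: actw (ig_K J) Tk (ig_K I).
- exact: actw (ig_E J) Te (ig_E I).
- exact: actw (ig_F J) Tf (ig_F I).
- rewrite pdxD (ig_pd I) mulmxDr; congr (_ + _).
  by rewrite /w pdx_sr pdx_sl (ig_pd J) !mulmxA -!scalmxM kT.
- rewrite epsxD (ig_eps I) /w !epsxM !epsx_scal (ig_eps J) mulmx1.
  by rewrite subrK.
Qed.

(** * Equivariant matrices *)

(** In Sweedler notation the three conditions say
    h X = sigma2 (S h_(1)) X sigma1 (h_(2)) for h = K, E, F, where sigma1 and
    sigma2 are the representations with matrices k1, e1, f1 and k2, e2, f2.
    This is how X = u2^* y u1 transforms, for a scalar matrix y. *)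
Record equivariant m n (k2 ki2 e2 f2 : 'M[C]_m) (k1 e1 f1 : 'M[C]_n)
    (X : 'M[A]_(m, n)) : Prop := {
  eqv_K : actx K X = scal ki2 *m X *m scal k1;
  eqv_E : actx E X = scal k2 *m X *m scal e1 - scal (Q *: e2) *m X *m scal k1;
  eqv_F : actx F X = scal k2 *m X *m scal f1 - scal (Q^-1 *: f2) *m X *m scal k1 }.

Section Equivariance.
Variables (m n : nat).
Variables (k2 ki2 e2 f2 : 'M[C]_m) (k1 ki1 e1 f1 : 'M[C]_n).
Hypothesis H2 : uq_mx q k2 ki2 e2 f2.
Hypothesis H1 : uq_mx q k1 ki1 e1 f1.
Variables (u2 : 'M[A]_m) (u1 : 'M[A]_n).
Hypothesis I2 : integrates k2 e2 f2 1%:M u2.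
Hypothesis I1 : integrates k1 e1 f1 1%:M u1.

Lemma integrates_Ki p k ki e f (H : uq_mx q k ki e f) (u : 'M[A]_p) :
  integrates k e f 1%:M u -> actx Ki u = u *m scal ki.
Proof.
move=> I; have : actx Ki (actx K u) = u.
  by rewrite -(actxM msa) (uq_KiK hU) (actx1 msa).
rewrite (ig_K I) (actx_sr msa) => {2}<-.
by rewrite -mulmxA -scalmxM (um_kki H) scalmx1 mulmx1.
Qed.

Lemma ctr_ki p k ki e f (H : @uq_mx _ q p k ki e f) : ctr ki = ki.
Proof.
rewrite -[LHS]mulmx1 -(um_kki H) mulmxA -{1}(um_k H) -ctrM (um_kki H) ctr1.
by rewrite mul1mx.
Qed.

Lemma ctr_f p k ki e f (H : @uq_mx _ q p k ki e f) : ctr f = e.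
Proof. by rewrite -(um_e H) ctrK. Qed.

Lemma e_ki p k ki e f (H : @uq_mx _ q p k ki e f) : e *m ki = Q *: (ki *m e).
Proof.
have -> : e *m ki = ki *m (k *m e) *m ki by rewrite mulmxA (um_kik H) mul1mx.
by rewrite (um_ke H) -scalemxAr -scalemxAl -!mulmxA (um_kki H) mulmx1.
Qed.

Lemma equivariant_Ki X : equivariant k2 ki2 e2 f2 k1 e1 f1 X ->
  actx Ki X = scal k2 *m X *m scal ki1.
Proof.
move=> eX; have : actx Ki (actx K X) = X.
  by rewrite -(actxM msa) (uq_KiK hU) (actx1 msa).
rewrite (eqv_K eX) (actx_sr msa) (actx_sl msa) => {2}<-.
rewrite !mulmxA -scalmxM (um_kki H2) scalmx1 mul1mx -mulmxA -scalmxM.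
by rewrite (um_kki H1) scalmx1 mulmx1.
Qed.

Lemma act_st_K p k ki e f (H : uq_mx q k ki e f) (u : 'M[A]_p) :
  integrates k e f 1%:M u -> actx K (stx u) = scal ki *m stx u.
Proof.
move=> I; rewrite (actx_starK hU msa) (integrates_Ki H I) stmxM stmx_scal.
by rewrite (ctr_ki H).
Qed.

Lemma act_st_Ki p k ki e f (H : uq_mx q k ki e f) (u : 'M[A]_p) :
  integrates k e f 1%:M u -> actx Ki (stx u) = scal k *m stx u.
Proof.
by move=> I; rewrite (actx_starKi hU msa) (ig_K I) stmxM stmx_scal (um_k H).
Qed.

Lemma act_st_E p k ki e f (H : uq_mx q k ki e f) (u : 'M[A]_p) :
  integrates k e f 1%:M u -> actx E (stx u) = - (scal (Q *: e) *m stx u).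
Proof.
move=> I; rewrite (actx_starE hq0 hU msa) (ig_F I) stmxM stmx_scal (ctr_f H).
by rewrite -scalmxMC scaleNr scalmxN mulNmx.
Qed.

Lemma act_st_F p k ki e f (H : uq_mx q k ki e f) (u : 'M[A]_p) :
  integrates k e f 1%:M u -> actx F (stx u) = - (scal (Q^-1 *: f) *m stx u).
Proof.
move=> I; rewrite (actx_starF hq0 hU msa) (ig_E I) stmxM stmx_scal (um_e H).
by rewrite -scalmxMC scaleNr scalmxN mulNmx.
Qed.

Lemma intertwiner_equivariant (y : 'M[C]_(m, n)) :
  equivariant k2 ki2 e2 f2 k1 e1 f1 (stx u2 *m scal y *m u1).
Proof.
split.
- rewrite (actx_mulK hU msa) (actx_sr msa) (act_st_K H2 I2) (ig_K I1).
  by rewrite !mulmxA.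
- rewrite (actx_mulE hU msa) !(actx_sr msa) (act_st_E H2 I2) (act_st_Ki H2 I2).
  by rewrite (ig_K I1) (ig_E I1) addrC !mulmxA !mulNmx.
- rewrite (actx_mulF hU msa) !(actx_sr msa) (act_st_F H2 I2) (act_st_Ki H2 I2).
  by rewrite (ig_K I1) (ig_F I1) addrC !mulmxA !mulNmx.
Qed.

(** The matrix [u2 *m X *m stx u1] is invariant, hence scalar. *)
Lemma equivariant_intertwiner X : equivariant k2 ki2 e2 f2 k1 e1 f1 X ->
  X = stx u2 *m scal (epsx X) *m u1.
Proof.
move=> eX; pose Y := u2 *m X *m stx u1.
have s1 : stx u1 *m u1 = 1%:M by rewrite (ig_st I1) scalmx1.
have s2 : stx u2 *m u2 = 1%:M by rewrite (ig_st I2) scalmx1.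
have -> : epsx X = epsx Y.
  by rewrite !epsxM epsx_star (ig_eps I1) (ig_eps I2) mul1mx ctr1 mulmx1.
suff <- : Y = scal (epsx Y).
  by rewrite /Y !mulmxA s2 mul1mx -mulmxA s1 mulmx1.
apply: invariant_scalmx.
- rewrite /Y !(actx_mulK hU msa) (act_st_K H1 I1) (ig_K I2) (eqv_K eX).
  rewrite !mulmxA -[_ *m scal k2 *m scal ki2]mulmxA -scalmxM (um_kki H2) scalmx1.
  by rewrite mulmx1 -[_ *m scal k1 *m scal ki1]mulmxA -scalmxM (um_kki H1) scalmx1 mulmx1.
- rewrite /Y !(actx_mulE hU msa) !(actx_mulKi hU msa) (act_st_K H1 I1).
  rewrite (act_st_E H1 I1) (ig_E I2) (eqv_K eX) (integrates_Ki H2 I2).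
  rewrite (equivariant_Ki eX) (eqv_E eX).
  rewrite mulmxDl.
  have -> : u2 *m scal e2 *m (scal ki2 *m X *m scal k1) *m (scal ki1 *m stx u1) =
      u2 *m scal (e2 *m ki2) *m X *m stx u1.
    rewrite !mulmxA -[_ *m scal k1 *m scal ki1]mulmxA -scalmxM (um_kki H1) scalmx1 mulmx1.
    by rewrite -[_ *m scal e2 *m scal ki2]mulmxA -scalmxM.
  have -> : u2 *m scal ki2 *m (scal k2 *m X *m scal e1 - scal (Q *: e2) *m X *m scal k1)
      *m (scal ki1 *m stx u1) =
      u2 *m X *m scal (e1 *m ki1) *m stx u1 - u2 *m scal (e2 *m ki2) *m X *m stx u1.
    rewrite mulmxBr mulmxBl; congr (_ - _).
      rewrite !mulmxA -[u2 *m _ *m scal k2]mulmxA -scalmxM (um_kik H2) scalmx1 mulmx1.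
      by rewrite -[_ *m scal e1 *m scal ki1]mulmxA -scalmxM.
    rewrite !mulmxA -[_ *m scal k1 *m scal ki1]mulmxA -scalmxM (um_kki H1) scalmx1 mulmx1.
    by rewrite -[u2 *m scal ki2 *m scal (Q *: e2)]mulmxA -scalmxM -scalemxAr -(e_ki H2).
  have -> : u2 *m scal ki2 *m (scal k2 *m X *m scal ki1) *m (- (scal (Q *: e1) *m stx u1))
     = - (u2 *m X *m scal (e1 *m ki1) *m stx u1).
    rewrite mulmxN !mulmxA -[u2 *m _ *m scal k2]mulmxA -scalmxM (um_kik H2) scalmx1 mulmx1.
    by rewrite -[_ *m scal ki1 *m scal (Q *: e1)]mulmxA -scalmxM -scalemxAr -(e_ki H1).
  by rewrite addrCA subrr addr0 subrr.
Qed.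

End Equivariance.

(** * The adjoint action and the action on columns *)

(** The computations for E and F are the same, with q replaced by 1/q. *)
Definition generator (r : C) (g : U) := r = Q /\ g = E \/ r = Q^-1 /\ g = F.

Lemma gen_neq0 r g : generator r g -> r != 0.
Proof. by have Q0 := qc_neq0 hq0; case=> -[-> _]; rewrite ?invr_eq0. Qed.

Lemma gen_Sinv r g : generator r g -> hSinv g = - r^-1 *: g.
Proof.
by case=> -[-> ->]; rewrite ?(uq_SiE hq0 hU) ?(uq_SiF hq0 hU) ?invrK.
Qed.

Lemma gen_K r g : generator r g -> K * g = r *: (g * K).
Proof.
have rel := uq_rel hU; case=> -[-> ->]; first exact: (uqr_KE rel).
by rewrite (uqr_FK rel) scalerA mulVf ?scale1r // qc_neq0.
Qed.

Lemma gen_actx_mul r g m n p (X : 'M[A]_(m, n)) (Y : 'M[A]_(n, p)) :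
  generator r g -> actx g (X *m Y) = actx g X *m actx K Y + actx Ki X *m actx g Y.
Proof. by case=> -[_ ->]; [exact: (actx_mulE hU msa) | exact: (actx_mulF hU msa)]. Qed.

Lemma gen_actx_K r g m n (X : 'M[A]_(m, n)) : generator r g ->
  actx K (actx g X) = r%:A *: actx g (actx K X).
Proof. by move=> hg; rewrite -!(actxM msa) (gen_K hg) (actxZ msa). Qed.

Lemma hcop3_sum (V : zmodType) (T : U -> U -> U -> V) f :
  \sum_(p <- hcop3 f) T p.1.1 p.1.2 p.2 =
  \sum_(p <- hcop f) \sum_(r <- hcop p.1) T r.1 r.2 p.2.
Proof. by rewrite /hcop3 big_allpairs_dep. Qed.

Section ThreefoldCoproduct.
Variables (V : lmodType C) (T : U -> U -> U -> V).
Hypothesis T1 : forall y z, linear (fun x => T x y z).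
Hypothesis T2 : forall x z, linear (fun y => T x y z).
Hypothesis T3 : forall x y, linear (fun z => T x y z).

Let G x z := \sum_(r <- hcop x) T r.1 r.2 z.

Let G1 z : linear (fun x => G x z).
Proof. exact: (hcop_sum_linear (fun y => T1 y z) (fun x => T2 x z)). Qed.

Let G2 x : linear (G x).
Proof. by apply: lin_sumf => r; exact: T3. Qed.

Local Notation D3 f := (\sum_(p <- hcop3 f) T p.1.1 p.1.2 p.2).

Lemma hcop3_linear : linear (fun f => D3 f).
Proof. by move=> z f g; rewrite !hcop3_sum; exact: (hcop_sum_linear G1 G2). Qed.

Lemma hcop3_sum1 : D3 1 = T 1 1 1.
Proof.
by rewrite hcop3_sum (hcop_sum1 G1 G2) /G (hcop_sum1 (T1^~ 1) (T2^~ 1)).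
Qed.

Lemma hcop3_sumM f g : D3 (f * g) = \sum_(p <- hcop3 f) \sum_(r <- hcop3 g)
  T (p.1.1 * r.1.1) (p.1.2 * r.1.2) (p.2 * r.2).
Proof.
rewrite hcop3_sum (hcop_sumM G1 G2).
rewrite (@hcop3_sum _ (fun x y z => \sum_(r <- hcop3 g)
  T (x * r.1.1) (y * r.1.2) (z * r.2))).
apply: eq_bigr => p _.
under [RHS]eq_bigr => p' _ do rewrite
  (@hcop3_sum _ (fun x y z => T (p'.1 * x) (p'.2 * y) (p.2 * z))).
rewrite [RHS]exchange_big /=; apply: eq_bigr => r _.
exact: (hcop_sumM (T1^~ _) (T2^~ _)).
Qed.

Lemma hcop3_sumK : D3 K = T K K K.
Proof.
by rewrite hcop3_sum (hcop_sumK hU G1 G2) /G (hcop_sumK hU (T1^~ _) (T2^~ _)).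
Qed.

Lemma hcop3_sumE : D3 E = T E K K + T Ki E K + T Ki Ki E.
Proof.
rewrite hcop3_sum (hcop_sumE hU G1 G2) /G (hcop_sumE hU (T1^~ _) (T2^~ _)).
by rewrite (hcop_sumKi hU (T1^~ _) (T2^~ _)).
Qed.

Lemma hcop3_sumF : D3 F = T F K K + T Ki F K + T Ki Ki F.
Proof.
rewrite hcop3_sum (hcop_sumF hU G1 G2) /G (hcop_sumF hU (T1^~ _) (T2^~ _)).
by rewrite (hcop_sumKi hU (T1^~ _) (T2^~ _)).
Qed.

End ThreefoldCoproduct.

Section OppositeRepresentation.
Variables (n : nat) (rho : U -> 'M[C]_n).
Hypothesis hrho : is_opp_star_rep rho.

Lemma rho_linear : linear rho.
Proof. by have [h _ _ _] := hrho; exact: h. Qed.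

Lemma rho1 : rho 1 = 1%:M. Proof. by have [] := hrho. Qed.

Lemma rhoM f g : rho (f * g) = rho g *m rho f.
Proof. by have [_ _ h _] := hrho; exact: h. Qed.

Lemma rho_star f : rho (hstar f) = ctr (rho f).
Proof. by have [_ _ _ h] := hrho; exact: h. Qed.

Lemma rhoZ z f : rho (z *: f) = z *: rho f.
Proof. exact: linZ rho_linear. Qed.

Lemma rho_KKi : rho K *m rho Ki = 1%:M. Proof. by rewrite -rhoM (uq_KiK hU) rho1. Qed.
Lemma rho_KiK : rho Ki *m rho K = 1%:M. Proof. by rewrite -rhoM (uq_KKi hU) rho1. Qed.

Lemma rhoB f g : rho (f - g) = rho f - rho g.
Proof.
have -> : f - g = (-1) *: g + f by rewrite scaleN1r addrC.
by rewrite rho_linear scaleN1r addrC.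
Qed.

Lemma opp_rep_uq_mx : pos_rep K rho -> uq_mx q (rho Ki) (rho K) (- rho E) (- rho F).
Proof.
move=> pos; have rel := uq_rel hU; split.
- exact: rho_KiK.
- exact: rho_KKi.
- rewrite mulmxN mulNmx scalerN -!rhoM -rhoZ; congr (- rho _).
  have -> : E * Ki = Ki * (K * E) * Ki by rewrite !mulrA (uq_KiK hU) mul1r.
  by rewrite (uqr_KE rel) -scalerAr -scalerAl -!mulrA (uq_KKi hU) mulr1.
- rewrite mulmxN mulNmx scalerN -!rhoM -rhoZ; congr (- rho _).
  have -> : Ki * F = Ki * (F * K) * Ki by rewrite -!mulrA (uq_KKi hU) mulr1.
  by rewrite (uqr_FK rel) -scalerAr -scalerAl !mulrA (uq_KiK hU) mul1r.
- rewrite !mulNmx !mulmxN !opprK -!rhoM -!rhoB -rhoZ; congr (rho _).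
  by rewrite -[LHS]opprB (uqr_EF rel) -scalerN opprB.
- by rewrite -rho_star (uq_starKi hU).
- by rewrite ctrN -rho_star (uq_starE hU).
- move=> v z v0 vk.
  have vE : v = z *: (v *m rho K) by rewrite scalemxAl -vk -mulmxA rho_KiK mulmx1.
  have z0 : z != 0 by apply: contra v0 => /eqP z0; rewrite vE z0 scale0r.
  rewrite -invr_gt0; apply: pos; apply/eigenvalueP; exists v => //.
  by rewrite {2}vE scalerA mulVf // scale1r.
Qed.

Let aT (X : 'M[A]_n) x y z : cmx A n n :=
  scal (rho (hSinv x)) *m actx (hSinv (hSinv y)) X *m scal (rho z).

Let aT1 X y z : linear (fun x => aT X x y z).
Proof.
apply: (lin_comp (@cmx_mulr_linear _ A _ _ _ _)).
apply: (lin_comp (@cmx_mulr_linear _ A _ _ _ _)).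
exact: (cmx_scal_linear A (lin_comp rho_linear (@hSinv_linear _ U))).
Qed.

Let aT2 X x z : linear (fun y => aT X x y z).
Proof.
apply: (lin_comp (@cmx_mulr_linear _ A _ _ _ _)).
apply: (lin_comp (@cmx_mull_linear _ A _ _ _ _)).
apply: (lin_comp (actx_linearl msa X)).
exact: (lin_comp (@hSinv_linear _ U) (@hSinv_linear _ U)).
Qed.

Let aT3 X x y : linear (fun z => aT X x y z).
Proof.
apply: (lin_comp (@cmx_mull_linear _ A _ _ _ _)).
exact: (cmx_scal_linear A rho_linear).
Qed.

Lemma adRE f X : adR act rho f X =
  (\sum_(p <- hcop3 f) aT X p.1.1 p.1.2 p.2 : cmx A n n).
Proof. by []. Qed.

Lemma adR_linear X : linear (fun f => adR act rho f X : cmx A n n).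
Proof. exact: (hcop3_linear (aT1 X) (aT2 X) (aT3 X)). Qed.

Lemma adR_linearr f : linear (fun X : cmx A n n => adR act rho f X : cmx A n n).
Proof.
apply: lin_sumf => p.
apply: (lin_comp (@cmx_mulr_linear _ A _ _ _ _)).
apply: (lin_comp (@cmx_mull_linear _ A _ _ _ _)).
exact: (actx_linear msa).
Qed.

Lemma adR1 X : adR act rho 1 X = X.
Proof.
rewrite adRE (hcop3_sum1 (aT1 X) (aT2 X) (aT3 X)) /aT !hSinv1 rho1 scalmx1.
by rewrite mul1mx mulmx1 (actx1 msa).
Qed.

Lemma adRM f g X : adR act rho (f * g) X = adR act rho f (adR act rho g X).
Proof.
rewrite adRE (hcop3_sumM (aT1 X) (aT2 X) (aT3 X)) [RHS]adRE.
apply: eq_bigr => p _; rewrite {2}/aT adRE.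
rewrite (lin_sum (W := cmx A n n) _ _ (actx_linear msa (hSinv (hSinv p.1.2)) (m := n) (n := n))) mulmx_sumr mulmx_suml.
apply: eq_bigr => r _; rewrite /aT (actx_sr msa) (actx_sl msa).
by rewrite !hSinvM !rhoM !scalmxM (actxM msa) !mulmxA.
Qed.

Lemma adR_K X : adR act rho K X = scal (rho Ki) *m actx K X *m scal (rho K).
Proof.
rewrite adRE (hcop3_sumK (aT1 X) (aT2 X) (aT3 X)) /aT.
by rewrite (uq_SiK hU) (uq_SiKi hU).
Qed.

Lemma adR_gen r g P : generator r g ->
  adR act rho g P = - (scal (r^-1 *: rho g) *m actx K P *m scal (rho K))
    + scal (r^-2 *: rho K) *m actx g P *m scal (rho K)
    + scal (rho K) *m actx Ki P *m scal (rho g).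
Proof.
move=> hg; have h1 := aT1 P; have h2 := aT2 P; have h3 := aT3 P.
have hcop3g : adR act rho g P = aT P g K K + aT P Ki g K + aT P Ki Ki g.
  by case: hg => -[_ ->]; rewrite adRE ?(hcop3_sumE h1 h2 h3) ?(hcop3_sumF h1 h2 h3).
rewrite hcop3g /aT !((uq_SiK hU), (uq_SiKi hU)).
rewrite !(gen_Sinv hg) (linZ _ _ (@hSinv_linear _ U)) (gen_Sinv hg) scalerA mulrNN.
congr (_ + _ + _).
- have -> : rho (- r^-1 *: g) = - (r^-1 *: rho g) by rewrite rhoZ scaleNr.
  by rewrite scalmxN !mulNmx.
- by rewrite (actxZ msa) mulmxCA -scalmxMC -expr2 exprVn.
Qed.

Lemma rho_gen_K r g : generator r g -> rho g *m rho K = r *: (rho K *m rho g).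
Proof. by move=> hg; rewrite -!rhoM (gen_K hg) rhoZ. Qed.

Lemma scal_KKi m (X : 'M[A]_(n, m)) : scal (rho K) *m (scal (rho Ki) *m X) = X.
Proof. by rewrite mulmxA -scalmxM rho_KKi scalmx1 mul1mx. Qed.

Lemma scal_KiK m (X : 'M[A]_(n, m)) : scal (rho Ki) *m (scal (rho K) *m X) = X.
Proof. by rewrite mulmxA -scalmxM rho_KiK scalmx1 mul1mx. Qed.

Lemma scal_KKir m (X : 'M[A]_(m, n)) : X *m scal (rho K) *m scal (rho Ki) = X.
Proof. by rewrite -mulmxA -scalmxM rho_KKi scalmx1 mulmx1. Qed.

Lemma scal_KiKr m (X : 'M[A]_(m, n)) : X *m scal (rho Ki) *m scal (rho K) = X.
Proof. by rewrite -mulmxA -scalmxM rho_KiK scalmx1 mulmx1. Qed.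

Section InvariantMatrix.
Variables P X : 'M[A]_n.
Hypothesis XE : actx K P = X.

Lemma actK_PE : adR act rho K P = P -> actx K P = scal (rho K) *m P *m scal (rho Ki).
Proof. by move=> {2}<-; rewrite adR_K -!mulmxA scal_KKi mulmxA scal_KKir. Qed.

Lemma adR_K_equiv : adR act rho K P = P ->
  actx K X = scal (rho K) *m X *m scal (rho Ki).
Proof. by move=> KP; rewrite -{1}XE {1}(actK_PE KP) (actx_sr msa) (actx_sl msa) XE. Qed.

Lemma actKi_equiv : adR act rho K P = P -> P = scal (rho Ki) *m X *m scal (rho K).
Proof. by move=> {1}<-; rewrite adR_K XE. Qed.

(** Up to invertible factors, [adR] at a generator g measures the failure of
    X = K acting on P to be equivariant for g. *)
Lemma actK_adR_gen r g : generator r g -> adR act rho K P = P ->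
  actx K (adR act rho g P) = scal (r^-1 *: rho K) *m
    (actx g X - (scal (r *: rho g) *m X *m scal (rho Ki)
                 - scal (rho Ki) *m X *m scal (rho g))) *m scal (rho K).
Proof.
move=> hg KP; have r0 := gen_neq0 hg.
have KiP : actx K (actx Ki P) = P by rewrite -(actxM msa) (uq_KKi hU) (actx1 msa).
have id := adR_gen_identity (actx g X) (mulVf r0) rho_KKi rho_KiK (rho_gen_K hg)
  (actKi_equiv KP).
rewrite -{}id (adR_gen _ hg) -exprVn !(actxD msa) XE; congr (_ + _ + _).
- rewrite -!mulNmx -scalmxN (actx_sr msa) (actx_sl msa) (adR_K_equiv KP).
  by [].
- by rewrite (actx_sr msa) (actx_sl msa) (gen_actx_K _ hg) XE.
- by rewrite (actx_sr msa) (actx_sl msa) KiP.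
Qed.

Lemma actx_eq0 m (Y : 'M[A]_(n, m)) : actx K Y = 0 -> Y = 0.
Proof.
by move=> Y0; rewrite -[Y](actx1 msa) -(uq_KiK hU) (actxM msa) Y0 (actx0 msa).
Qed.

Lemma adR_gen0 r g : generator r g -> adR act rho K P = P ->
  adR act rho g P = 0 <->
  actx g X = scal (r *: rho g) *m X *m scal (rho Ki) - scal (rho Ki) *m X *m scal (rho g).
Proof.
move=> hg KP; have := actK_adR_gen hg KP.
set D := (X in _ - X); move=> id; split => [g0|gD].
  move: id; rewrite g0 (actx0 msa) => /esym id; apply/eqP; rewrite -subr_eq0; apply/eqP.
  have id' := congr1 (mulmx^~ (scal (rho Ki))) id.
  rewrite /= mul0mx scal_KKir in id'.
  have r0 : r^-1 != 0 by rewrite invr_eq0 (gen_neq0 hg).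
  by rewrite -[LHS]scal_KiK (scalmxZ_eq0 r0 id') mulmx0.
by apply: actx_eq0; rewrite id gD subrr mulmx0 mul0mx.
Qed.

End InvariantMatrix.

(** The map f |-> [adR act rho f] is multiplicative, so generators suffice. *)
Lemma adR_invariant P : adR act rho K P = P -> adR act rho E P = 0 ->
  adR act rho F P = 0 -> forall f, adR act rho f P = (heps f)%:A *: P.
Proof.
move=> PK PE PF; apply: (uq_ind hU) => [|z f g hf hg|f g hf hg||||].
- by rewrite adR1 heps1 !scale1r.
- rewrite adR_linear hf hg hepsP scalerDl scalerDl; congr (_ + _).
  by rewrite cmx_scaleE scalerA mulr_algl scalerA.
- rewrite adRM hg (linZ (heps g) (P : cmx A n n) (adR_linearr f)) hf hepsM.
  by rewrite cmx_scaleE scalerA mulr_algl scalerA mulrC.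
- by rewrite PE (uq_epsE hU) !scale0r.
- by rewrite PF (uq_epsF hU) !scale0r.
- by rewrite PK (uq_epsK1 hU) !scale1r.
- by rewrite (uq_epsKi hU) !scale1r -{1}PK -adRM (uq_KiK hU) adR1.
Qed.

Let pT m (x : 'M[A]_(n, m)) y z : cmx A n m := scal (rho z) *m actx (hSinv y) x.

Let pT1 m (x : 'M[A]_(n, m)) z : linear (fun y => pT x y z).
Proof.
apply: (lin_comp (@cmx_mull_linear _ A _ _ _ _)).
exact: (lin_comp (actx_linearl msa x) (@hSinv_linear _ U)).
Qed.

Let pT2 m (x : 'M[A]_(n, m)) y : linear (fun z => pT x y z).
Proof.
apply: (lin_comp (@cmx_mulr_linear _ A _ _ _ _)).
exact: (cmx_scal_linear A rho_linear).
Qed.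

Lemma pi_oppE f x : Defs.pi_opp act rho f x =
  (\sum_(p <- hcop f) pT x p.1 p.2 : cmx A n 1).
Proof. by []. Qed.

Lemma pi_linear x : linear (fun f => Defs.pi_opp act rho f x : cmx A n 1).
Proof. exact: (hcop_sum_linear (pT1 x) (pT2 x)). Qed.

Lemma pi1 x : Defs.pi_opp act rho 1 x = x.
Proof.
rewrite pi_oppE (hcop_sum1 (pT1 x) (pT2 x)) /pT hSinv1 rho1 scalmx1.
by rewrite mul1mx (actx1 msa).
Qed.

Lemma piM f g x : Defs.pi_opp act rho (f * g) x = Defs.pi_opp act rho g (Defs.pi_opp act rho f x).
Proof.
rewrite pi_oppE (hcop_sumM (pT1 x) (pT2 x)) exchange_big [RHS]pi_oppE /=.
apply: eq_bigr => p _; rewrite {2}/pT pi_oppE.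
rewrite (lin_sum (W := cmx A n 1) _ _ (actx_linear msa (hSinv p.1) (m := n) (n := 1))).
rewrite mulmx_sumr; apply: eq_bigr => r _; rewrite /pT (actx_sl msa).
by rewrite hSinvM rhoM scalmxM (actxM msa) !mulmxA.
Qed.

Lemma pi_K x : Defs.pi_opp act rho K x = scal (rho K) *m actx Ki x.
Proof. by rewrite pi_oppE (hcop_sumK hU (pT1 x) (pT2 x)) /pT (uq_SiK hU). Qed.

Lemma pi_gen r g x : generator r g -> Defs.pi_opp act rho g x =
  - (scal (r^-1 *: rho K) *m actx g x) + scal (rho g) *m actx K x.
Proof.
move=> hg; have hcopg : Defs.pi_opp act rho g x = pT x g K + pT x Ki g.
  by case: hg => -[_ ->]; rewrite pi_oppE ?(hcop_sumE hU (pT1 x) (pT2 x))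
    ?(hcop_sumF hU (pT1 x) (pT2 x)).
rewrite hcopg /pT (uq_SiKi hU) (gen_Sinv hg); congr (_ + _).
by rewrite scaleNr (actxNl msa) (actxZ msa) mulmxN mulmxCA -scalmxMC.
Qed.

End OppositeRepresentation.

Section Intertwiners.
Variables (m n : nat) (rho2 : U -> 'M[C]_m) (rho1 : U -> 'M[C]_n).
Hypothesis hrho2 : is_opp_star_rep rho2.
Hypothesis hrho1 : is_opp_star_rep rho1.
Variables V X : 'M[A]_(m, n).
Hypothesis XE : actx K V = X.

(** The last condition of Murray-von Neumann equivalence for a single f, asked
    of the columns over the whole of A so as to be multiplicative in f. *)
Definition pi_intertwines f := forall x : 'cV[A]_n,
  Defs.pi_opp act rho2 f (V *m x) = V *m Defs.pi_opp act rho1 f x.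

Lemma actKi_V : X = scal (rho2 K) *m V *m scal (rho1 Ki) ->
  actx Ki V = scal (rho2 Ki) *m V *m scal (rho1 K).
Proof.
move=> XV.
rewrite -[V in LHS](scal_KiK hrho2) -[scal (rho2 K) *m V](scal_KiKr hrho1).
rewrite -XV (actx_sl msa) (actx_sr msa) -XE -(actxM msa Ki) (uq_KiK hU).
by rewrite (actx1 msa) mulmxA.
Qed.

Lemma pi_intertwines_K :
  X = scal (rho2 K) *m V *m scal (rho1 Ki) -> pi_intertwines K.
Proof.
move=> XV x; have KiV := actKi_V XV.
rewrite !pi_K // (actx_mulKi hU msa) KiV -!mulmxA (scal_KKi hrho2) //.
Qed.

Lemma pi_intertwines_gen r g : generator r g ->
    X = scal (rho2 K) *m V *m scal (rho1 Ki) ->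
    actx g X = scal (r *: rho2 g) *m X *m scal (rho1 Ki)
               - scal (rho2 Ki) *m X *m scal (rho1 g) ->
  pi_intertwines g.
Proof.
move=> hg XV gX x; have r0 := gen_neq0 hg.
have KiV := actKi_V XV.
have KX : actx K X = scal (rho2 K) *m X *m scal (rho1 Ki).
  by rewrite {1}XV (actx_sr msa) (actx_sl msa) XE.
have VG : - (scal (r^-1 *: rho2 K) *m actx g V) + scal (rho2 g) *m X =
    V *m scal (rho1 g).
  apply/eqP; rewrite -subr_eq0; apply/eqP; apply: actx_eq0.
  rewrite !(actxD msa) !(actxN msa) (actx_sr msa) !(actx_sl msa) XE KX.
  rewrite (gen_actx_K _ hg) XE scalmxVZ // gX.
  rewrite mulmxBr !mulmxA -!scalmxM (rho_gen_K hrho2 hg) -scalemxAr.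
  rewrite (rho_KKi hrho2) scalmx1 mul1mx opprB.
  by rewrite subrK subrr.
have e Y : scal (r^-1 *: rho2 K) *m (scal (rho2 Ki) *m V *m scal (rho1 K) *m Y) =
    V *m (scal (r^-1 *: rho1 K) *m Y) :> 'cV[A]_m.
  rewrite !scalmxMC mulmxCA -!mulmxA; congr (_ *: _).
  exact: (scal_KKi hrho2).
rewrite !(pi_gen _ _ hg) // (gen_actx_mul _ _ hg) (actx_mulK hU msa) XE KiV.
rewrite mulmxDr e [RHS]mulmxDr [V *m (_ *m actx K x)]mulmxA -VG mulmxN mulmxDl.
by rewrite mulNmx opprD [- _ - _]addrC -addrA -!mulmxA.
Qed.

Lemma pi_intertwines_all : pi_intertwines K -> pi_intertwines E -> pi_intertwines F ->
  forall f, pi_intertwines f.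
Proof.
move=> VK VE VF; apply: (uq_ind hU) => [|z f g hf hg|f g hf hg||||] // x.
- by rewrite !pi1.
- rewrite (pi_linear hrho2) (pi_linear hrho1) hf hg mulmxDr; congr (_ + _).
  by rewrite !cmx_scaleE mulmxCA.
- by rewrite !piM // hf hg.
- rewrite -{1}[x](pi1 hrho1) -(uq_KiK hU) (piM hrho1) -VK -(piM hrho2).
  by rewrite (uq_KKi hU) pi1.
Qed.

End Intertwiners.

(** * Fibres of invariant projections *)

Local Notation is_invP := (is_inv_proj (@hstar _ A) act B (act (K ^+ 2)) (@pos_rep R U K)).
Local Notation invproj := (inv_proj (@hstar _ A) act B (act (K ^+ 2)) (@pos_rep R U K)).
Local Notation dag := (dagger (@hstar _ A) (act (K ^+ 2))).

Lemma mx_in_podles m n (X : 'M[A]_(m, n)) : mx_in B X <-> pdx Ki X = X.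
Proof.
split=> [h|/matrixP h] => [|i j]; last by rewrite podlesE -{2}h mxE.
by apply/matrixP => i j; rewrite mxE; apply/eqP; rewrite -podlesE; exact: h.
Qed.

Lemma epsx_actK m n (X : 'M[A]_(m, n)) : mx_in B X -> epsx (actx K X) = epsx X.
Proof. by move=> h; apply/matrixP => i j; rewrite !mxE heps_podlesK. Qed.

Lemma epsx_actKi m n (X : 'M[A]_(m, n)) : mx_in B X -> epsx (actx Ki X) = epsx X.
Proof. by move=> h; apply/matrixP => i j; rewrite !mxE heps_podlesKi. Qed.

Lemma actx_in m n f (X : 'M[A]_(m, n)) : mx_in B X -> mx_in B (actx f X).
Proof. by move=> h i j; rewrite mxE; exact: podles_act. Qed.

Lemma pdx_scal m n (M : 'M[C]_(m, n)) : pdx Ki (scal M) = scal M.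
Proof.
rewrite -[scal M]mulmx1 pdx_sl; congr (_ *m _).
apply/matrixP => i j; rewrite !mxE; case: (i == j); last exact: (lin0 (pd_linear _)).
by apply/eqP; rewrite mulr1n -t0_1 pd_tKi /dbl /= qh0 scale1r.
Qed.

(** A representation rho of the opposite algebra makes
    f |-> rho (S^-1 (K f K^-1)) a representation of the algebra itself, which
    sends K, E and F to the three matrices below. *)
Definition rep_integrates n (rho : U -> 'M[C]_n) (u : 'M[A]_n) :=
  [/\ is_opp_star_rep rho, pos_rep K rho &
      integrates (rho Ki) (- rho E) (- rho F) 1%:M u].

Lemma rep_integrable n (rho : U -> 'M[C]_n) :
  is_opp_star_rep rho -> pos_rep K rho -> exists u, rep_integrates rho u.
Proof.
move=> hr hp; have H := opp_rep_uq_mx hr hp.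
have [|||||u Iu] := integrate_proj H (p := 1%:M); rewrite ?mul1mx ?mulmx1 ?ctr1 //.
by exists u.
Qed.

Lemma equivariant_gen m n (rho2 : U -> 'M[C]_m) (rho1 : U -> 'M[C]_n) X :
  equivariant (rho2 Ki) (rho2 K) (- rho2 E) (- rho2 F)
              (rho1 Ki) (- rho1 E) (- rho1 F) X <->
  actx K X = scal (rho2 K) *m X *m scal (rho1 Ki) /\
  forall r g, generator r g ->
    actx g X = scal (r *: rho2 g) *m X *m scal (rho1 Ki)
               - scal (rho2 Ki) *m X *m scal (rho1 g).
Proof.
have aux r g : scal (rho2 Ki) *m X *m scal (- rho1 g)
    - scal (r *: - rho2 g) *m X *m scal (rho1 Ki) =
  scal (r *: rho2 g) *m X *m scal (rho1 Ki) - scal (rho2 Ki) *m X *m scal (rho1 g).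
  by rewrite scalerN !scalmxN mulmxN !mulNmx opprK addrC.
split=> [[eK eE eF]|[eK eg]].
  split=> [|r g [] [-> ->]]; first exact: eK.
    by rewrite -(aux Q E); exact: eE.
  by rewrite -(aux Q^-1 F); exact: eF.
split; first exact: eK.
  by rewrite (aux Q E); apply: eg; left.
by rewrite (aux Q^-1 F); apply: eg; right.
Qed.

Section Lift.

(** The matrix over the sphere with fibre w, if w respects weights.  The inner
    factor is [equivariant]; by [actK_lift] the outer factors undo the action of K. *)
Definition fiber_lift m n (rho2 : U -> 'M[C]_m) (rho1 : U -> 'M[C]_n)
    (u2 : 'M[A]_m) (u1 : 'M[A]_n) (w : 'M[C]_(m, n)) : 'M[A]_(m, n) :=
  scal (rho2 Ki) *m (stx u2 *m scal w *m u1) *m scal (rho1 K).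

Variables (m n : nat) (rho2 : U -> 'M[C]_m) (rho1 : U -> 'M[C]_n).
Variables (u2 : 'M[A]_m) (u1 : 'M[A]_n).
Hypothesis J2 : rep_integrates rho2 u2.
Hypothesis J1 : rep_integrates rho1 u1.
Variable w : 'M[C]_(m, n).

Let hr2 : is_opp_star_rep rho2. Proof. by case: J2. Qed.
Let hr1 : is_opp_star_rep rho1. Proof. by case: J1. Qed.
Let H2 : uq_mx q (rho2 Ki) (rho2 K) (- rho2 E) (- rho2 F).
Proof. by apply: opp_rep_uq_mx hr2 _; case: J2. Qed.
Let H1 : uq_mx q (rho1 Ki) (rho1 K) (- rho1 E) (- rho1 F).
Proof. by apply: opp_rep_uq_mx hr1 _; case: J1. Qed.
Let I2 : integrates (rho2 Ki) (- rho2 E) (- rho2 F) 1%:M u2. Proof. by case: J2. Qed.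
Let I1 : integrates (rho1 Ki) (- rho1 E) (- rho1 F) 1%:M u1. Proof. by case: J1. Qed.

Local Notation V := (fiber_lift rho2 rho1 u2 u1 w).
Local Notation X := (stx u2 *m scal w *m u1).

Lemma lift_eqv : equivariant (rho2 Ki) (rho2 K) (- rho2 E) (- rho2 F)
  (rho1 Ki) (- rho1 E) (- rho1 F) X.
Proof. exact: (intertwiner_equivariant H2 I2 I1 w). Qed.

Lemma actK_lift : actx K V = X.
Proof.
rewrite /fiber_lift (actx_sr msa) (actx_sl msa) (eqv_K lift_eqv) -!mulmxA (scal_KiK hr2).
by rewrite -scalmxM (rho_KiK hr1) scalmx1 mulmx1.
Qed.

Lemma lift_actK : X = scal (rho2 K) *m V *m scal (rho1 Ki).
Proof. by rewrite /fiber_lift -!mulmxA (scal_KKi hr2) !mulmxA (scal_KKir hr1). Qed.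

Lemma lift_in : w *m rho1 Ki = rho2 Ki *m w -> mx_in B V.
Proof.
move=> wk; apply/mx_in_podles; rewrite /fiber_lift pdx_sr pdx_sl; congr (_ *m _ *m _).
rewrite !pdx_mulKi (ig_pd I1) pdx_starKi.
have -> : pdx K u2 = scal (rho2 K) *m u2.
  have : pdx K (pdx Ki u2) = u2 by apply/matrixP => i j; rewrite !mxE pd_KKi.
  by rewrite (ig_pd I2) pdx_sl => {2}<-; rewrite (scal_KKi hr2).
rewrite pdx_scal stmxM stmx_scal (ctr_ki H2) !mulmxA; congr (_ *m _).
rewrite -!mulmxA -!scalmxM; congr (_ *m scal _).
by rewrite wk mulmxA (rho_KKi hr2) mul1mx.
Qed.

Lemma lift_intertwines f : pi_intertwines rho2 rho1 V f.
Proof.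
have [eK eg] := (equivariant_gen rho2 rho1 X).1 lift_eqv.
have XV := lift_actK; have VX := actK_lift.
move: f; apply: (pi_intertwines_all hr2 hr1).
- exact: (pi_intertwines_K hr2 hr1 VX XV).
- by apply: (pi_intertwines_gen hr2 hr1 VX _ XV (eg _ _ _)); left.
- by apply: (pi_intertwines_gen hr2 hr1 VX _ XV (eg _ _ _)); right.
Qed.

Lemma eps_lift : w *m rho1 Ki = rho2 Ki *m w -> epsx V = w.
Proof.
move=> wk; rewrite /fiber_lift !epsxM !epsx_scal epsx_star (ig_eps I2) (ig_eps I1) ctr1.
by rewrite mul1mx mulmx1 -wk -mulmxA (rho_KiK hr1) mulmx1.
Qed.

End Lift.

Lemma lift_dagger m n rho2 rho1 (u2 : 'M[A]_m) (u1 : 'M[A]_n) w :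
    rep_integrates rho2 u2 -> rep_integrates rho1 u1 ->
  dag (fiber_lift rho2 rho1 u2 u1 w) = fiber_lift rho1 rho2 u1 u2 (ctr w).
Proof.
move=> J2 J1; rewrite /dagger (actxM msa) (actK_lift J2 J1) (eqv_K (lift_eqv J2 J1 w)).
have [hr2 _ _] := J2; have [hr1 _ _] := J1.
rewrite /fiber_lift !stmxM !stmx_scal stmxK -!(rho_star hr2) -!(rho_star hr1).
by rewrite (uq_starK hU) (uq_starKi hU) !mulmxA.
Qed.

Lemma lift_mul m n p rho3 rho2 rho1 (u3 : 'M[A]_m) (u2 : 'M[A]_n) (u1 : 'M[A]_p) w w' :
    rep_integrates rho2 u2 ->
  fiber_lift rho3 rho2 u3 u2 w *m fiber_lift rho2 rho1 u2 u1 w' = fiber_lift rho3 rho1 u3 u1 (w *m w').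
Proof.
move=> [hr2 _ I2]; rewrite /fiber_lift !mulmxA (scal_KKir hr2).
rewrite -[_ *m u2 *m stx u2]mulmxA (ig_ts I2) scalmx1 mulmx1.
by rewrite -[_ *m scal w *m scal w']mulmxA -scalmxM.
Qed.

(** K acting on P is equivariant, so it is u^* y u with y scalar, and applying the
    counit gives y = eps P. *)
Lemma inv_proj_fiber n (P : 'M[A]_n) rho u : is_invP P rho -> rep_integrates rho u ->
  [/\ epsx P *m epsx P = epsx P, ctr (epsx P) = epsx P,
      epsx P *m rho Ki = rho Ki *m epsx P & P = fiber_lift rho rho u u (epsx P)].
Proof.
move=> hP J; have [hr hp Iu] := J.
have PB := ip_in hP.
have PK : adR act rho K P = P by rewrite (ip_inv hP) (uq_epsK1 hU) !scale1r.
have kP : epsx P = rho K *m epsx P *m rho Ki.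
  by rewrite -{1}(epsx_actK PB) (actK_PE hr PK) !epsxM !epsx_scal.
have H := opp_rep_uq_mx hr hp.
split.
- by rewrite -epsxM (ip_idem hP).
- rewrite -{2}(ip_dagger hP) /dagger epsx_star (actxM msa) epsx_actK ?epsx_actK //.
  exact: actx_in.
- by rewrite {2}kP !mulmxA (rho_KiK hr) mul1mx.
- rewrite /fiber_lift -(epsx_actK PB) {1}(actKi_equiv hr erefl PK); congr (_ *m _ *m _).
  apply: (equivariant_intertwiner H H Iu Iu).
  apply/equivariant_gen; split; first exact: (adR_K_equiv hr erefl PK).
  move=> r g hg; apply/(adR_gen0 hr erefl hg PK).
  by rewrite (ip_inv hP); case: hg => -[_ ->]; rewrite ?(uq_epsE hU) ?(uq_epsF hU) !scale0r.
Qed.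

Lemma lift_inv_proj n rho (u : 'M[A]_n) p : rep_integrates rho u ->
    p *m p = p -> ctr p = p -> p *m rho Ki = rho Ki *m p ->
  is_invP (fiber_lift rho rho u u p) rho.
Proof.
move=> J pp pa pk; have [hr hp Iu] := J.
have [eK eg] := (equivariant_gen rho rho _).1 (lift_eqv J J p).
have PK : adR act rho K (fiber_lift rho rho u u p) = fiber_lift rho rho u u p.
  by rewrite (adR_K hr) (actK_lift J J).
have Pg r g : generator r g -> adR act rho g (fiber_lift rho rho u u p) = 0.
  by move=> hg; apply/(adR_gen0 hr (actK_lift J J p) hg PK); exact: eg.
split=> //.
- exact: (lift_in J J pk).
- by rewrite (lift_mul _ _ _ _ _ _ J) pp.
- by rewrite (lift_dagger _ J J) pa.
- apply: (adR_invariant hr PK).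
  + by apply: (Pg Q); left.
  + by apply: (Pg Q^-1); right.
Qed.

(** * Weights of invariant projections *)

Lemma scal_in m n (M : 'M[C]_(m, n)) : mx_in B (scal M).
Proof. by apply/mx_in_podles; exact: pdx_scal. Qed.

Lemma invproj_integrable (P : invproj) : exists u, rep_integrates (ip_rep P) u.
Proof.
have hP := ip_prop P.
exact: rep_integrable (ip_star_rep hP) (ip_adm hP).
Qed.

Lemma ctr_rho_Ki n (rho : U -> 'M[C]_n) : is_opp_star_rep rho -> ctr (rho Ki) = rho Ki.
Proof. by move=> hr; rewrite -(rho_star hr) (uq_starKi hU). Qed.

Lemma epsx_dagger m n (V : 'M[A]_(m, n)) : mx_in B V -> epsx (dag V) = ctr (epsx V).
Proof.
move=> hV; rewrite /dagger epsx_star (actxM msa) epsx_actK ?epsx_actK //.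
exact: actx_in.
Qed.

(** The fibre of V intertwines the weights: evaluate the condition for f = K on
    constant columns, on which K acts trivially. *)
Lemma mvn_fiber (P P' : invproj) : mvn_equiv P P' ->
  exists w : 'M[C]_(ip_size P', ip_size P),
    [/\ ctr w *m w = epsx (ip_mx P), w *m ctr w = epsx (ip_mx P')
      & w *m ip_rep P Ki = ip_rep P' Ki *m w].
Proof.
move=> [V [VB VP VP' Vf]]; exists (epsx V).
have hr := ip_star_rep (ip_prop P).
have hr' := ip_star_rep (ip_prop P').
rewrite -(epsx_dagger VB) -!epsxM VP VP'; split=> //.
have wK : ip_rep P' K *m epsx V = epsx V *m ip_rep P K.
  apply/matrixP => i j.
  pose x : 'cV[C]_(ip_size P) := delta_mx j 0.
  have := congr1 (fun M : 'cV[A]__ => epsx M i 0) (Vf K (scal x) (scal_in x)).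
  rewrite !(pi_K hr') !(pi_K hr) (actx_mulKi hU msa) (actx_s msa) (uq_epsKi hU) scale1r.
  rewrite !epsxM !epsx_scal epsx_actKi // !mulmxA -!colE !mxE.
  by [].
have := congr1 (fun M => ip_rep P' Ki *m M *m ip_rep P Ki) wK.
rewrite /= !mulmxA (rho_KiK hr') mul1mx => ->.
by rewrite -!mulmxA (rho_KKi hr) mulmx1.
Qed.

(** The equivalence is the lift of w. *)
Lemma fiber_mvn (P P' : invproj) (w : 'M[C]_(ip_size P', ip_size P)) :
    ctr w *m w = epsx (ip_mx P) -> w *m ctr w = epsx (ip_mx P') ->
    w *m ip_rep P Ki = ip_rep P' Ki *m w ->
  mvn_equiv P P'.
Proof.
move=> wP wP' wk.
have [u J] := invproj_integrable P; have [u' J'] := invproj_integrable P'.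
have [_ _ _ EP] := inv_proj_fiber (ip_prop P) J.
have [_ _ _ EP'] := inv_proj_fiber (ip_prop P') J'.
exists (fiber_lift (ip_rep P') (ip_rep P) u' u w); split.
- exact: (lift_in J' J wk).
- by rewrite (lift_dagger _ J' J) (lift_mul _ _ _ _ _ _ J') wP -EP.
- by rewrite (lift_dagger _ J' J) (lift_mul _ _ _ _ _ _ J) wP' -EP'.
- by move=> f x _; exact: (lift_intertwines J' J w f x).
Qed.

Definition inv_weights (P : invproj) r (g : 'I_r -> int) :=
  has_weights q (epsx (ip_mx P)) (ip_rep P Ki) g.

Lemma inv_weights_exist (P : invproj) :
  exists x : {freeg int}, exists r (g : 'I_r -> int),
    inv_weights P g /\ x = \sum_i << g i >>.
Proof.
have [u J] := invproj_integrable P.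
have [pp pa pk _] := inv_proj_fiber (ip_prop P) J.
have H := opp_rep_uq_mx (ip_star_rep (ip_prop P)) (ip_adm (ip_prop P)).
have [r [g hg]] := weights_exist hq0 hq1 H pp pa pk.
by exists (\sum_i << g i >>), r, g.
Qed.

Definition wt (P : invproj) : {freeg int} := projT1 (cid (inv_weights_exist P)).

Lemma inv_weights_mvn (P P' : invproj) r (g : 'I_r -> int) r' (g' : 'I_r' -> int) :
    inv_weights P g -> inv_weights P' g' -> mvn_equiv P P' ->
  \sum_i << g i >> = \sum_i << g' i >> :> {freeg int}.
Proof.
move=> hg hg' /mvn_fiber [w [w1 w2 wk]].
apply: (weights_unique hq0 hq1 hg hg' _ w1 w2 wk).
exact: ctr_rho_Ki (ip_star_rep (ip_prop P)).
Qed.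

Lemma inv_weights_eq_mvn (P P' : invproj) r (g : 'I_r -> int) :
  inv_weights P g -> inv_weights P' g -> mvn_equiv P P'.
Proof.
move=> hg hg'.
have [w [w1 w2 wk]] := weights_fiber hg hg' (ctr_rho_Ki (ip_star_rep (ip_prop P'))).
exact: (fiber_mvn w1 w2 wk).
Qed.

Lemma wtE (P : invproj) r (g : 'I_r -> int) : inv_weights P g -> wt P = \sum_i << g i >>.
Proof.
move=> hg; rewrite /wt; case: (cid _) => x /= [r' [g' [hg' ->]]].
apply: (inv_weights_mvn hg' hg (inv_weights_eq_mvn hg hg)).
Qed.

Lemma wtP (P : invproj) : exists r (g : 'I_r -> int), inv_weights P g.
Proof. by have [_ [r [g [hg _]]]] := inv_weights_exist P; exists r, g. Qed.

Lemma wt_mvn (P P' : invproj) : mvn_equiv P P' -> wt P = wt P'.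
Proof.
move=> h; have [r [g hg]] := wtP P; have [r' [g' hg']] := wtP P'.
by rewrite (wtE hg) (wtE hg'); exact: inv_weights_mvn hg hg' h.
Qed.

Lemma epsx_dsum m n (P : 'M[A]_m) (P' : 'M[A]_n) :
  epsx (dsum_mx P P') = block_mx (epsx P) 0 0 (epsx P').
Proof.
rewrite /dsum_mx map_block_mx; congr block_mx;
  by apply/matrixP => i j; rewrite !mxE (lin0 (@heps_linear _ A)).
Qed.

Lemma inv_weights_dsum (P P' : invproj)
    (h : is_invP (dsum_mx (ip_mx P) (ip_mx P')) (dsum_rep (ip_rep P) (ip_rep P')))
    r (g : 'I_r -> int) r' (g' : 'I_r' -> int) :
  inv_weights P g -> inv_weights P' g' -> inv_weights (InvProj h) (sum_fun g g').
Proof.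
move=> hg hg'; rewrite /inv_weights /= epsx_dsum.
exact: has_weights_sum hg hg'.
Qed.

Lemma sum_fun_freeg r r' (g : 'I_r -> int) (g' : 'I_r' -> int) :
  \sum_i << sum_fun g g' i >> = \sum_i << g i >> + \sum_i << g' i >> :> {freeg int}.
Proof.
rewrite big_split_ord /=; congr (_ + _); apply: eq_bigr => i _.
  by rewrite sum_funl.
by rewrite sum_funr.
Qed.

Lemma wt_dsum (P P' : invproj)
    (h : is_invP (dsum_mx (ip_mx P) (ip_mx P')) (dsum_rep (ip_rep P) (ip_rep P'))) :
  wt (InvProj h) = wt P + wt P'.
Proof.
have [r [g hg]] := wtP P; have [r' [g' hg']] := wtP P'.
by rewrite (wtE hg) (wtE hg') (wtE (inv_weights_dsum h hg hg')) sum_fun_freeg.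
Qed.

(** * The projections P_N and the K_0-group *)

Section Lines.
Variable sigma : forall L : nat, U -> 'M[C]_L.+1.
Hypothesis hsigma : is_spin_rep q t act sigma.

Lemma actx_sigma L f : actx f (t L) = t L *m scal (sigma L f).
Proof.
apply/matrixP => i j; rewrite !mxE {1}pw_tE (linZ _ _ (act_linear msa f)) hsigma.
rewrite scaler_sumr; apply: eq_bigr => k _; rewrite pw_vE !scalerA !mxE mulr_algr.
by rewrite mulrAC mulVf ?mul1r // pw_cst_neq0.
Qed.

Lemma sigmaE L f : sigma L f = epsx (actx f (t L)).
Proof. by rewrite actx_sigma epsxM epsx_scal epsx_t mul1mx. Qed.

Lemma sigma_gen L f (M : 'M[C]_L.+1) : actx f (t L) = t L *m scal M -> sigma L f = M.
Proof. by move=> h; rewrite sigmaE h epsxM epsx_scal epsx_t mul1mx. Qed.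

Lemma sigmaM L f g : sigma L (f * g) = sigma L f *m sigma L g.
Proof.
apply: sigma_gen; rewrite (actxM msa) [actx g _]actx_sigma (actx_sr msa) actx_sigma.
by rewrite -mulmxA scalmxM.
Qed.

Lemma sigma1 L : sigma L 1 = 1%:M.
Proof. by apply: sigma_gen; rewrite (actx1 msa) scalmx1 mulmx1. Qed.

Lemma sigma_linear L : linear (sigma L).
Proof.
move=> z f g; apply/matrixP => i j.
by rewrite !sigmaE !mxE (act_linearl msa) hepsP.
Qed.

Lemma sigmaZ L z f : sigma L (z *: f) = z *: sigma L f.
Proof. exact: linZ (sigma_linear L). Qed.

Local Notation rhoL := (@rho_opp R U K Ki sigma).

Lemma rhoL_Ki L : rhoL L Ki = spinK q L.
Proof.
rewrite /rho_opp (uq_SKi hU) (uq_KiK hU) mul1r; apply: sigma_gen.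
exact: actx_tK.
Qed.

Lemma rhoL_E L : rhoL L E = - spinE q L.
Proof.
have Q0 := qc_neq0 hq0; have rel := uq_rel hU.
have -> : rhoL L E = - sigma L E.
  rewrite /rho_opp (uq_SE hU) -scalerAr -scalerAl sigmaZ -mulrA.
  have -> : E * K = Q^-1 *: (K * E) by rewrite (uqr_KE rel) scalerA mulVf // scale1r.
  by rewrite -scalerAr mulrA (uq_KiK hU) mul1r sigmaZ scalerA mulNr divff // scaleN1r.
congr (- _); apply: sigma_gen; exact: actx_tE.
Qed.

Lemma rhoL_F L : rhoL L F = - spinF q L.
Proof.
have Q0 := qc_neq0 hq0; have rel := uq_rel hU.
have -> : rhoL L F = - sigma L F.
  rewrite /rho_opp (uq_SF hU) -scalerAr -scalerAl sigmaZ -mulrA (uqr_FK rel).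
  rewrite -scalerAr mulrA (uq_KiK hU) mul1r sigmaZ scalerA mulNr fmorphV mulVf //.
  by rewrite scaleN1r.
congr (- _); apply: sigma_gen; exact: actx_tF.
Qed.

Lemma rhoL_opp_star_rep L : is_opp_star_rep (rhoL L).
Proof.
have rl z f g : rhoL L (z *: f + g) = z *: rhoL L f + rhoL L g.
  by rewrite /rho_opp hSP mulrDr mulrDl -scalerAr -scalerAl sigma_linear.
have r1 : rhoL L 1 = 1%:M by rewrite /rho_opp hS1 mulr1 (uq_KiK hU) sigma1.
have rM f g : rhoL L (f * g) = rhoL L g *m rhoL L f.
  rewrite /rho_opp hSM -sigmaM; congr (sigma L _).
  by rewrite -!mulrA; congr (_ * (_ * _)); rewrite [K * (Ki * _)]mulrA (uq_KKi hU) mul1r.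
have rKKi : rhoL L K *m rhoL L Ki = 1%:M by rewrite -rM (uq_KiK hU).
have rKiK : rhoL L Ki *m rhoL L K = 1%:M by rewrite -rM (uq_KKi hU).
have sKi : rhoL L Ki = ctr (rhoL L Ki) by rewrite rhoL_Ki ctr_spinK.
have sK : rhoL L K = ctr (rhoL L K).
  rewrite -[RHS]mul1mx -{1}rKKi -mulmxA {1}sKi -ctrM rKKi.
  by rewrite ctr1 mulmx1.
split=> //; apply: (uq_ind hU) => [|z f g hf hg|f g hf hg||||].
- by rewrite hstar1 r1 /adjmx -/(ctr _) ctr1.
- have [stl _ _] := hstarP U; rewrite stl !rl hf hg.
  by rewrite -![adjmx _]/(ctr _) ctrD ctrZ.
- have [_ stM _] := hstarP U; rewrite stM !rM hf hg.
  by rewrite -![adjmx _]/(ctr _) ctrM.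
- by rewrite (uq_starE hU) rhoL_E rhoL_F -[adjmx _]/(ctr _) ctrN ctr_spinE.
- by rewrite (uq_starF hU) rhoL_E rhoL_F -[adjmx _]/(ctr _) ctrN ctr_spinF.
- by rewrite (uq_starK hU).
- by rewrite (uq_starKi hU).
Qed.

Lemma rhoL_pos L : pos_rep K (rhoL L).
Proof.
move=> z /eigenvalueP [v vz v0].
have hr := rhoL_opp_star_rep L.
have z0 : z != 0.
  apply: contra v0 => /eqP z0.
  by rewrite -[v]mulmx1 -(rho_KKi hr) mulmxA vz z0 scale0r mul0mx.
have [i vi] : exists i, v 0 i != 0.
  apply/existsP; apply: contraR v0; rewrite negb_exists => /forallP h.
  by apply/eqP/rowP => i; rewrite mxE; apply/eqP; rewrite -[_ == _]negbK h.
have vk : v *m rhoL L Ki = z^-1 *: v.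
  have vE : v = z^-1 *: (v *m rhoL L K) by rewrite vz scalerA mulVf // scale1r.
  by rewrite {1}vE -scalemxAl -mulmxA (rho_KKi hr) mulmx1.
have := congr1 (fun w : 'rV[C]_L.+1 => w 0 i) vk.
rewrite /= rhoL_Ki mul_mx_diag !mxE mulrC => /(mulIf vi) h.
by rewrite -invr_gt0 -h qh_gt0.
Qed.

Lemma rhoL_integrates L : rep_integrates (rhoL L) (t L).
Proof.
split; [exact: rhoL_opp_star_rep|exact: rhoL_pos|].
by rewrite rhoL_Ki rhoL_E rhoL_F !opprK; exact: spin_integrates.
Qed.

Lemma row_scal m n i (X : 'M[A]_(m, n)) : row i X = scal (delta_mx 0 i) *m X.
Proof.
rewrite rowE; congr (_ *m _); apply/matrixP => j k.
by rewrite !mxE /= scaler_nat.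
Qed.

Lemma ctr_delta m n i j : ctr (delta_mx i j : 'M[C]_(m, n)) = delta_mx j i.
Proof. by apply/matrixP => k l; rewrite !mxE conjC_nat andbC. Qed.

Lemma dbl_extremal N : dbl (extremal_idx N) = N.
Proof.
rewrite /extremal_idx /dbl; case: ifP => h /=; last by lia.
by lia.
Qed.

(** The fibre of P_N is the highest weight line of spin |N|/2 for N >= 0, and its
    lowest weight line for N < 0. *)
Lemma podles_projE N : podles_proj K Ki t sigma N =
  fiber_lift (rhoL `|N|%N) (rhoL `|N|%N) (t `|N|%N) (t `|N|%N)
       (delta_mx (extremal_idx N) (extremal_idx N)).
Proof.
rewrite /podles_proj /fiber_lift row_scal stmxM stmx_scal ctr_delta !mulmxA.
congr (_ *m _ *m _); rewrite -!mulmxA -[in RHS](mul_delta_mx (0 : 'I_1)) scalmxM.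
by rewrite !mulmxA.
Qed.

Lemma extremal_comm N (i := extremal_idx N) :
  delta_mx i i *m rhoL `|N|%N Ki = rhoL `|N|%N Ki *m delta_mx i i.
Proof.
rewrite rhoL_Ki; apply/matrixP => j k; rewrite mul_mx_diag mul_diag_mx !mxE.
by case: eqP => [->|_]; case: eqP => [->|_]; rewrite ?mul0r ?mulr0 ?mul1r ?mulr1.
Qed.

Lemma podles_proj_inv N : is_invP (podles_proj K Ki t sigma N) (rhoL `|N|%N).
Proof.
rewrite podles_projE; apply: lift_inv_proj (rhoL_integrates _) _ _ (extremal_comm N).
  by rewrite mul_delta_mx.
by rewrite ctr_delta.
Qed.

Local Notation line := (fun N => InvProj (podles_proj_inv N) : invproj).

Lemma line_weights N : inv_weights (line N) (fun _ : 'I_1 => N).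
Proof.
rewrite /inv_weights /= podles_projE.
rewrite (eps_lift (rhoL_integrates _) (rhoL_integrates _) (extremal_comm N)) rhoL_Ki.
exists (delta_mx 0 (extremal_idx N)); rewrite ctr_delta !mul_delta_mx; split=> //.
  by apply/matrixP => i j; rewrite !ord1 !mxE.
apply/matrixP => i j; rewrite weight_mxE mul_mx_diag !mxE.
case: eqP => _ /=; last by rewrite mul0r mulr0.
by case: eqP => [->|_]; rewrite ?mul0r ?mulr0 // dbl_extremal mulrC.
Qed.

Local Notation cls P := (@K0_class _ _ _ (@hstar _ A) act B (act (K ^+ 2)) (@pos_rep R U K) P).

Lemma pi_K0_rel (x y : {freeg invproj}) : K0_rel (x - y) ->
  \pi_(equivK0 (@hstar _ A) act B (act (K ^+ 2)) (@pos_rep R U K)) x =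
  \pi_(equivK0 (@hstar _ A) act B (act (K ^+ 2)) (@pos_rep R U K)) y.
Proof.
move=> h; apply/eqP; rewrite -Quotient.idealrBE; exact/asboolP.
Qed.

Lemma class_mvn (P P' : invproj) : mvn_equiv P P' -> cls P = cls P'.
Proof. by move=> h; apply: pi_K0_rel; exact: K0_rel_mvn. Qed.

Lemma class_dsum (P P' : invproj)
    (h : is_invP (dsum_mx (ip_mx P) (ip_mx P')) (dsum_rep (ip_rep P) (ip_rep P'))) :
  cls (InvProj h) = cls P + cls P'.
Proof.
rewrite /K0_class -raddfD; apply: pi_K0_rel; rewrite opprD addrA.
exact: K0_rel_dsum.
Qed.

Lemma dsum_inv (P P' : invproj) :
  is_invP (dsum_mx (ip_mx P) (ip_mx P')) (dsum_rep (ip_rep P) (ip_rep P')).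
Proof.
apply: dsum_is_inv_proj (ip_prop P) (ip_prop P').
- by rewrite podlesE (lin0 (pd_linear _)).
- exact: hstar0.
- exact: (act0 msa).
- exact: (act0 msa).
- exact: pos_rep_dsum.
Qed.

Lemma inv_proj_size0 (X : 'M[A]_0) (rho : U -> 'M[C]_0) : is_invP X rho.
Proof.
by split; first (by move=> []); try (by rewrite [LHS]flatmx0 [RHS]flatmx0);
  [split=> *; rewrite [LHS]flatmx0 [RHS]flatmx0
  |move=> z /eigenvalueP [v _]; rewrite [v]thinmx0 eqxx
  |move=> f; rewrite [LHS]flatmx0 [RHS]flatmx0].
Qed.

Lemma weights_size0 (X : 'M[A]_0) (rho : U -> 'M[C]_0) (h : is_invP X rho)
  (g : 'I_0 -> int) : inv_weights (InvProj h) g.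
Proof. by exists 0; split; rewrite [LHS]flatmx0 [RHS]flatmx0. Qed.

(** An empty projection Z is equivalent to the direct sum of Z with itself. *)
Lemma class_size0 (X : 'M[A]_0) (rho : U -> 'M[C]_0) (h : is_invP X rho) :
  cls (InvProj h) = 0.
Proof.
pose Z : invproj := InvProj h; pose g (i : 'I_0) : int := 0.
have e := class_dsum (dsum_inv Z Z).
have : cls (InvProj (dsum_inv Z Z)) = cls Z.
  apply: class_mvn; apply: (@inv_weights_eq_mvn _ _ 0%N g); exact: weights_size0.
by rewrite e => /eqP; rewrite -subr_eq0 addrK => /eqP.
Qed.

(** By additivity, starting from an empty projection. *)
Lemma sum_of_lines r (g : 'I_r -> int) : exists P : invproj,
  inv_weights P g /\ cls P = \sum_i cls (line (g i)).
Proof.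
elim: r g => [|r IH] g.
  exists (InvProj (inv_proj_size0 0 (fun _ => 0))); split; first exact: weights_size0.
  by rewrite big_ord0 class_size0.
have [P [hP eP]] := IH (g \o fintype.lift ord0).
exists (InvProj (dsum_inv (line (g ord0)) P)); split.
  have gE : g = sum_fun (fun _ : 'I_1 => g ord0) (g \o fintype.lift ord0).
    apply/funext => i; case: (split_ordP (m := 1) i) => j ->.
      by rewrite sum_funl ord1 lshift0.
    by rewrite sum_funr rshift1.
  rewrite [X in inv_weights _ X]gE.
  exact: inv_weights_dsum (line_weights _) hP.
by rewrite class_dsum eP big_ord_recl.
Qed.

Lemma equivK0_free : exists2 phi : {additive
      equivK0 (@hstar _ A) act (podles K pd) (act (K ^+ 2)) (@pos_rep R U K)
      -> {freeg int}},
    bijective phi & forall N : int, phi (cls (line N)) = << N >>.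
Proof.
apply: (@K0_free _ _ _ _ _ _ _ _ _ wt (fun N => line N)).
- exact: wt_mvn.
- exact: wt_dsum.
- by move=> N; rewrite (wtE (line_weights N)) big_ord1.
- move=> P; have [r [g hg]] := wtP P; have [P' [hP' eP']] := sum_of_lines g.
  rewrite (wtE hg) (class_mvn (inv_weights_eq_mvn hg hP')) eP'.
  exact: K0_of_weights_sum.
Qed.

End Lines.

End PeterWeyl.

Theorem proposition3p8 (R : realType) (q : R) (hq0 : 0 < q) (hq1 : q != 1)
  (U : hopfStarAlg R[i]) (E F K Ki : U) (hU : is_uq_su2 q E F K Ki)
  (A : hopfStarAlg R[i]) (a b c d : A) (hA : is_osuq2 q a b c d)
  (t : forall L : nat, 'M[A]_L.+1) (ht : is_peter_weyl a b c d t)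
  (act : U -> A -> A) (hact : is_left_action q E F K t act)
  (pd : U -> A -> A) (hpd : is_partial_action q K t act pd)
  (sigma : forall L : nat, U -> 'M[R[i]]_L.+1)
  (hsigma : is_spin_rep q t act sigma) :
  exists hP : forall N : int,
      is_inv_proj (@hstar _ A) act (podles K pd) (act (K ^+ 2))
        (@pos_rep R U K) (podles_proj K Ki t sigma N)
        (@rho_opp R U K Ki sigma `|N|%N),
  exists2 phi : {additive
      equivK0 (@hstar _ A) act (podles K pd) (act (K ^+ 2)) (@pos_rep R U K)
      -> {freeg int}},
    bijective phi & forall N : int, phi (K0_class (InvProj (hP N))) = << N >>.
Proof.
exists (podles_proj_inv hq0 hq1 hU ht hact hpd hsigma).
exact: equivK0_free.
Qed.
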